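(* Let $\mathfrak g$ be a classical Lie superalgebra over $\mathbb K$, not of type $A(1,1)$, $P(3)$, $Q(n)$, nor $D(2,1;a)$ with $a\notin\mathbb Z$, and fix a Chevalley basis $\{H_1,\dots,H_\ell\}\sqcup\{X_\alpha\}_{\alpha\in\Delta}$ of $\mathfrak g$. Then the Kostant superalgebra $K_{\mathbb Z}(\mathfrak g)$ is a free $\mathbb Z$-module. For any given total order $\preceq$ of the set $\Delta\cup\{1,\dots,\ell\}$, a $\mathbb Z$-basis of $K_{\mathbb Z}(\mathfrak g)$ is the set $\mathcal B$ of ordered ''PBW-like monomials'', i.e. all products (without repetitions) of factors of type $X_\alpha^{(n_\alpha)}$, $\binom{H_i}{n_i}$ and $X_\gamma$, with $\alpha\in\Delta_0$, $i\in\{1,\dots,\ell\}$, $\gamma\in\Delta_1$ and $n_\alpha,n_i\in\mathbb N$, taken in the right order with respect to $\preceq$.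
   Context: $\mathbb K$ is an algebraically closed field of characteristic $0$. A finite dimensional non-Abelian Lie superalgebra $\mathfrak g=\mathfrak g_0\oplus\mathfrak g_1$ over $\mathbb K$ is classical if it has no nontrivial homogeneous ideals and $\mathfrak g_1$ is completely reducible as a $\mathfrak g_0$-module; by Kac these are the simple Lie algebras and $A(m,n),B(m,n),C(n),D(m,n),F(4),G(3),D(2,1;a),P(n),Q(n)$ (Kac's notation), where $P(n)=\big\{\begin{pmatrix}A&B\\C&-A^t\end{pmatrix}: A\in\mathfrak{sl}(n+1),\,B^t=B,\,C^t=-C\big\}$. Roots. $\mathfrak h$ is a fixed Cartan subalgebra of $\mathfrak g_0$; $\mathfrak g_\alpha=\{x\in\mathfrak g: [h,x]=\alpha(h)x\ \forall h\in\mathfrak h\}$; $\Delta_0=\{\alpha\ne0:\mathfrak g_\alpha\cap\mathfrak g_0\neq0\}$, $\Delta_1=\{\alpha:\mathfrak g_\alpha\cap\mathfrak g_1\ne0\}$, $\Delta=\Delta_0\cup\Delta_1$; $\ell=\dim\mathfrak h$. On $\mathfrak h$ and $\mathfrak h^*$ one has a nondegenerate symmetric form $(\ ,\ )$: the restriction of an even nondegenerate invariant form on $\mathfrak g$ if $\mathfrak g$ is not of type $P(n)$, and the one coming from $\mathfrak g_0\cong\mathfrak{sl}(n+1)$ for $P(n)$. Fix a distinguished simple root system $\Pi$ (all its elements even except one, if $\mathfrak g_1\neq0$; every root is a sum of elements of $\Pi$, ''positive'', or the opposite of such a sum, ''negative''); $\Delta^\pm$ are the positive/negative roots, $\Delta_i^\pm=\Delta^\pm\cap\Delta_i$.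 Coroots. If $\mathfrak g$ is not of type $P(n)$, $H_\alpha\in\mathfrak h$ is proportional to the element dual to $\alpha$ under the form, normalized by $\alpha(H_\alpha)=2$ if $(\alpha,\alpha)\ne0$, and, if $(\alpha,\alpha)=0$, so that the numbers $\beta(H_\alpha)$ $(\beta\in\Delta)$ generate $\mathbb Z$ (unique up to an immaterial sign, with $H_{-\alpha}=-H_\alpha$). For $P(n)$, with $\varepsilon_i$ the diagonal coordinates, the even roots are $\alpha_{i,j}=\varepsilon_i-\varepsilon_j$ with usual coroots, the odd ones are $\pm\beta_{i,j}$, $\beta_{i,j}=\beta_{j,i}=\varepsilon_i+\varepsilon_j$ $(i<j)$, and $\gamma_i=2\varepsilon_i$; the positive odd roots are the $\beta_{i,j}$ and $\gamma_i$; $H_{\pm\beta_{i,j}}:=\pm H_{\alpha_{i,j}}$ $(i<j)$; sums and strings of roots of $P(n)$ are computed formally in the free $\mathbb Z$-module on $\varepsilon_1,\dots,\varepsilon_{n+1}$. The $\alpha$-string through $\beta$ is $\{\beta-r\alpha,\dots,\beta+q\alpha\}$ with $r,q\geq0$ largest such that $\beta+j\alpha\in\Delta\cup\{0\}$ for $-r\le j\le q$. A Chevalley basis of $\mathfrak g$ is a homogeneous $\mathbb K$-basis $\{H_1,\dots,H_\ell\}\sqcup\{X_\alpha\}_{\alpha\in\Delta}$ such that: (a) $\{H_i\}$ is a $\mathbb K$-basis of $\mathfrak h$, and $\mathfrak h_{\mathbb Z}:=\mathrm{Span}_{\mathbb Z}(H_1,\dots,H_\ell)=\mathrm{Span}_{\mathbb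 Z}\{H_\alpha:\alpha\in\Delta\cap(-\Delta)\}$; (b) $[H_i,H_j]=0$, $[H_i,X_\alpha]=\alpha(H_i)X_\alpha$; (c) $[X_\alpha,X_{-\alpha}]=\sigma_\alpha H_\alpha$ for $\alpha\in\Delta\cap(-\Delta)$, with $\sigma_\alpha=-1$ if $\alpha\in\Delta_1^-$ and $\sigma_\alpha=1$ otherwise; (d) $[X_\alpha,X_\beta]=c_{\alpha,\beta}X_{\alpha+\beta}$ for $\alpha\ne-\beta$, where: if $\alpha+\beta\notin\Delta$, then $c_{\alpha,\beta}=0$, $X_{\alpha+\beta}:=0$; if $\alpha+\beta\in\Delta$ and $(\alpha,\alpha)\ne0$ or $(\beta,\beta)\neq0$, then $c_{\alpha,\beta}=\pm(r+1)$ with $r$ from the $\alpha$-string through $\beta$, except that $c_{\alpha,\beta}=\pm(r+2)$ if $\mathfrak g=P(n)$, $\alpha=\beta_{j,i}$, $\beta=\alpha_{i,j}$; if $\alpha+\beta\in\Delta$ and $(\alpha,\alpha)=0=(\beta,\beta)$, then $c_{\alpha,\beta}=\pm\beta(H_\alpha)$. Kostant superalgebra. In the universal enveloping superalgebra $U(\mathfrak g)$ put $X_\alpha^{(n)}:=X_\alpha^n/n!$ ($\alpha\in\Delta_0$, $n\in\mathbb N$) and $\binom{H}{n}:=H(H-1)\cdots(H-n+1)/n!$. $K_{\mathbb Z}(\mathfrak g)$ is the unital $\mathbb Z$-subsuperalgebra of $U(\mathfrak g)$ generated by all $X_\alpha^{(n)}$, $X_\gamma$, $\binom{H_i}{n}$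 with $\alpha\in\Delta_0$, $n\in\mathbb N$, $\gamma\in\Delta_1$, $i=1,\dots,\ell$. *)

(* Defs.v *)
From mathcomp Require Export all_boot all_order all_algebra.

Set Implicit Arguments.
Unset Strict Implicit.
Unset Printing Implicit Defensive.

Import Order.TTheory GRing.Theory Num.Theory.
Local Open Scope ring_scope.

(* Finite-dimensional Lie superalgebras. [spart g b] is the homogeneous part of
   parity b (false = even, true = odd). These axioms are the right ones away
   from characteristics 2 and 3; they are only used in characteristic 0. *)
Record lieSuper (K : fieldType) := LieSuper {
  scar :> vectType K;
  spart : bool -> {vspace scar};
  sbr : scar -> scar -> scar;
  spart_sum : (spart false + spart true = fullv)%VS;
  spart_direct : (spart false :&: spart true = 0)%VS;
  sbr_linl : forall y, linear (fun x => sbr x y);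
  sbr_linr : forall x, linear (fun y => sbr x y);
  sbr_part : forall a b x y,
    x \in spart a -> y \in spart b -> sbr x y \in spart (a (+) b);
  sbr_anti : forall a b x y,
    x \in spart a -> y \in spart b ->
    sbr x y = - ((-1) ^+ (a && b) *: sbr y x);
  sbr_jacobi : forall a b x y z,
    x \in spart a -> y \in spart b ->
    sbr x (sbr y z) = sbr (sbr x y) z + (-1) ^+ (a && b) *: sbr y (sbr x z)
}.

Section Classical.
Variables (K : fieldType) (g : lieSuper K).

Definition homogeneous_ideal (W : {vspace g}) :=
  W = ((W :&: spart g false) + (W :&: spart g true))%VS /\
  forall x y, y \in W -> sbr x y \in W.

Definition submodule_of_odd (W : {vspace g}) :=
  (W <= spart g true)%VS /\
  forall x y, x \in spart g false -> y \in W -> sbr x y \in W.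

Definition classical :=
  [/\ exists x y : g, sbr x y <> 0,
      forall W, homogeneous_ideal W -> W = 0%VS \/ W = fullv
    & forall W, submodule_of_odd W -> exists W' : {vspace g},
        [/\ submodule_of_odd W', (W + W')%VS = spart g true
          & (W :&: W')%VS = 0%VS] ].

End Classical.

(* Matrix models. Matrices of size m + n carry the block grading of gl(m|n). *)
Section Models.
Variable K : fieldType.

Definition smx_part m n (b : bool) (M : 'M[K]_(m + n)) : 'M[K]_(m + n) :=
  if b then block_mx 0 (ursubmx M) (dlsubmx M) 0
  else block_mx (ulsubmx M) 0 0 (drsubmx M).

(* MN - (-1)^{|M||N|} NM, extended bilinearly. *)
Definition smx_br m n (M N : 'M[K]_(m + n)) : 'M[K]_(m + n) :=
  \sum_(a : bool) \sum_(b : bool)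
    (smx_part a M *m smx_part b N
     - (-1) ^+ (a && b) *: (smx_part b N *m smx_part a M)).

(* psi induces an isomorphism from the quotient S / Z onto g, where S is a
   sub-superalgebra of gl(m|n) and Z an ideal of S; the values of psi outside S
   are irrelevant. *)
Definition mx_model (g : lieSuper K) m n (S Z : 'M[K]_(m + n) -> Prop)
    (psi : 'Hom('M[K]_(m + n), g)) :=
  [/\ forall b M, S M -> smx_part b M = M -> psi M \in spart g b,
      forall M N, S M -> S N -> psi (smx_br M N) = sbr (psi M) (psi N),
      forall x, exists2 M, S M & psi M = x
    & forall M, S M -> (psi M = 0 <-> Z M) ].

Definition is_scalar m (M : 'M[K]_m) : Prop := exists a, M = a%:M.

(* A(m, m) = sl(m+1|m+1) / scalars, for m = 1. *)
Definition sl22_mx (M : 'M[K]_(2 + 2)) := \tr (ulsubmx M) = \tr (drsubmx M).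

Definition type_A11 (g : lieSuper K) :=
  exists psi, @mx_model g 2 2 sl22_mx (@is_scalar (2 + 2)) psi.

Definition Q_mx n (M : 'M[K]_(n.+1 + n.+1)) :=
  [/\ ulsubmx M = drsubmx M, ursubmx M = dlsubmx M & \tr (ursubmx M) = 0].

(* Kac's Q(n), n >= 2: the quotient by the centre, which consists of scalars. *)
Definition type_Q n (g : lieSuper K) :=
  exists psi, @mx_model g n.+1 n.+1 (@Q_mx n) (@is_scalar (n.+1 + n.+1)) psi.

Definition P_mx n (M : 'M[K]_(n.+1 + n.+1)) :=
  [/\ \tr (ulsubmx M) = 0, drsubmx M = - (ulsubmx M)^T,
      (ursubmx M)^T = ursubmx M & (dlsubmx M)^T = - dlsubmx M].

Definition P_model n (g : lieSuper K) psi :=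
  @mx_model g n.+1 n.+1 (@P_mx n) (fun M => M = 0) psi.

Definition type_P n (g : lieSuper K) := exists psi, @P_model n g psi.

(* Kac's contragredient Lie superalgebra with Cartan matrix A, the generators
   e_i, f_i being odd exactly when i satisfies tau. *)
Definition contragredient r (A : 'M[K]_r) (tau : pred 'I_r) (g : lieSuper K) :=
  exists e f c : 'I_r -> g,
  [/\ [/\ forall i, e i \in spart g (tau i),
          forall i, f i \in spart g (tau i)
        & free [seq c i | i <- enum 'I_r] ],
      [/\ forall i j, sbr (e i) (f j) = if i == j then c i else 0,
          forall i j, sbr (c i) (c j) = 0,
          forall i j, sbr (c i) (e j) = A i j *: e j
        & forall i j, sbr (c i) (f j) = - A i j *: f j ],
      forall W : {vspace g},
        (forall i, e i \in W) -> (forall i, f i \in W) ->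
        (forall x y, x \in W -> y \in W -> sbr x y \in W) -> W = fullv
    & forall W : {vspace g}, homogeneous_ideal W ->
        (W :&: <<[seq c i | i <- enum 'I_r]>>)%VS = 0%VS -> W = 0%VS ].

Definition D21_cartan (a : K) : 'M[K]_3 :=
  \matrix_(i < 3, j < 3)
     nth 0 (nth [::] [:: [:: 0; 1; a]; [:: -1; 2; 0]; [:: -1; 0; 2]] i) j.

Definition type_D21 (a : K) (g : lieSuper K) :=
  [/\ a <> 0, a <> -1
    & contragredient (D21_cartan a) (fun i : 'I_3 => i == ord0) g].

(* D(2,1;a) is isomorphic to D(2,1;1/a) and to D(2,1;-1-a), so that the
   condition on a has to be read up to isomorphism: g is of this type, but for
   no integral value of the parameter. *)
Definition type_D21_nonintegral (g : lieSuper K) :=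
  (exists a : K, type_D21 a g) /\ ~ (exists k : int, type_D21 k%:~R g).

End Models.

Definition hdual (K : fieldType) (g : lieSuper K) (h : {vspace g}) :=
  'Hom(subvs_of h, K^o).

Section Roots.
Variables (K : fieldType) (g : lieSuper K) (h : {vspace g}).
Implicit Types (a b : hdual h) (x y : g).

(* h is a nilpotent subalgebra of the even part, equal to its normalizer there. *)
Definition cartan_subalgebra :=
  [/\ (h <= spart g false)%VS,
      forall x y, x \in h -> y \in h -> sbr x y \in h,
      exists k, forall (s : k.-tuple g) y,
        (forall x, x \in tval s -> x \in h) -> y \in h ->
        foldr (@sbr _ g) y s = 0
    & forall x, x \in spart g false ->
        (forall y, y \in h -> sbr x y \in h) -> x \in h ].

Definition in_root_space a x := forall u : subvs_of h, sbr (val u) x = a u *: x.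

Definition even_root a :=
  a <> 0 /\ exists x, [/\ x <> 0, x \in spart g false & in_root_space a x].

Definition odd_root a :=
  exists x, [/\ x <> 0, x \in spart g true & in_root_space a x].

Definition is_root a := even_root a \/ odd_root a.

(* The bracket of the root spaces of a and b is not zero. *)
Definition root_spaces_interact a b :=
  exists x y, [/\ in_root_space a x, in_root_space b y & sbr x y <> 0].

(* Sums of elements of Pi, formed along nonzero brackets of root spaces. The
   restriction matters for A(n,n) only: there the simple roots satisfy, as
   functionals on h, a linear relation with positive coefficients, so that every
   root would be both such a sum and the opposite of one. *)
Inductive simple_sum (Pi : seq (hdual h)) : hdual h -> Prop :=
| SimpleSum1 a : a \in Pi -> simple_sum Pi a
| SimpleSumD a b : simple_sum Pi a -> simple_sum Pi b ->
    root_spaces_interact a b -> simple_sum Pi (a + b).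

Definition distinguished_simple_system (D Pi : seq (hdual h)) :=
  [/\ uniq Pi /\ {subset Pi <= D},
      forall a, a \in D -> simple_sum Pi a \/ simple_sum Pi (- a),
      forall a, a \in D -> ~ (simple_sum Pi a /\ simple_sum Pi (- a)),
      forall a b, simple_sum Pi a -> simple_sum Pi b ->
        root_spaces_interact a b -> a + b \notin Pi
    & if spart g true == 0%VS then forall a, a \in Pi -> even_root a
      else exists a, [/\ a \in Pi, odd_root a
                       & forall b, b \in Pi -> b != a -> even_root b] ].

Definition even_invariant_form (B : g -> g -> K) :=
  [/\ forall y, linear (fun x => B x y : K^o),
      forall x, linear (fun y => B x y : K^o),
      forall p q x y, x \in spart g p -> y \in spart g q ->
        B x y = (if p == q then (-1) ^+ (p && q) * B y x else 0),
      forall x y z, B (sbr x y) z = B x (sbr y z)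
    & forall x, (forall y, B x y = 0) -> x = 0 ].

(* t is the element of h dual to a under the form (nondegenerate on h);
   then (a, a) = form t t. *)
Definition dual_elt (form : subvs_of h -> subvs_of h -> K) a (t : subvs_of h) :=
  forall u, form t u = a u.

Definition anisotropic (form : subvs_of h -> subvs_of h -> K) a :=
  exists2 t, dual_elt form a t & form t t <> 0.

(* Coroots when g is not of type P(n). In the isotropic case the additive
   subgroup of K generated by the values b(H_a) is the ring of integers. *)
Definition basic_coroots (form : subvs_of h -> subvs_of h -> K)
    (D : seq (hdual h)) (cor : hdual h -> subvs_of h) :=
  forall a, a \in D ->
  [/\ exists t k, dual_elt form a t /\ cor a = k *: t,
      anisotropic form a -> a (cor a) = 2,
      ~ anisotropic form a -> forall x : K,
        inIntSpan (in_tuple [seq (b (cor a) : K) | b : hdual h <- D]) x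
        <-> exists k : int, x = k%:~R
    & cor (- a) = - cor a ].

(* Conditions (a)-(d), relative to
   - lift : an injection of the roots in an abelian group M where the sums and
     strings of roots are computed;
   - exc : the pairs of roots where r + 2 replaces r + 1;
   - negodd : the negative odd roots. *)
Section ChevalleyAxioms.
Variables (form : subvs_of h -> subvs_of h -> K) (cor : hdual h -> subvs_of h).
Variables (M : zmodType) (lift : hdual h -> M).
Variables (exc : hdual h -> hdual h -> Prop) (negodd : hdual h -> Prop).
Variables (D : seq (hdual h)) (H : 'I_(\dim h) -> subvs_of h) (X : hdual h -> g).

Let lifts : seq M := [seq lift a | a <- D].

(* r is the number so named in the a-string through b. *)
Definition string_lower a b (r : nat) :=
  (forall j, (j <= r)%N -> lift b - lift a *+ j \in 0 :: lifts) /\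
  lift b - lift a *+ r.+1 \notin 0 :: lifts.

Definition pm (k x : K) := k = x \/ k = - x.

Definition structure_constant a b (c : K) :=
  [/\ anisotropic form a \/ anisotropic form b ->
        exists2 r, string_lower a b r &
          (~ exc a b -> pm c r.+1%:R) /\ (exc a b -> pm c r.+2%:R)
    & ~ anisotropic form a /\ ~ anisotropic form b -> pm c (b (cor a)) ].

Definition chevalley_axioms :=
  [/\ basis_of fullv ([seq val (H i) | i <- enum 'I_(\dim h)]
                      ++ [seq X a | a <- D])
      /\ (forall a, a \in D -> exists p, X a \in spart g p),
      basis_of fullv [seq H i | i <- enum 'I_(\dim h)]
      /\ (forall u : subvs_of h,
            inIntSpan (in_tuple [seq H i | i <- enum 'I_(\dim h)]) u <->
            inIntSpan (in_tuple [seq cor a | a <- D & - a \in D]) u),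
      (forall i j, sbr (val (H i)) (val (H j)) = 0)
      /\ (forall i a, a \in D -> sbr (val (H i)) (X a) = a (H i) *: X a),
      forall a, a \in D -> - a \in D ->
        (negodd a -> sbr (X a) (X (- a)) = - val (cor a)) /\
        (~ negodd a -> sbr (X a) (X (- a)) = val (cor a))
    & forall a b, a \in D -> b \in D -> a != - b ->
        (lift a + lift b \notin lifts -> sbr (X a) (X b) = 0) /\
        (forall s, s \in D -> lift s = lift a + lift b ->
           exists2 c, structure_constant a b c & sbr (X a) (X b) = c *: X s) ].

End ChevalleyAxioms.

(* Roots of P(n), as elements of the free Z-module on eps_0, ..., eps_n. *)
Section PnRoots.
Variable n : nat.

Definition eps (i : 'I_n.+1) : 'rV[int]_n.+1 := delta_mx 0 i.

Definition P_formal_root (v : 'rV[int]_n.+1) :=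
  (exists i j, i != j /\
     [\/ v = eps i - eps j, v = eps i + eps j | v = - (eps i + eps j)])
  \/ (exists i, v = eps i *+ 2).

Definition P_diag (d : 'rV[K]_n.+1) : 'M[K]_(n.+1 + n.+1) :=
  block_mx (diag_mx d) 0 0 (- diag_mx d).

(* psi identifies h with the diagonal matrices of P(n), and d gives the
   diagonal coordinates of u. *)
Definition P_coords (psi : 'Hom('M[K]_(n.+1 + n.+1), g)) (u : subvs_of h)
    (d : 'rV[K]_n.+1) :=
  \sum_i d 0 i = 0 /\ val u = psi (P_diag d).

Definition P_cartan (psi : 'Hom('M[K]_(n.+1 + n.+1), g)) :=
  forall x, x \in h <-> exists d : 'rV[K]_n.+1, \sum_i d 0 i = 0 /\ x = psi (P_diag d).

Definition P_lift (psi : 'Hom('M[K]_(n.+1 + n.+1), g)) (D : seq (hdual h))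
    (lift : hdual h -> 'rV[int]_n.+1) :=
  forall a, a \in D -> P_formal_root (lift a) /\
  forall u d, P_coords psi u d -> a u = \sum_i (lift a 0 i)%:~R * d 0 i.

Definition P_form (psi : 'Hom('M[K]_(n.+1 + n.+1), g))
    (form : subvs_of h -> subvs_of h -> K) :=
  forall u v c d, P_coords psi u c -> P_coords psi v d ->
    form u v = \tr (diag_mx c *m diag_mx d).

Definition P_coroot_diag (i j : 'I_n.+1) : 'rV[K]_n.+1 :=
  delta_mx 0 i - delta_mx 0 j.

Definition P_coroots (psi : 'Hom('M[K]_(n.+1 + n.+1), g)) (D : seq (hdual h))
    (lift : hdual h -> 'rV[int]_n.+1) (cor : hdual h -> subvs_of h) :=
  forall a i j, a \in D ->
  [/\ i != j -> lift a = eps i - eps j ->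
        P_coords psi (cor a) (P_coroot_diag i j),
      (i < j)%N -> lift a = eps i + eps j ->
        P_coords psi (cor a) (P_coroot_diag i j)
    & (i < j)%N -> lift a = - (eps i + eps j) ->
        P_coords psi (- cor a) (P_coroot_diag i j) ].

Definition P_exceptional (lift : hdual h -> 'rV[int]_n.+1) a b :=
  exists i j, [/\ i != j, lift a = eps j + eps i & lift b = eps i - eps j].

Definition P_negative_odd (lift : hdual h -> 'rV[int]_n.+1) a :=
  exists i j, i != j /\ lift a = - (eps i + eps j).

End PnRoots.

(* The auxiliary choices (form, simple roots, coroots, and for P(n) the matrix
   realization) are made in the constructors. For a type other than P(n) sums
   and strings are computed in the dual of h. *)
Inductive chevalley_basis (D : seq (hdual h)) (H : 'I_(\dim h) -> subvs_of h)
    (X : hdual h -> g) : Prop :=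
| ChevalleyBasic (B : g -> g -> K) (Pi : seq (hdual h))
    (cor : hdual h -> subvs_of h) :
    (forall n, (2 <= n)%N -> ~ type_P n g) ->
    even_invariant_form B ->
    distinguished_simple_system D Pi ->
    basic_coroots (fun u v => B (val u) (val v)) D cor ->
    chevalley_axioms (fun u v => B (val u) (val v)) cor id
      (fun _ _ => False) (fun a => odd_root a /\ simple_sum Pi (- a)) D H X ->
    chevalley_basis D H X
| ChevalleyP n (psi : 'Hom('M[K]_(n.+1 + n.+1), g))
    (lift : hdual h -> 'rV[int]_n.+1)
    (form : subvs_of h -> subvs_of h -> K) (cor : hdual h -> subvs_of h) :
    (2 <= n)%N -> P_model psi -> P_cartan psi ->
    P_lift psi D lift -> P_form psi form -> P_coroots psi D lift cor ->
    chevalley_axioms form cor lift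
      (P_exceptional lift) (P_negative_odd lift) D H X ->
    chevalley_basis D H X.

End Roots.

Section Enveloping.
Variables (K : fieldType) (g : lieSuper K).

Definition super_representation (A : algType K) (f : g -> A) :=
  linear f /\
  forall a b x y, x \in spart g a -> y \in spart g b ->
    f (sbr x y) = f x * f y - (-1) ^+ (a && b) * (f y * f x).

(* (U, iota) has the universal property of the enveloping superalgebra. *)
Definition universal_enveloping (U : algType K) (iota : g -> U) :=
  super_representation iota /\
  forall (A : algType K) (f : g -> A), super_representation f ->
    (exists F : {lrmorphism U -> A}, forall x, F (iota x) = f x) /\
    (forall F G : {lrmorphism U -> A},
       (forall x, F (iota x) = f x) -> (forall x, G (iota x) = f x) -> F =1 G).

End Enveloping.

Section Kostant.
Variables (K : fieldType) (U : algType K).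

Definition divided_power (x : U) (n : nat) : U := (n`!%:R : K)^-1 *: x ^+ n.

Definition divided_binomial (x : U) (n : nat) : U :=
  (n`!%:R : K)^-1 *: \prod_(k < n) (x - k%:R).

(* Unital subring generated by G; it is a sub-superalgebra over Z as soon as
   the elements of G are homogeneous. *)
Inductive generated_subring (G : U -> Prop) : U -> Prop :=
| GenIn x : G x -> generated_subring G x
| Gen1 : generated_subring G 1
| GenB x y : generated_subring G x -> generated_subring G y ->
    generated_subring G (x - y)
| GenM x y : generated_subring G x -> generated_subring G y ->
    generated_subring G (x * y).

(* The family of the b i, for i satisfying P, is a Z-basis of S. *)
Definition is_Zbasis (S : U -> Prop) (I : eqType) (P : I -> Prop) (b : I -> U) :=
  [/\ forall i, P i -> S (b i),
      forall (s : seq I) (c : I -> int),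
        uniq s -> (forall i, i \in s -> P i) ->
        \sum_(i <- s) b i *~ c i = 0 -> forall i, i \in s -> c i = 0
    & forall x, S x -> exists (s : seq I) (c : I -> int),
        (forall i, i \in s -> P i) /\ x = \sum_(i <- s) b i *~ c i ].

Definition is_Zfree (S : U -> Prop) :=
  exists (I : eqType) (b : I -> U), is_Zbasis S (fun _ => True) b.

Variables (g : lieSuper K) (h : {vspace g}) (D : seq (hdual h)).
Variables (H : 'I_(\dim h) -> subvs_of h) (X : hdual h -> g) (iota : g -> U).

Inductive kostant_generator : U -> Prop :=
| KostantEven a n : even_root a -> kostant_generator (divided_power (iota (X a)) n)
| KostantOdd a : odd_root a -> kostant_generator (iota (X a))
| KostantCartan i n : kostant_generator (divided_binomial (iota (val (H i))) n).

Definition kostant : U -> Prop := generated_subring kostant_generator.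

Definition pbw_index : finType := (seq_sub D + 'I_(\dim h))%type.

(* The factor with exponent 0 or 1 at an odd root is 1 or X_gamma. *)
Definition pbw_factor (k : pbw_index) (n : nat) : U :=
  match k with
  | inl a => divided_power (iota (X (ssval a))) n
  | inr i => divided_binomial (iota (val (H i))) n
  end.

Definition pbw_exponent (e : {ffun pbw_index -> nat}) : Prop :=
  forall a : seq_sub D, odd_root (ssval a) -> (e (inl a) <= 1)%N.

Definition pbw_monomial (le : rel pbw_index) (e : {ffun pbw_index -> nat}) : U :=
  \prod_(k <- sort le (enum pbw_index)) pbw_factor k (e k).

End Kostant.

(* Main.v *)
(* In the filtration of U by degree, divided powers, binomials and odd root
   vectors commute up to sign modulo Z-combinations of products of lower degree,
   and products of two factors with the same index are integral multiples of a
   single factor modulo lower degree; hence products can be straightened over Z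
   in any order. Everything is explicit (Vandermonde, the sl2 formula, divided
   powers of ad X_a) except for two even roots a <> - b, where the lower terms
   depend on the rank 2 system they generate.

   Linear independence and this last case both come from functionals on U. Let
   V be the adjoint module plus a trivial module of dimension 1|1, and choose
   functionals phi_k on End V vanishing at 1 and at the parity operator and dual
   to the root basis of g. On V^(tensor m), the functional
   phi_(k_1) tensor ... tensor phi_(k_m) kills all products of fewer than m
   elements of g, and takes the value +-1 or 0 on an ordered monomial of degree m
   according to whether its exponents are the multiplicities of k_1, ..., k_m.
   For even roots phi_k can be chosen integral on the Chevalley lattice, which
   the divided powers preserve, so the coefficients of the ordered monomials in
   the commutator of two even divided powers are integers. *)

Require Import Defs.
From mathcomp Require Import boolp ssrAC zify ring mxtens.

Set Implicit Arguments.
Unset Strict Implicit.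
Unset Printing Implicit Defensive.

Import Order.TTheory GRing.Theory Num.Theory.
Local Open Scope ring_scope.

(** * Straightening products over a subring *)

(** The obstacle is that an integral dual functional is available only at even root vectors; those
    dual to a Cartan element or to an odd root vector are obtained over K alone. Reading off
    integral coefficients is therefore confined to lists of even root vectors whose brackets are
    combinations of the list. Two even roots a <> - b lie in such a list because no sum a i + b j,
    with i, j natural and not both 0, vanishes; the pair a, - a, where Cartan elements appear, is
    left to the sl2 formula. Inside the list a commutator is first straightened over K and its
    integrality recovered afterwards, whereas on all of U the same straightening runs over the
    integers: hence the ring of coefficients is a parameter. Root systems are never classified. What
    is used of a Chevalley basis is collected in [kostant_data], where sums of roots are taken in
    the dual of h. Outside type P(n), integrality of weights comes from sl2 strings, and X_a^2 =
    [X_a, X_a] / 2 is integral for a nonisotropic odd root a because its string gives [X_a, X_a] = 4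
    X_2a up to sign. *)

Section Spans.
Variables (K : fieldType).

Record subring_pred (A : K -> Prop) : Prop := SubringPred {
  subring1 : A 1;
  subringB : forall a b, A a -> A b -> A (a - b);
  subringM : forall a b, A a -> A b -> A (a * b) }.

Lemma subring0 A : subring_pred A -> A 0.
Proof. by case=> A1 AB _; rewrite -(subrr 1); apply: AB. Qed.

Lemma subringN A a : subring_pred A -> A a -> A (- a).
Proof. by move=> sA Aa; rewrite -sub0r; apply: subringB => //; apply: subring0. Qed.

Lemma subringD A a b : subring_pred A -> A a -> A b -> A (a + b).
Proof. by move=> sA Aa Ab; rewrite -[b]opprK; apply: subringB => //; apply: subringN. Qed.

Lemma subring_nat A n : subring_pred A -> A n%:R.
Proof.
move=> sA; elim: n => [|n IH]; first exact: subring0.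
by rewrite -addn1 natrD; apply: subringD => //; apply: subring1.
Qed.

Lemma subring_sum A I r (P : pred I) (F : I -> K) : subring_pred A ->
  (forall i, P i -> A (F i)) -> A (\sum_(i <- r | P i) F i).
Proof. by move=> sA AF; apply: big_ind => //; [exact: subring0 | move=> x y; apply: subringD]. Qed.

Definition Zint (x : K) : Prop := exists k : int, x = k%:~R.

Lemma Zint_subring : subring_pred Zint.
Proof.
split; first by exists 1.
  by move=> _ _ [k ->] [l ->]; exists (k - l); rewrite rmorphB.
by move=> _ _ [k ->] [l ->]; exists (k * l); rewrite rmorphM.
Qed.

Lemma Zint_int (k : int) : Zint k%:~R. Proof. by exists k. Qed.

Lemma all_subring : subring_pred (fun _ : K => True).
Proof. by []. Qed.

Variables (V : lmodType K).

Inductive span (A : K -> Prop) (G : V -> Prop) : V -> Prop :=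
| span0 : span A G 0
| spanS a x y : A a -> G x -> span A G y -> span A G (a *: x + y).

Variable A : K -> Prop.
Hypothesis sA : subring_pred A.

Lemma span_in (G : V -> Prop) x : G x -> span A G x.
Proof. by move=> Gx; rewrite -[x]addr0 -[x]scale1r; constructor=> //; [apply: subring1 | constructor]. Qed.

Lemma spanD G x y : span A G x -> span A G y -> span A G (x + y).
Proof.
move=> Sx Sy; elim: Sx => [|a u v Aa Gu _ IH]; first by rewrite add0r.
by rewrite -addrA; constructor.
Qed.

Lemma spanZ G a x : A a -> span A G x -> span A G (a *: x).
Proof.
move=> Aa; elim=> [|b u v Ab Gu _ IH]; first by rewrite scaler0; constructor.
by rewrite scalerDr scalerA; constructor => //; apply: subringM.
Qed.

Lemma spanN G x : span A G x -> span A G (- x).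
Proof. by rewrite -scaleN1r; apply: spanZ; apply: subringN => //; apply: subring1. Qed.

Lemma spanB G x y : span A G x -> span A G y -> span A G (x - y).
Proof. by move=> Sx Sy; apply: spanD => //; apply: spanN. Qed.

Lemma span_sum G I r (P : pred I) (F : I -> V) :
  (forall i, P i -> span A G (F i)) -> span A G (\sum_(i <- r | P i) F i).
Proof. by move=> AF; apply: big_ind => //; [exact: span0 | move=> x y; apply: spanD]. Qed.

Lemma span_bind (G G' : V -> Prop) x :
  (forall u, G u -> span A G' u) -> span A G x -> span A G' x.
Proof.
move=> GG'; elim=> [|a u v Aa Gu _ IH]; first by constructor.
by apply: spanD => //; apply: spanZ => //; apply: GG'.
Qed.

Lemma span_sub (G G' : V -> Prop) x :
  (forall u, G u -> G' u) -> span A G x -> span A G' x.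
Proof. by move=> GG'; apply: span_bind => u /GG'; apply: span_in. Qed.

End Spans.

Arguments Zint {K}.

Lemma span_linear (K : fieldType) (V W : lmodType K) (A : K -> Prop)
  (G : V -> Prop) (G' : W -> Prop) (f : V -> W) x : subring_pred A ->
  linear f -> (forall u, G u -> span A G' (f u)) -> span A G x -> span A G' (f x).
Proof.
move=> sA lf Gf; elim=> [|a u v Aa Gu _ IH].
  by have := lf (-1) 0 0; rewrite scaleN1r oppr0 addr0 addrC scaleN1r subrr => ->; constructor.
by rewrite lf; apply: spanD => //; apply: spanZ => //; apply: Gf.
Qed.

Lemma span_mul (K : fieldType) (U : algType K) (A : K -> Prop)
  (G G' G'' : U -> Prop) x y : subring_pred A ->
  (forall u v, G u -> G' v -> span A G'' (u * v)) ->
  span A G x -> span A G' y -> span A G'' (x * y).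
Proof.
move=> sA GG Sx Sy; elim: Sx => [|a u v Aa Gu _ IH].
  by rewrite mul0r; constructor.
rewrite mulrDl -scalerAl; apply: spanD => //; apply: spanZ => //.
elim: Sy => [|b u' v' Ab Gu' _ IH']; first by rewrite mulr0; constructor.
by rewrite mulrDr -scalerAr; apply: spanD => //; apply: spanZ => //; apply: GG.
Qed.

Section Straightening.
Variables (K : fieldType) (U : algType K) (A : K -> Prop).
Hypothesis sA : subring_pred A.
Variables (I : eqType) (gen : I -> nat -> U) (ok : I -> nat -> bool) (l : seq I).

Definition wval (w : seq (I * nat)) : U := \prod_(x <- w) gen x.1 x.2.
Definition wdeg (w : seq (I * nat)) := (\sum_(x <- w) x.2)%N.
Definition wok (w : seq (I * nat)) := all (fun x => (x.1 \in l) && ok x.1 x.2) w.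

(* The bound on the degree is strict, so that [wspan 0] is zero and the error
   term of a product of degree d lies in [wspan d]. *)
Definition wspan (m : nat) : U -> Prop :=
  span A (fun u => exists w, [/\ wok w, (wdeg w < m)%N & u = wval w]).

Definition mon (e : I -> nat) (l' : seq I) : U := \prod_(k <- l') gen k (e k).
Definition mdeg (e : I -> nat) (l' : seq I) := (\sum_(k <- l') e k)%N.

Definition mspan (m : nat) : U -> Prop :=
  span A (fun u => exists e, [/\ forall k, ok k (e k), (mdeg e l < m)%N & u = mon e l]).

Lemma wspan_le m n x : (m <= n)%N -> wspan m x -> wspan n x.
Proof.
move=> le_mn; apply: span_sub => // u [w [wo wd ->]].
by exists w; split=> //; apply: leq_trans le_mn.
Qed.

Lemma wspanM m n p x y : (m + n <= p.+1)%N -> wspan m x -> wspan n y -> wspan p (x * y).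
Proof.
move=> lep; apply: span_mul => // _ _ [w [wo wd ->]] [w' [wo' wd' ->]].
apply: span_in => //; exists (w ++ w'); split.
- by rewrite /wok all_cat; apply/andP.
- by rewrite /wdeg big_cat /=; move: wd wd'; rewrite /wdeg; lia.
- by rewrite /wval big_cat.
Qed.

Lemma wspan_gen k p m : k \in l -> ok k p -> (p < m)%N -> wspan m (gen k p).
Proof.
move=> kl okp lt; apply: span_in => //; exists [:: (k, p)]; split.
- by rewrite /wok /= kl okp.
- by rewrite /wdeg big_seq1.
- by rewrite /wval big_seq1.
Qed.

Lemma wspan1 m : (0 < m)%N -> wspan m 1.
Proof.
move=> m0; apply: span_in => //; exists [::].
by rewrite /wdeg /wval !big_nil.
Qed.

Lemma mon_wspan e l' : {subset l' <= l} -> (forall k, ok k (e k)) ->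
  wspan (mdeg e l').+1 (mon e l').
Proof.
move=> sub oke; apply: span_in => //; exists [seq (k, e k) | k <- l']; split.
- by apply/allP=> _ /mapP[k kl' ->] /=; rewrite sub //= oke.
- by rewrite /wdeg big_map.
- by rewrite /wval big_map.
Qed.

Hypothesis gen0 : forall k, gen k 0%N = 1.
Hypothesis ok0 : forall k, ok k 0%N.
(** The coefficient may be 0, and then p + q need not be admissible: this is the case of the square
    of an odd root vector, which has no leading term. *)
Hypothesis gen_same : forall k p q, k \in l -> ok k p -> ok k q ->
  exists a, [/\ A a, (a != 0 -> ok k (p + q)%N)
    & wspan (p + q) (gen k p * gen k q - a *: gen k (p + q)%N)].
Hypothesis gen_swap : forall j k p q, j \in l -> k \in l -> j != k -> ok j p -> ok k q ->
  exists s, A s /\ wspan (p + q) (gen j p * gen k q - s *: (gen k q * gen j p)).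

Lemma eq_mon e e' l' : {in l', e =1 e'} -> mon e l' = mon e' l'.
Proof. by move=> E; apply: eq_big_seq => k /E ->. Qed.

Lemma eq_mdeg e e' l' : {in l', e =1 e'} -> mdeg e l' = mdeg e' l'.
Proof. by move=> E; apply: eq_big_seq => k /E ->. Qed.

(* Modulo lower degree the letters commute up to scalars, so a letter can be
   moved into its place in any prescribed order of the keys. *)
Lemma mon_insert k p e l' : {subset l' <= l} -> uniq l' -> k \in l' -> ok k p ->
  (forall j, ok j (e j)) ->
  exists a e', [/\ A a, forall j, ok j (e' j), (mdeg e' l' <= p + mdeg e l')%N
    & wspan (p + mdeg e l') (gen k p * mon e l' - a *: mon e' l')].
Proof.
elim: l' e => // j l' IH e sub /= /andP[jl' ul'].
have subl' : {subset l' <= l} by move=> x xl'; apply: sub; rewrite inE xl' orbT.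
have jl : j \in l by apply: sub; rewrite inE eqxx.
have Em e1 : mon e1 (j :: l') = gen j (e1 j) * mon e1 l' by rewrite /mon big_cons.
have Ed e1 : mdeg e1 (j :: l') = (e1 j + mdeg e1 l')%N by rewrite /mdeg big_cons.
rewrite inE; case: (eqVneq k j) => [-> _ | nkj /= kl'] okp oke.
  have okj : ok j (e j) := oke j.
  have [a [Aa oka Wa]] := gen_same jl okp okj.
  have Wr : wspan (p + e j + mdeg e l')
      ((gen j p * gen j (e j) - a *: gen j (p + e j)%N) * mon e l').
    by apply: wspanM Wa (mon_wspan subl' oke); rewrite addnS.
  case: (eqVneq a 0) => [a0 | a0].
    (* With a = 0 the whole product is of lower degree, and any admissible exponent of small degree
       can stand for e'. *)
    exists 0, (fun=> 0%N); split=> //.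
    - exact: subring0.
    - by rewrite /mdeg big1.
    - by move: Wr; rewrite a0 !scale0r !subr0 Em Ed mulrA addnA.
  exists a, (fun i => if i == j then (p + e j)%N else e i); split=> //.
  - by move=> i; case: eqP => [-> | //]; apply: oka.
  - rewrite !Ed eqxx addnA leq_add2l; apply/eq_leq/eq_mdeg => i il'.
    by case: eqP il' jl' => // -> ->.
  - move: Wr; rewrite !Em eqxx Ed mulrBl mulrA scalerAl (@eq_mon e (fun i => if i == j then (p + e j)%N else e i)).
      by rewrite addnA.
    by move=> i il'; case: eqP il' jl' => // -> ->.
have okj := oke j.
have [a [e' [Aa oke' de' We']]] := IH e subl' ul' kl' okp oke.
have [s [As Ws]] := gen_swap (subl' _ kl') jl nkj okp okj.
exists (s * a), (fun i => if i == j then e j else e' i); split=> //.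
- exact: subringM.
- by move=> i; case: eqP => [-> | //].
- rewrite !Ed eqxx (@eq_mdeg _ e'); first by move: de'; lia.
  by move=> i il'; case: eqP il' jl' => // -> ->.
have -> : mon (fun i : I => if i == j then e j else e' i) (j :: l') = gen j (e j) * mon e' l'.
  rewrite Em eqxx; congr (_ * _); apply: eq_mon => i il'.
  by case: eqP il' jl' => // -> ->.
rewrite Em Ed.
have -> : gen k p * (gen j (e j) * mon e l') - (s * a) *: (gen j (e j) * mon e' l') =
  (gen k p * gen j (e j) - s *: (gen j (e j) * gen k p)) * mon e l' +
  s *: (gen j (e j) * (gen k p * mon e l' - a *: mon e' l')).
  rewrite mulrBl mulrBr scalerBr -!scalerAr -!scalerAl !mulrA scalerA.
  by rewrite addrA subrK.
apply: spanD; first by apply: wspanM Ws (mon_wspan subl' oke); lia.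
apply: spanZ => //; apply: wspanM (wspan_gen jl okj (ltnSn _)) We'.
lia.
Qed.

Hypothesis ul : uniq l.

(** Outer induction on the degree bound, inner induction on the word: once the tail is an ordered
    monomial the first letter is inserted into it, and the error of the insertion, of strictly
    smaller degree, is left to the outer induction. *)
Theorem straighten m x : wspan m x -> mspan m x.
Proof.
elim/ltn_ind: m x => m IHm x; apply: span_bind => // _ [w [wo wd ->]].
suff: mspan (wdeg w).+1 (wval w).
  by apply: span_sub => // u [e [oke de ->]]; exists e; split=> //; apply: leq_trans wd.
elim: w wo wd => [|[k p] w IHw] /=.
  move=> _ _; apply: span_in => //; exists (fun=> 0%N); split=> //.
    by rewrite /mdeg big1.
  by rewrite /wval /mon big_nil big1.
rewrite /wdeg /wval !big_cons /= => /andP[/andP[kl okp] wo] wd.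
have {IHw} IHw : mspan (wdeg w).+1 (wval w) by apply: IHw => //; move: wd; rewrite /wdeg; lia.
have ->: gen k p * \prod_(j <- w) gen j.1 j.2 = gen k p * wval w by [].
apply: (span_linear (f := fun y => gen k p * y) sA _ _ IHw).
  by move=> a u v; rewrite mulrDr scalerAr.
move=> _ [e [oke de ->]].
have [a [e' [Aa oke' de' We']]] := mon_insert (fun _ => id) ul kl okp oke.
rewrite -[gen k p * _](subrK (a *: mon e' l)); apply: spanD.
  have : mspan (p + mdeg e l) (gen k p * mon e l - a *: mon e' l).
    by apply: IHm => //; move: wd de; rewrite /wdeg; lia.
  apply: span_sub => // u [e1 [ok1 d1 ->]]; exists e1; split=> //.
  by move: wd de d1; rewrite /wdeg; lia.
apply: spanZ => //; apply: span_in => //; exists e'; split=> //.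
by move: wd de de'; rewrite /wdeg; lia.
Qed.

End Straightening.

(** * Super representations by matrices and their tensor products *)

Section TensorLinear.
Variables (K : fieldType) (m n p q : nat).
Implicit Types (A : 'M[K]_(m, n)) (B : 'M[K]_(p, q)).

Lemma tensmxDl A A' B : (A + A') *t B = A *t B + A' *t B.
Proof. by apply/matrixP=> i j; rewrite !mxE mulrDl. Qed.

Lemma tensmxDr A B B' : A *t (B + B') = A *t B + A *t B'.
Proof. by apply/matrixP=> i j; rewrite !mxE mulrDr. Qed.

Lemma tensmxZl a A B : (a *: A) *t B = a *: (A *t B).
Proof. by apply/matrixP=> i j; rewrite !mxE mulrA. Qed.

Lemma tensmxZr a A B : A *t (a *: B) = a *: (A *t B).
Proof. by apply/matrixP=> i j; rewrite !mxE mulrCA. Qed.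

End TensorLinear.

Lemma tensmx11 (K : fieldType) m n : (1%:M : 'M[K]_m) *t (1%:M : 'M[K]_n) = 1%:M.
Proof.
apply/matrixP=> i j; rewrite !mxE -natrM mulnb; congr (_%:R).
by rewrite -xpair_eqE -!surjective_pairing (can_eq (@mxtens_unindexK _ _)).
Qed.

Lemma mxtrace_tens (K : fieldType) m n (A : 'M[K]_m) (B : 'M[K]_n) :
  \tr (A *t B) = \tr A * \tr B.
Proof.
rewrite /mxtrace mulr_sum; apply: eq_bigr => i _.
by rewrite !mxE.
Qed.

Definition intmx (K : fieldType) m n (M : 'M[K]_(m, n)) := forall i j, Zint (M i j).

Section IntegralMatrices.
Variable K : fieldType.
Let sZ := @Zint_subring K.

Lemma intmx0 m n : intmx (0 : 'M[K]_(m, n)).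
Proof. by move=> i j; rewrite mxE; apply: subring0. Qed.

Lemma intmx1 n : intmx (1%:M : 'M[K]_n).
Proof. by move=> i j; rewrite mxE; apply: subring_nat. Qed.

Lemma intmxD m n (A B : 'M[K]_(m, n)) : intmx A -> intmx B -> intmx (A + B).
Proof. by move=> iA iB i j; rewrite mxE; apply: subringD. Qed.

Lemma intmxZ m n a (A : 'M[K]_(m, n)) : Zint a -> intmx A -> intmx (a *: A).
Proof. by move=> ia iA i j; rewrite mxE; apply: subringM. Qed.

Lemma intmxM m n p (A : 'M[K]_(m, n)) (B : 'M[K]_(n, p)) :
  intmx A -> intmx B -> intmx (A *m B).
Proof. by move=> iA iB i j; rewrite mxE; apply: subring_sum => // k _; apply: subringM. Qed.

Lemma intmx_sum m n I r (P : pred I) (F : I -> 'M[K]_(m, n)) :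
  (forall i, P i -> intmx (F i)) -> intmx (\sum_(i <- r | P i) F i).
Proof. by move=> iF; apply: big_ind => //; [exact: intmx0 | move=> A B; apply: intmxD]. Qed.

Lemma intmx_tens m n p q (A : 'M[K]_(m, n)) (B : 'M[K]_(p, q)) :
  intmx A -> intmx B -> intmx (A *t B).
Proof. by move=> iA iB i j; rewrite mxE; apply: subringM. Qed.

Lemma intmx_trace n (A : 'M[K]_n) : intmx A -> Zint (\tr A).
Proof. by move=> iA; apply: subring_sum. Qed.

End IntegralMatrices.

Section SuperRep.
Variables (K : fieldType) (g : lieSuper K).

Definition parity_proj (b : bool) : 'End(g) := daddv_pi (spart g b) (spart g (~~ b)).

Lemma spart_cap b : (spart g b :&: spart g (~~ b) = 0)%VS.
Proof. by case: b; rewrite /= ?[(spart g true :&: _)%VS]capvC spart_direct. Qed.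

Lemma parity_proj_in b x : parity_proj b x \in spart g b.
Proof. exact: memv_pi. Qed.

Lemma parity_proj_id b x : x \in spart g b -> parity_proj b x = x.
Proof. by move=> xb; rewrite /parity_proj daddv_pi_id // spart_cap. Qed.

Lemma parity_projD x : parity_proj false x + parity_proj true x = x.
Proof. by apply: daddv_pi_add; rewrite ?spart_direct // spart_sum memvf. Qed.

Lemma parity_proj0 b x : x \in spart g b -> parity_proj (~~ b) x = 0.
Proof.
move=> xb; have := parity_projD x; rewrite -{3}(parity_proj_id xb).
case: b xb => _ /=; first by move/(canRL (addrK _)); rewrite subrr.
by rewrite addrC => /(canRL (addrK _)); rewrite subrr.
Qed.

Lemma spart_decomp x : exists x0 x1,
  [/\ x0 \in spart g false, x1 \in spart g true & x = x0 + x1].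
Proof. by exists (parity_proj false x), (parity_proj true x); rewrite !parity_proj_in parity_projD. Qed.

Lemma spart_disjoint x : x \in spart g false -> x \in spart g true -> x = 0.
Proof.
move=> x0 x1; apply/eqP; rewrite -memv0 -(spart_direct g) memv_cap x0 //.
Qed.

(** No grading of the module is named: the involution P, commuting with even elements and
    anticommuting with odd ones, carries all that the sign rule of tensor products needs. *)
Definition super_rep n (P : 'M[K]_n) (s : g -> 'M[K]_n) :=
  [/\ linear s, P *m P = 1%:M,
      forall b x, x \in spart g b -> P *m s x = (-1) ^+ b *: (s x *m P)
    & forall a b x y, x \in spart g a -> y \in spart g b ->
        s (sbr x y) = s x *m s y - (-1) ^+ (a && b) *: (s y *m s x)].

Definition mxP n (P : 'M[K]_n) (b : bool) : 'M[K]_n := if b then P else 1%:M.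

(* The sign rule of the super tensor product is encoded in ordinary matrices by
   letting the odd part of the first factor drag the parity operator P of the
   second one. *)
Definition tens_rep m n (P : 'M[K]_n) (s : g -> 'M[K]_m) (s' : g -> 'M[K]_n) (x : g) :
    'M[K]_(m * n) :=
  s (parity_proj false x) *t 1%:M + s (parity_proj true x) *t P + 1%:M *t s' x.

Section Tens.
Variables (m n : nat) (P : 'M[K]_m) (s : g -> 'M[K]_m) (P' : 'M[K]_n) (s' : g -> 'M[K]_n).
Hypotheses (srep : super_rep P s) (srep' : super_rep P' s').

Lemma linear_fun0 (V W : lmodType K) (f : V -> W) : linear f -> f 0 = 0.
Proof. by move=> /(_ (-1) 0 0); rewrite scaleN1r oppr0 addr0 scaleN1r addNr. Qed.

Lemma linear_funZ (V W : lmodType K) (f : V -> W) a x : linear f -> f (a *: x) = a *: f x.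
Proof. by move=> lf; have := lf a x 0; rewrite (linear_fun0 lf) !addr0. Qed.

Lemma linear_funD (V W : lmodType K) (f : V -> W) x y : linear f -> f (x + y) = f x + f y.
Proof. by move=> lf; have := lf 1 x y; rewrite !scale1r. Qed.

Lemma linear_fun_sum (V W : lmodType K) (f : V -> W) I r (Q : pred I) F : linear f ->
  f (\sum_(i <- r | Q i) F i) = \sum_(i <- r | Q i) f (F i).
Proof.
move=> lf; elim: r => [|i r IH]; first by rewrite !big_nil linear_fun0.
by rewrite !big_cons; case: ifP => _ //; rewrite linear_funD // IH.
Qed.

Lemma tens_rep_hom b x : x \in spart g b ->
  tens_rep P' s s' x = s x *t mxP P' b + 1%:M *t s' x.
Proof.
case: srep => ls _ _ _ xb; rewrite /tens_rep.
have := parity_proj0 xb; have := parity_proj_id xb.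
by case: b xb => /= _ -> ->; rewrite (linear_fun0 ls) tens0mx ?add0r ?addr0.
Qed.

Lemma super_rep_tens : super_rep (P *t P') (tens_rep P' s s').
Proof.
case: (srep) (srep') => ls PP Ps sb [ls' PP' Ps' sb']; split.
- move=> a x y; rewrite /tens_rep !linearP /= !ls ls'.
  rewrite !tensmxDl !tensmxDr !tensmxZl !tensmxZr !scalerDr.
  by rewrite [RHS]addrACA; congr (_ + _); exact: addrACA.
- by rewrite (@tensmx_mul K m m n n m n) PP PP' tensmx11.
- move=> b x xb; rewrite (tens_rep_hom xb) mulmxDr mulmxDl !tensmx_mul (Ps _ _ xb) (Ps' _ _ xb).
  rewrite scalerDr mulmx1 mul1mx -tensmxZl -tensmxZr; congr (_ *t _ + _).
  by case: (b); rewrite /= ?mulmx1 ?mul1mx.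
move=> a b x y xa yb; rewrite (tens_rep_hom (sbr_part xa yb)) (tens_rep_hom xa) (tens_rep_hom yb).
rewrite (sb _ _ _ _ xa yb) (sb' _ _ _ _ xa yb).
rewrite !mulmxDl !mulmxDr !tensmx_mul !mulmx1 !mul1mx !scalerDr.
have PaPb c d : mxP P' c *m mxP P' d = mxP P' (c (+) d).
  by case: c; case: d; rewrite /= ?mulmx1 ?mul1mx ?PP'.
have sP c d z : z \in spart g d -> mxP P' c *m s' z = (-1) ^+ (c && d) *: (s' z *m mxP P' c).
  by case: c => zd; rewrite /= ?mulmx1 ?mul1mx ?scale1r // (Ps' _ _ zd).
rewrite !PaPb (sP _ _ _ yb) (sP _ _ _ xa).
rewrite !tensmxDl !tensmxDr !tensmxZr -![- (_ *: _)]scaleNr !tensmxZl !tensmxZr !scaleNr.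
rewrite [b (+) a]addbC [b && a]andbC.
rewrite !scalerA -!signr_addb !addbb !scale1r.
set t1 := _ *t _; set t2 := _ *: _; set t3 := _ *t _; set t4 := _ *: _.
set t5 := _ *: _; set t6 := _ *t _.
(* The mixed terms, with one of x, y in each tensor factor, come in two pairs of opposite sign; the
   pattern brings them together. *)
rewrite !opprD [RHS](AC ((2*2)*(2*2)) (((1*5)*(4*8))*((2*7)*(3*6)))) /=.
by rewrite !subrr !addr0.
Qed.
End Tens.
End SuperRep.

(** * Functionals on words *)

Lemma fact_neq0 (K : fieldType) (char0 : [pchar K] =i pred0) n : (n`!%:R : K) != 0.
Proof. by move/pcharf0P: char0 => ->; rewrite -lt0n fact_gt0. Qed.

Lemma natK_neq0 (K : fieldType) (char0 : [pchar K] =i pred0) n : (n.+1%:R : K) != 0.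
Proof. by move/pcharf0P: char0 => ->. Qed.

Section MatrixDividedPowers.
Variables (K : fieldType) (char0 : [pchar K] =i pred0).

Definition mxdp n (A : 'M[K]_n) k : 'M[K]_n := (k`!%:R)^-1 *: (A ^+ k).

Lemma tens_expl m n (A : 'M[K]_m) i : (A *t (1%:M : 'M[K]_n)) ^+ i = A ^+ i *t 1%:M.
Proof.
elim: i => [|i IH]; first by rewrite !expr0 -[1]/(1%:M) -[in LHS]tensmx11.
by rewrite !exprS IH -!mulmxE tensmx_mul mulmx1.
Qed.

Lemma tens_expr m n (B : 'M[K]_n) i : ((1%:M : 'M[K]_m) *t B) ^+ i = 1%:M *t B ^+ i.
Proof.
elim: i => [|i IH]; first by rewrite !expr0 -[1]/(1%:M) -[in LHS]tensmx11.
by rewrite !exprS IH -!mulmxE tensmx_mul mulmx1.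
Qed.

(** The binomial coefficients of (A + B)^k cancel against the factorials. Integrality of all divided
    powers thus passes to tensor products, which fails for integrality of A and B weakened by any
    other denominators. *)
Lemma mxdp_tens m n (A : 'M[K]_m) (B : 'M[K]_n) k :
  mxdp (A *t 1%:M + 1%:M *t B) k = \sum_(i < k.+1) mxdp A (k - i) *t mxdp B i.
Proof.
rewrite /mxdp exprDn_comm; last first.
  by rewrite /GRing.comm -!mulmxE !tensmx_mul !mulmx1 !mul1mx.
rewrite scaler_sumr; apply: eq_bigr => i _.
rewrite tensmxZl tensmxZr tens_expl tens_expr -mulmxE tensmx_mul mulmx1 mul1mx.
rewrite -scaler_nat !scalerA; congr (_ *: _).
have := bin_fact (ltnSE (ltn_ord i)) => /(congr1 (fun j => j%:R : K)).
rewrite !natrM => <-; rewrite !invfM.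
have := fact_neq0 char0 i; have := fact_neq0 char0 (k - i).
have : ('C(k, i)%:R : K) != 0.
  move/pcharf0P: char0 => ->; rewrite -lt0n bin_gt0 //; exact: ltnSE.
by move=> h1 h2 h3; rewrite mulrC !mulrA mulfV // mul1r mulrC.
Qed.

End MatrixDividedPowers.

Section WordFunctionals.
Variables (K : fieldType) (char0 : [pchar K] =i pred0) (g : lieSuper K).
Variables (I : eqType) (v : I -> g) (par : I -> bool).
Hypothesis v_par : forall k, v k \in spart g (par k).

Definition rep_word n (s : g -> 'M[K]_n) (J : seq I) : 'M[K]_n :=
  foldr (fun k M => s (v k) *m M) 1%:M J.

Lemma rep_word_cat n (s : g -> 'M[K]_n) J J' : rep_word s (J ++ J') = rep_word s J *m rep_word s J'.
Proof. by elim: J => [|k J IH] /=; rewrite ?mul1mx // IH mulmxA. Qed.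

Lemma rep_word_rcons n (s : g -> 'M[K]_n) J k : rep_word s (rcons J k) = rep_word s J *m s (v k).
Proof. by rewrite -cats1 rep_word_cat /= mulmx1. Qed.

Definition wpar (J : seq I) := foldr (fun k b => par k (+) b) false J.

(** The argument w accumulates the letters already passed, so that f receives what precedes and what
    follows each occurrence of k. The sign in [matching_value] depends on the second part, the
    recursion on their concatenation. *)
Fixpoint removal_sum (f : seq I -> seq I -> K) (k : I) (w J : seq I) : K :=
  if J is x :: J' then (if x == k then f w J' else 0) + removal_sum f k (rcons w x) J'
  else 0.

(* Signed number of ways to match the letters of J with those of js. *)
Fixpoint matching_value (js J : seq I) : K :=
  if js is k :: js' then
    removal_sum (fun w J' => (-1) ^+ (par k && wpar J') * matching_value js' (w ++ J')) k [::] J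
  else 1.

Section Word.
Variables (n : nat) (P : 'M[K]_n) (s : g -> 'M[K]_n).
Hypothesis srep : super_rep P s.

Lemma mxPM c d : mxP P c *m mxP P d = mxP P (c (+) d).
Proof.
by case: srep => _ PP _ _; case: c; case: d; rewrite /= ?mulmx1 ?mul1mx ?PP.
Qed.

Lemma mxP_rep c d z : z \in spart g d ->
  mxP P c *m s z = (-1) ^+ (c && d) *: (s z *m mxP P c).
Proof.
case: srep => _ _ Ps _.
by case: c => zd; rewrite /= ?mulmx1 ?mul1mx ?scale1r // (Ps _ _ zd).
Qed.

Lemma mxP_sw c J : mxP P c *m rep_word s J = (-1) ^+ (c && wpar J) *: (rep_word s J *m mxP P c).
Proof.
elim: J => [|k J IH] /=; first by rewrite andbF scale1r mulmx1 mul1mx.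
rewrite mulmxA (mxP_rep _ (v_par k)) -scalemxAl -mulmxA IH -scalemxAr scalerA -mulmxA.
by rewrite -signr_addb andb_addr.
Qed.

(** Shape of the second tensor factor of a term in the expanded coproduct: every odd letter sent to
    the first factor leaves a parity operator behind, which can be moved to the right end at the
    cost of a sign. The scalar e is left free since only vanishing is deduced. *)
Definition short_word d (B : 'M[K]_n) :=
  exists e w c, (size w <= d)%N /\ B = e *: (rep_word s w *m mxP P c).

Lemma short_wordP d B c : short_word d B -> short_word d (B *m mxP P c).
Proof.
move=> [e [w [c' [sw_d ->]]]]; exists e, w, (c' (+) c); split=> //.
by rewrite -scalemxAl -mulmxA mxPM.
Qed.

Lemma short_wordM d B k : short_word d B -> short_word d.+1 (B *m s (v k)).
Proof.
move=> [e [w [c [sw_d ->]]]]; exists (e * (-1) ^+ (c && par k)), (rcons w k), c.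
split; first by rewrite size_rcons.
by rewrite -scalemxAl -mulmxA (mxP_rep _ (v_par k)) -scalemxAr scalerA rep_word_rcons mulmxA.
Qed.

Lemma short_wordMw d B J : short_word d B -> short_word (d + size J) (B *m rep_word s J).
Proof.
elim: J d B => [|k J IH] d B dB /=; first by rewrite addn0 mulmx1.
by rewrite mulmxA addnS -addSn; apply: IH; apply: short_wordM.
Qed.

End Word.

Variables (N : nat) (P0 : 'M[K]_N) (rho : g -> 'M[K]_N) (Q0 : I -> 'M[K]_N).
Hypothesis rho_rep : super_rep P0 rho.
Hypothesis Q0_1 : forall k b, \tr (Q0 k *m mxP P0 b) = 0.
Hypothesis Q0_rho : forall k j, \tr (Q0 k *m rho (v j)) = (j == k)%:R.

Variables (good : I -> Prop) (E : g -> Prop).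
Hypothesis good_even : forall k, good k -> par k = false.
Hypothesis good_int : forall k, good k -> intmx (Q0 k).
Hypothesis E_even : forall x, E x -> x \in spart g false.
Hypothesis E_int : forall x k, E x -> intmx (mxdp (rho x) k).

(** The vanishing in [wf_short] is demanded also after multiplication by the parity operator;
    without this the induction on js breaks, because odd letters leave such an operator in the
    second factor. *)
Record word_functional (js : seq I) n (P : 'M[K]_n) (s : g -> 'M[K]_n) (Q : 'M[K]_n) : Prop :=
  WordFunctional {
  wf_rep : super_rep P s;
  wf_short : forall J b, (size J < size js)%N -> \tr (Q *m (rep_word s J *m mxP P b)) = 0;
  wf_val : forall J, size J = size js -> \tr (Q *m rep_word s J) = matching_value js J;
  wf_int : (forall k, k \in js -> good k) -> intmx Q;
  wf_E : forall x k, E x -> intmx (mxdp (s x) k) }.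

Section Step.
Variables (js : seq I) (n : nat) (P : 'M[K]_n) (s : g -> 'M[K]_n) (Q : 'M[K]_n).
Hypothesis wf : word_functional js P s Q.
Variable k : I.

Let srep := wf_rep wf.
(** The factor [mxP P (par k)] is there to cancel the parity operator that the letter k, if odd,
    leaves in the second factor when it is sent to the first. *)
Let Q' := mxP P (par k) *m Q.
Let D := tens_rep P rho s.
Let PP := P0 *t P.

Let tensrep : super_rep PP D. Proof. exact: super_rep_tens. Qed.

Let Q'E M : \tr (Q' *m M) = \tr (Q *m (M *m mxP P (par k))).
Proof. by rewrite /Q' -mulmxA mxtrace_mulC mulmxA. Qed.

Let short0 d B : short_word P s d B -> (d < size js)%N -> \tr (Q' *m B) = 0.
Proof.
move=> [e [w [c [swd ->]]]] dlt; rewrite Q'E -scalemxAl -scalemxAr mxtraceZ -mulmxA (mxPM srep).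
by rewrite (wf_short wf) ?mulr0 //; apply: leq_ltn_trans dlt.
Qed.

Let DE x : D (v x) = rho (v x) *t mxP P (par x) + 1%:M *t s (v x).
Proof. by rewrite /D (tens_rep_hom P s rho_rep (v_par x)). Qed.

Let mxPPE b : mxP PP b = mxP P0 b *t mxP P b.
Proof. by case: b => //=; rewrite tensmx11. Qed.

(* In the coproduct of a word J, the functional [Q0 k] kills the terms with no
   letter in the first factor, and the inductive hypothesis on Q' those with
   too few letters left in the second; only the terms with exactly one letter
   in the first factor survive when J has the critical length. *)
Lemma tens_word_short d A B J b : short_word P s d B -> (d + size J <= size js)%N ->
  \tr ((Q0 k *t Q') *m ((A *t B) *m rep_word D J *m mxP PP b)) =
  \tr (Q0 k *m (A *m mxP P0 b)) * \tr (Q' *m (B *m rep_word s J *m mxP P b)).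
Proof.
elim: J d A B => [|x J IH] d A B dB le /=.
  by rewrite !mulmx1 mxPPE !tensmx_mul mxtrace_tens.
rewrite DE (mulmxA (A *t B)) mulmxDr !tensmx_mul mulmx1 !mulmxDl mulmxDr mxtraceD.
rewrite (IH d) //; last by move: le => /=; lia.
  rewrite (IH d.+1); [|exact: short_wordM|by move: le => /=; lia].
  rewrite (short0 (d := d + size J)%N); [|apply: short_wordP => //; apply: short_wordMw => //|by move: le => /=; lia].
    by rewrite mulr0 add0r !mulmxA.
  exact: short_wordP.
exact: short_wordP.
Qed.

Lemma tens_word_long w J : (size w + size J)%N = (size js).+1 ->
  \tr ((Q0 k *t Q') *m ((1%:M *t rep_word s w) *m rep_word D J)) =
  removal_sum (fun w J' => (-1) ^+ (par k && wpar J') * matching_value js (w ++ J')) k w J.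
Proof.
elim: J w => [|x J IH] w sz /=.
  rewrite mulmx1 tensmx_mul mxtrace_tens mulmx1.
  by have := Q0_1 k false; rewrite /= mulmx1 => ->; rewrite mul0r.
rewrite DE (mulmxA (1%:M *t _)) mulmxDr !tensmx_mul mulmx1 mul1mx !mulmxDl mulmxDr mxtraceD.
rewrite -rep_word_rcons IH; last by rewrite size_rcons; move: sz => /=; lia.
congr (_ + _).
have dB : short_word P s (size w) (rep_word s w *m mxP P (par x)).
  by exists 1, w, (par x); rewrite scale1r.
have := @tens_word_short (size w) (rho (v x)) _ J false dB.
rewrite /= !mulmx1 => ->; last by move: sz => /=; lia.
rewrite Q0_rho; case: eqP => [-> | _]; last by rewrite mul0r.
rewrite mul1r Q'E -(mulmxA (rep_word s w)) (mxP_sw srep) -scalemxAr (mulmxA (rep_word s w)) -rep_word_cat -scalemxAl -scalemxAr mxtraceZ.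
rewrite -(mulmxA (rep_word s _)) (mxPM srep) addbb /= mulmx1 (wf_val wf) //.
by rewrite size_cat; move: sz => /=; lia.
Qed.

Lemma word_functional_step : word_functional (k :: js) PP D (Q0 k *t Q').
Proof.
split=> //.
- move=> J b; rewrite ltnS => le.
  have d1 : short_word P s 0 1%:M.
    by exists 1, [::], false; rewrite scale1r mulmx1.
  have := @tens_word_short 0 1%:M _ J b d1 le.
  by rewrite tensmx11 !mul1mx Q0_1 mul0r.
- move=> J sz; have := @tens_word_long [::] J sz.
  by rewrite /= tensmx11 mul1mx.
- move=> gjs; have gk : good k by apply: gjs; rewrite inE eqxx.
  apply: intmx_tens; first exact: good_int.
  rewrite /Q' (good_even gk) mul1mx; apply: (wf_int wf) => j jjs; apply: gjs.
  by rewrite inE jjs orbT.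
- move=> x i Ex; rewrite /D (tens_rep_hom P s rho_rep (E_even Ex)) /= mxdp_tens //.
  apply: intmx_sum => j _; apply: intmx_tens; [exact: E_int | exact: (wf_E wf)].
Qed.

End Step.

Lemma word_functional_exists js : exists n (P : 'M[K]_n) s Q, word_functional js P s Q.
Proof.
elim: js => [|k js [n [P [s [Q wf]]]]]; last first.
  by exists (N * n)%N, (P0 *t P), (tens_rep P rho s), (Q0 k *t (mxP P (par k) *m Q));
     exact: word_functional_step.
(* For the empty list the functional is the counit, realized on the trivial module of dimension
   1. *)
exists 1%N, 1%:M, (fun=> 0), 1%:M; split=> //.
- split; first by move=> a x y; rewrite scaler0 addr0.
  + by rewrite mulmx1.
  + by move=> b x _; rewrite mulmx0 mul0mx scaler0.
  + by move=> *; rewrite mulmx0 scaler0 subrr.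
- by case=> //= _; rewrite mulmx1 mxtrace1.
- by move=> _; apply: intmx1.
- move=> x [|k] _; rewrite /mxdp; last by rewrite exprS mul0r scaler0; apply: intmx0.
  by rewrite expr0 invr1 scale1r; apply: intmx1.
Qed.

End WordFunctionals.

Section WordValues.
Variables (K : fieldType) (I : eqType) (par : I -> bool).

Lemma removal_sum_cat (f : seq I -> seq I -> K) k w J J' : k \notin J ->
  removal_sum f k w (J ++ J') = removal_sum f k (w ++ J) J'.
Proof.
elim: J w => [|x J IH] w /=; first by rewrite cats0.
rewrite inE negb_or => /andP[kx kJ]; rewrite eq_sym (negPf kx) add0r IH //.
by rewrite cat_rcons.
Qed.

Lemma removal_sum_notin (f : seq I -> seq I -> K) k w J : k \notin J -> removal_sum f k w J = 0.
Proof. by move=> kJ; rewrite -[J]cats0 removal_sum_cat. Qed.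

Lemma removal_sum_nseq (f : seq I -> seq I -> K) h k w J c :
  (forall w J, f w J = h (w ++ J)) -> k \notin J ->
  removal_sum f k w (nseq c k ++ J) = c%:R * h (w ++ nseq c.-1 k ++ J).
Proof.
move=> fh kJ; elim: c w => [|c IH] w /=; first by rewrite mul0r removal_sum_notin.
rewrite eqxx fh IH -[in RHS]addn1 natrD mulrDl mul1r addrC; congr (_ + _).
by case: c {IH} => [|c] /=; rewrite ?mul0r // cat_rcons.
Qed.

Definition eword (e : I -> nat) (l : seq I) : seq I := flatten [seq nseq (e k) k | k <- l].

Lemma size_eword e l : size (eword e l) = mdeg e l.
Proof.
by rewrite /eword size_flatten /shape -map_comp sumnE big_map; apply: eq_bigr => k _; rewrite /= size_nseq.
Qed.

Lemma count_eword e l k : uniq l -> k \in l -> count_mem k (eword e l) = e k.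
Proof.
elim: l => //= x l IH /andP[xl ul]; rewrite inE /eword /= count_cat count_nseq /=.
have nin j : j \notin l -> count_mem j (eword e l) = 0%N.
  move=> jl; apply/count_memPn/negP => /flattenP[_ /mapP[i il ->]].
  by rewrite mem_nseq => /andP[_ /eqP ji]; move: jl; rewrite ji il.
case: (eqVneq k x) => [-> _ | kx /= kl].
  by rewrite [(true * _)%N]mul1n -/(eword e l) nin // addn0.
by rewrite mul0n add0n -/(eword e l) IH.
Qed.

Lemma eword_sub e l : {subset eword e l <= l}.
Proof.
move=> j /flattenP[_ /mapP[i il ->]].
by rewrite mem_nseq => /andP[_ /eqP ->].
Qed.

Lemma eq_eword e e' l : {in l, e =1 e'} -> eword e l = eword e' l.
Proof. by move=> E; rewrite /eword; congr flatten; apply/eq_in_map => k /E ->. Qed.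

(** In an ordered word all occurrences of k are adjacent, so removing any one of them leaves the
    same word. Each removal thus multiplies the count by the current exponent, and the factorials
    build up, later to be cancelled by those of the divided powers. *)
Lemma matching_value_eword e l js : uniq l -> {subset js <= l} ->
  (forall k, par k -> (e k <= 1)%N) -> size js = mdeg e l ->
  exists b : bool, matching_value K par js (eword e l) = (-1) ^+ b *
    (if all (fun k => count_mem k js == e k) l then \prod_(k <- l) (e k)`!%:R else 0).
Proof.
move=> ul; elim: js e => [|k js IH] e sub epar sz.
  exists false; rewrite mul1r /=.
  have e0 k : k \in l -> e k = 0%N.
    move=> kl; apply/eqP; rewrite -leqn0.
    by have := sz; rewrite /mdeg (big_rem k kl) /=; lia.
  have -> : all (fun k => 0%N == e k) l by apply/allP => k kl; rewrite e0.
  by rewrite big_seq big1 // => k kl; rewrite e0.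
have kl : k \in l by apply: sub; rewrite inE eqxx.
have subjs : {subset js <= l} by move=> x xjs; apply: sub; rewrite inE xjs orbT.
have [l1 [l2 [El kl1 kl2]]] : exists l1 l2, [/\ l = l1 ++ k :: l2, k \notin l1 & k \notin l2].
  case/splitPr: kl ul => l1 l2; rewrite cat_uniq /= negb_or => /and4P[_ /andP[kl1 _] kl2 _].
  by exists l1, l2.
have notinw e1 (l' : seq I) : k \notin l' -> k \notin eword e1 l'.
  by move=> kl'; apply: contra kl'; apply: eword_sub.
have Ew e1 : eword e1 l = eword e1 l1 ++ nseq (e1 k) k ++ eword e1 l2.
  by rewrite El /eword map_cat flatten_cat.
have Ed e1 : mdeg e1 l = (e1 k + (mdeg e1 l1 + mdeg e1 l2))%N.
  by rewrite El /mdeg big_cat big_cons /=; lia.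
rewrite /= Ew removal_sum_cat ?notinw //.
case ek : (e k) => [|c].
  exists false; rewrite removal_sum_notin ?notinw //.
  have -> : all (fun j => ((k == j) + count_mem j js)%N == e j) l = false.
    by apply/negP => /allP/(_ k kl); rewrite ek eqxx.
  by rewrite mulr0.
pose e' j := if j == k then c else e j.
have e'E (l' : seq I) : k \notin l' -> {in l', e =1 e'}.
  by move=> kl' j jl'; rewrite /e'; case: eqP => // jk; move: kl'; rewrite -jk jl'.
have e'par j : par j -> (e' j <= 1)%N.
  by rewrite /e'; case: eqP => [-> /epar | _ /epar]; rewrite ?ek //; lia.
have sz' : size js = mdeg e' l.
  move: sz; rewrite !Ed /= ek /e' eqxx -/e' (eq_mdeg (e'E _ kl1)) (eq_mdeg (e'E _ kl2)).
  by rewrite addSn => -[].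
have [b Hb] := IH e' subjs e'par sz'.
have allE : all (fun j => ((k == j) + count_mem j js)%N == e j) l =
            all (fun j => count_mem j js == e' j) l.
  apply: eq_in_all => j jl; rewrite /e' eq_sym; case: (eqVneq j k) => [-> | _].
    by rewrite ek add1n eqSS.
  by rewrite add0n.
have prodE : \prod_(j <- l) ((e j)`!%:R : K) = c.+1%:R * \prod_(j <- l) (e' j)`!%:R.
  rewrite El !big_cat !big_cons /= ek /e' eqxx factS natrM -/e'.
  have P l' : k \notin l' -> \prod_(j <- l') ((e j)`!%:R : K) = \prod_(j <- l') (e' j)`!%:R.
    by move=> kl'; apply: eq_big_seq => j /(e'E _ kl') ->.
  by rewrite !P //; ring.
have Ew' : eword e' l = eword e l1 ++ nseq c k ++ eword e l2.
  by rewrite Ew /e' eqxx -/e' (eq_eword (e'E _ kl1)) (eq_eword (e'E _ kl2)).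
(* An odd k occurs exactly once, and its removal costs the sign of passing the letters after it; for
   k even the c + 1 occurrences contribute equally. *)
case pk : (par k).
  have c0 : c = 0%N by have := epar _ pk; rewrite ek; lia.
  rewrite c0 /= eqxx removal_sum_notin ?notinw // addr0.
  exists (wpar par (eword e l2) (+) b); rewrite allE prodE c0 mul1r.
  rewrite signr_addb -[RHS]mulrA -Hb; congr (_ * _).
  by rewrite Ew' c0.
exists b; rewrite (@removal_sum_nseq _ (fun J => matching_value K par js J)) ?notinw //; last first.
  by move=> w J /=; rewrite mul1r.
rewrite /= -Ew' Hb allE prodE; case: ifP => _; last by rewrite !mulr0.
ring.
Qed.

End WordValues.

Section Env.
Variables (K : fieldType) (g : lieSuper K) (U : algType K) (iota : g -> U).
Hypothesis Uenv : universal_enveloping iota.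

Lemma env_rep n (P : 'M[K]_n) (s : g -> 'M[K]_n) : super_rep P s ->
  exists F : U -> 'M[K]_n, [/\ linear F, F 1 = 1%:M,
    (forall x y, F (x * y) = F x *m F y) & forall x, F (iota x) = s x].
Proof.
(* In size 0 one has 1 = 0, and the zero map has all the required properties. *)
case: n P s => [|n] P s [ls _ _ sb].
  exists (fun=> 0); split.
  - by move=> a x y; apply/matrixP => -[].
  - by apply/matrixP => -[].
  - by move=> x y; apply/matrixP => -[].
  - by move=> x; apply/matrixP => -[].
have [_ /(_ _ s)] := Uenv; case; first split=> // a b x y xa yb.
  by rewrite (sb a b) //; case: (a && b); rewrite /= ?scale1r ?mul1r ?scaleN1r ?mulN1r.
case=> F FE _; exists F; split=> //.
- by move=> a x y; rewrite linearP.
- by rewrite rmorph1.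
- by move=> x y; rewrite rmorphM.
Qed.

End Env.

Section Families.
Variables (K : fieldType) (V : vectType K) (T : finType) (F : T -> V).

Definition fam : #|T|.-tuple V := [tuple F (enum_val i) | i < #|T|].
Definition fcoord (t : T) : V -> K := coord fam (enum_rank t).
Definition free_family := forall c : T -> K, \sum_t c t *: F t = 0 -> forall t, c t = 0.

Lemma fam_nth (i : 'I_#|T|) : fam`_i = F (enum_val i).
Proof. by rewrite -tnth_nth tnth_mktuple. Qed.

Lemma sum_enum_val (R : nmodType) (G : T -> R) : \sum_(i < #|T|) G (enum_val i) = \sum_t G t.
Proof.
rewrite (reindex_onto (@enum_rank T) (@enum_val T _)) /=.
  by apply: eq_big => t; rewrite enum_rankK ?eqxx.
by move=> i _; rewrite enum_valK.
Qed.

Lemma free_familyP : free_family <-> free fam.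
Proof.
split=> [Ff | /freeP Ff c c0 t].
  apply/freeP => c c0 i; rewrite -[i]enum_valK; apply: (Ff (fun t => c (enum_rank t))).
  rewrite -[RHS]c0 -(sum_enum_val (fun t => c (enum_rank t) *: F t)); apply: eq_bigr => j _.
  by rewrite enum_valK fam_nth.
rewrite -[t]enum_rankK; apply: (Ff (fun i => c (enum_val i))).
rewrite -[RHS]c0 -(sum_enum_val (fun t => c t *: F t)); apply: eq_bigr => j _.
by rewrite fam_nth.
Qed.

Lemma fcoord_free t s : free_family -> fcoord t (F s) = (s == t)%:R.
Proof.
move=> /free_familyP Ff; rewrite /fcoord -{1}[s]enum_rankK -fam_nth coord_free //.
by rewrite (can_eq enum_rankK) eq_sym.
Qed.

Lemma fcoord_expand x : x \in <<fam>>%VS -> x = \sum_t fcoord t x *: F t.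
Proof.
move=> /coord_span {1}->; rewrite -(sum_enum_val (fun t => fcoord t x *: F t)); apply: eq_bigr => i _.
by rewrite fam_nth /fcoord enum_valK.
Qed.

Lemma fcoord_linear t : linear (fcoord t : V -> K^o).
Proof. by move=> a x y; rewrite /fcoord linearP. Qed.

End Families.

(** * The adjoint module enlarged by a trivial 1|1 summand, and its dual functionals *)

Section Adjoint.
Variables (K : fieldType) (char0 : [pchar K] =i pred0) (g : lieSuper K).
Variables (I : finType) (v : I -> g) (par : I -> bool).
Hypothesis v_par : forall k, v k \in spart g (par k).
Hypothesis v_free : free_family v.
Hypothesis v_span : forall x, x = \sum_k fcoord v k x *: v k.
Hypothesis centerless : forall x : g, (forall y : g, sbr x y = 0) -> x = 0.

Local Notation co := (fcoord v).

Lemma fcoordD k x y : co k (x + y) = co k x + co k y.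
Proof. by rewrite (linear_funD _ _ (fcoord_linear v k)). Qed.

Lemma fcoordZ k a x : co k (a *: x) = a * co k x.
Proof. by rewrite (linear_funZ _ _ (fcoord_linear v k)). Qed.

Lemma fcoord_bigsum k J r (P : pred J) (G : J -> g) :
  co k (\sum_(j <- r | P j) G j) = \sum_(j <- r | P j) co k (G j).
Proof. by rewrite (linear_fun_sum _ _ _ (fcoord_linear v k)). Qed.

Lemma fcoord_basis k j : co k (v j) = (j == k)%:R.
Proof. exact: fcoord_free. Qed.

Lemma eq_fcoord x y : (forall k, co k x = co k y) -> x = y.
Proof. by move=> E; rewrite [x]v_span [y]v_span; apply: eq_bigr => k _; rewrite E. Qed.

Lemma fcoord_part b k x : x \in spart g b -> par k != b -> co k x = 0.
Proof.
move=> xb; pose y c := \sum_(j | par j == c) co j x *: v j.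
have yc c : y c \in spart g c.
  by apply: memv_suml => j /eqP <-; apply: memvZ; apply: v_par.
have xE : x = y b + y (~~ b).
  rewrite {1}[x]v_span (bigID (fun j => par j == b)) /=; congr (_ + _).
  by apply: eq_bigl => j; case: (par j) (b) => [] [].
have y0 : y (~~ b) = 0.
  have yb : y (~~ b) \in spart g b.
    by rewrite -[y (~~ b)](addKr (y b)) -xE memvD // memvN.
  by case: (b) yb (yc (~~ b)) => /= h1 h2; apply: spart_disjoint.
move=> kb; have := congr1 (co k) y0.
rewrite fcoord_bigsum (bigD1 k) /=; last by case: (par k) (b) kb => [] [].
rewrite fcoordZ fcoord_basis eqxx mulr1 big1 ?addr0 => [->|j /andP[_ jk]].
  by rewrite /fcoord linear0.
by rewrite fcoordZ fcoord_basis (negPf jk) mulr0.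
Qed.

Lemma sbrDl x y z : sbr (x + y) z = sbr x z + sbr y z :> g.
Proof. exact: (linear_funD _ _ (@sbr_linl K g z)). Qed.

Lemma sbrDr x y z : sbr z (x + y) = sbr z x + sbr z y :> g.
Proof. exact: (linear_funD _ _ (@sbr_linr K g z)). Qed.

Lemma sbrZl a y z : sbr (a *: y) z = a *: sbr y z :> g.
Proof. exact: (linear_funZ _ _ (@sbr_linl K g z)). Qed.

Lemma sbrZr a y z : sbr z (a *: y) = a *: sbr z y :> g.
Proof. exact: (linear_funZ _ _ (@sbr_linr K g z)). Qed.

Lemma sbr_sumr z J r (P : pred J) (G : J -> g) :
  sbr z (\sum_(j <- r | P j) G j) = \sum_(j <- r | P j) sbr z (G j).
Proof. exact: (linear_fun_sum _ _ _ (@sbr_linr K g z)). Qed.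

Definition ad_mx (x : g) : 'M[K]_(#|I|) :=
  \matrix_(i, j) co (enum_val i) (sbr x (v (enum_val j))).

Definition ad_par : 'M[K]_(#|I|) :=
  \matrix_(i, j) ((i == j)%:R * (-1) ^+ par (enum_val i)).

Lemma ad_mx_linear : linear ad_mx.
Proof.
by move=> a x y; apply/matrixP => i j; rewrite !mxE sbrDl sbrZl fcoordD fcoordZ.
Qed.

Lemma ad_mxM x y i j : (ad_mx x *m ad_mx y) i j =
  co (enum_val i) (sbr x (sbr y (v (enum_val j)))).
Proof.
rewrite mxE [sbr y _]v_span sbr_sumr fcoord_bigsum -[RHS]sum_enum_val.
by apply: eq_bigr => k _; rewrite !mxE sbrZr fcoordZ mulrC.
Qed.

Lemma ad_parM (M : 'M[K]_(#|I|)) i j : (ad_par *m M) i j = (-1) ^+ par (enum_val i) * M i j.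
Proof.
rewrite mxE (bigD1 i) //= mxE eqxx mul1r big1 ?addr0 // => k /negPf ki.
by rewrite mxE eq_sym ki !mul0r.
Qed.

Lemma ad_Mpar (M : 'M[K]_(#|I|)) i j : (M *m ad_par) i j = (-1) ^+ par (enum_val j) * M i j.
Proof.
rewrite mxE (bigD1 j) //= mxE eqxx mul1r mulrC big1 ?addr0 // => k /negPf kj.
by rewrite mxE kj !mul0r mulr0.
Qed.

(* The adjoint representation plus a trivial one of dimension 1|1, which makes
   1 and the parity operator linearly independent of the image of g. *)
Definition ad1_mx (x : g) : 'M[K]_(#|I| + 2) := block_mx (ad_mx x) 0 0 0.

Definition par11 : 'M[K]_2 := \matrix_(i, j) ((i == j)%:R * (-1) ^+ i).

Definition ad1_par : 'M[K]_(#|I| + 2) := block_mx ad_par 0 0 par11.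

Lemma ad1_rep : super_rep ad1_par ad1_mx.
Proof.
have par11_sq : par11 *m par11 = 1%:M.
  apply/matrixP => i j; rewrite !mxE !big_ord_recl big_ord0 !mxE.
  case: i => -[|[|//]] ? ; case: j => -[|[|//]] ? /=; rewrite ?eqE /=; ring.
split.
- move=> a x y; rewrite /ad1_mx ad_mx_linear.
  by rewrite scale_block_mx add_block_mx !scaler0 !addr0.
- rewrite /ad1_par mulmx_block !mulmx0 !mul0mx !addr0 !add0r par11_sq.
  have -> : ad_par *m ad_par = 1%:M.
    apply/matrixP => i j; rewrite ad_parM !mxE mulrCA -signr_addb addbb mulr1.
    by [].
  by rewrite -scalar_mx_block.
- move=> b x xb; rewrite /ad1_par /ad1_mx !mulmx_block !mulmx0 !mul0mx !addr0.
  rewrite scale_block_mx !scaler0; congr block_mx.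
  apply/matrixP => i j; rewrite ad_parM [RHS]mxE ad_Mpar mxE mulrA -signr_addb.
  have := sbr_part xb (v_par (enum_val j)).
  case: (eqVneq (par (enum_val i)) (b (+) par (enum_val j))) => [-> // | ne].
  by move=> h; rewrite (fcoord_part h ne) !mulr0.
move=> a b x y xa yb; rewrite /ad1_mx !mulmx_block !mulmx0 !mul0mx !addr0.
rewrite scale_block_mx !scaler0 -scaleN1r scale_block_mx !scaler0 add_block_mx !addr0.
congr block_mx; apply/matrixP => i j.
rewrite scaleN1r [LHS]mxE [RHS]mxE ad_mxM [X in _ + X]mxE [X in _ - X]mxE ad_mxM.
by rewrite (sbr_jacobi (v (enum_val j)) xa yb) fcoordD fcoordZ addrK.
Qed.

(** On the trivial summand the relation reads a + b = 0 and a - b = 0, hence a = b = 0. What remains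
    says that the combination x of the basis acts by 0, so x is central. *)
Lemma ad1_free (a b : K) (c : I -> K) :
  a *: 1%:M + b *: ad1_par + \sum_k c k *: ad1_mx (v k) = 0 ->
  [/\ a = 0, b = 0 & forall k, c k = 0].
Proof.
pose x := \sum_k c k *: v k.
have -> : \sum_k c k *: ad1_mx (v k) = ad1_mx x.
  have ll : linear ad1_mx by case: ad1_rep.
  by rewrite (linear_fun_sum _ _ _ ll); apply: eq_bigr => k _; rewrite (linear_funZ _ _ ll).
rewrite /ad1_par /ad1_mx scalar_mx_block !scale_block_mx !add_block_mx !scaler0 !addr0.
rewrite -[RHS](@block_mx0 K #|I| 2 #|I| 2) => /eq_block_mx [E1 _ _ E2].
have h0 := congr1 (fun M : 'M[K]_2 => M ord0 ord0) E2.
have h1 := congr1 (fun M : 'M[K]_2 => M ord_max ord_max) E2.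
rewrite !mxE /= !mulr1 in h0; rewrite !mxE /= !mulr1 mulrN1 in h1.
have a0 : a = 0.
  have : 2%:R * a = 0 by move: (congr2 +%R h0 h1); rewrite addr0 => <-; ring.
  by move/eqP; rewrite mulf_eq0 (negPf (natK_neq0 char0 1)) => /eqP.
have b0 : b = 0 by move: h0; rewrite a0 add0r.
split=> //; move: E1; rewrite a0 b0 !scale0r !add0r => adx0.
have x0 : x = 0.
  apply: centerless => y; rewrite [y]v_span sbr_sumr big1 // => j _; rewrite sbrZr.
  suff -> : sbr x (v j) = 0 by rewrite scaler0.
  apply: eq_fcoord => i; have := congr1 (fun M : 'M[K]_(#|I|) => M (enum_rank i) (enum_rank j)) adx0.
  by rewrite !mxE !enum_rankK => ->; rewrite /fcoord linear0.
exact: v_free.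
Qed.

Lemma trace_functional (V := 'M[K]_(#|I| + 2)) (phi : V -> K) : linear (phi : V -> K^o) ->
  exists Q : V, forall M, \tr (Q *m M) = phi M.
Proof.
move=> lphi; exists (\matrix_(i, j) phi (delta_mx j i)) => M.
rewrite [M in RHS]matrix_sum_delta (linear_fun_sum _ _ _ lphi) /mxtrace.
under [RHS]eq_bigr => i _ do rewrite (linear_fun_sum _ _ _ lphi).
rewrite [RHS]exchange_big /=; apply: eq_bigr => i _.
rewrite mxE; apply: eq_bigr => j _.
by rewrite mxE (linear_funZ _ _ lphi) mulrC.
Qed.

Lemma ad1_functional k : exists Q : 'M[K]_(#|I| + 2),
  (forall b, \tr (Q *m mxP ad1_par b) = 0) /\
  forall j, \tr (Q *m ad1_mx (v j)) = (j == k)%:R.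
Proof.
pose F (t : bool + I) : 'M[K]_(#|I| + 2) :=
  match t with inl b => mxP ad1_par b | inr j => ad1_mx (v j) end.
have Ff : free_family F.
  move=> c; rewrite big_sumType big_bool /= [X in X + _]addrC => /ad1_free [c1 c2 c3].
  by case=> [[]|j].
have [Q QE] := trace_functional (fcoord_linear F (inr k)).
exists Q; split=> [b|j].
  by rewrite QE (fcoord_free (inr k) (inl b) Ff).
by rewrite QE (fcoord_free (inr k) (inr j) Ff).
Qed.

Definition entry_mx (i j : I) : 'M[K]_(#|I| + 2) :=
  delta_mx (lshift 2 (enum_rank j)) (lshift 2 (enum_rank i)).

Lemma trace_entry i j M :
  \tr (entry_mx i j *m M) = M (lshift 2 (enum_rank i)) (lshift 2 (enum_rank j)).
Proof.
rewrite /mxtrace (bigD1 (lshift 2 (enum_rank j))) //= big1 ?addr0 => [|k /negPf kj].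
  rewrite mxE (bigD1 (lshift 2 (enum_rank i))) //= mxE !eqxx mul1r big1 ?addr0 // => k /negPf ki.
  by rewrite mxE ki andbF mul0r.
by rewrite mxE big1 // => l _; rewrite mxE kj mul0r.
Qed.

Lemma intmx_entry i j : intmx (entry_mx i j).
Proof. by move=> k l; rewrite mxE; apply: subring_nat; apply: Zint_subring. Qed.

Lemma entry_par i j b : i != j -> \tr (entry_mx i j *m mxP ad1_par b) = 0.
Proof.
move=> ij; have ne : (enum_rank i == enum_rank j) = false.
  by rewrite (can_eq enum_rankK); apply: negPf.
rewrite trace_entry; case: b => /=; last by rewrite mxE (inj_eq (@lshift_inj _ _)) ne.
by rewrite block_mxEul mxE ne mul0r.
Qed.

Lemma entry_ad i j x : \tr (entry_mx i j *m ad1_mx x) = co i (sbr x (v j)).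
Proof. by rewrite trace_entry block_mxEul mxE !enum_rankK. Qed.

Lemma ad_mx_exp x k i j : (ad_mx x ^+ k) i j =
  co (enum_val i) (iter k (sbr x) (v (enum_val j))).
Proof.
elim: k i j => [|k IH] i j.
  by rewrite expr0 /= fcoord_basis (can_eq enum_valK) eq_sym -[1]/(1%:M) mxE.
rewrite exprS -mulmxE mxE iterS [iter k _ _]v_span sbr_sumr fcoord_bigsum -[RHS]sum_enum_val.
by apply: eq_bigr => l _; rewrite !mxE IH sbrZr fcoordZ mulrC.
Qed.

Lemma ad1_mx_exp x k : ad1_mx x ^+ k.+1 = block_mx (ad_mx x ^+ k.+1) 0 0 0.
Proof.
elim: k => [|k IH]; first by rewrite !expr1.
by rewrite exprS IH -mulmxE /ad1_mx mulmx_block !mulmx0 !mul0mx !addr0 mulmxE -exprS.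
Qed.

Lemma intmx_ad1 x : (forall k i j, Zint (co i ((k`!%:R)^-1 *: iter k (sbr x) (v j)))) ->
  forall k, intmx (mxdp (ad1_mx x) k).
Proof.
move=> xint [|k]; rewrite /mxdp; first by rewrite expr0 invr1 scale1r; apply: intmx1.
rewrite ad1_mx_exp scale_block_mx !scaler0 => i j; rewrite mxE.
case: splitP => i' _; rewrite mxE; case: splitP => j' _; rewrite ?mxE.
- by rewrite ad_mx_exp -fcoordZ.
- exact: (subring0 (Zint_subring K)).
- exact: (subring0 (Zint_subring K)).
- exact: (subring0 (Zint_subring K)).
Qed.

End Adjoint.

(** * Divided powers and binomials *)

Section DividedPowers.
Variables (K : fieldType) (char0 : [pchar K] =i pred0) (U : algType K).
Implicit Types (x y z e f h : U).

Local Notation dp := (@divided_power K U).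
Local Notation bin := (@divided_binomial K U).

Lemma natr_scale1 n : n%:R = n%:R *: 1 :> U.
Proof. by rewrite scaler_nat. Qed.

Lemma mulr_natZl n x : n%:R * x = (n%:R : K) *: x.
Proof. by rewrite natr_scale1 -scalerAl mul1r. Qed.

Lemma mulr_natZr n x : x * n%:R = (n%:R : K) *: x.
Proof. by rewrite natr_scale1 -scalerAr mulr1. Qed.

Lemma natK_lcancel n x y : (n.+1%:R : K) *: x = (n.+1%:R : K) *: y -> x = y.
Proof. by apply: scalerI; apply: natK_neq0. Qed.

Lemma invfactS n : (n.+1%:R : K) * (n.+1`!%:R)^-1 = (n`!%:R)^-1.
Proof.
rewrite factS natrM invfM mulrA mulfV ?mul1r //; exact: natK_neq0.
Qed.

Lemma dp0 x : dp x 0 = 1.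
Proof. by rewrite /divided_power expr0 invr1 scale1r. Qed.

Lemma dp1 x : dp x 1 = x.
Proof. by rewrite /divided_power expr1 invr1 scale1r. Qed.

Lemma dpS x n : (n.+1%:R : K) *: dp x n.+1 = x * dp x n.
Proof. by rewrite /divided_power scalerA invfactS exprS scalerAr. Qed.

Lemma dpSr x n : (n.+1%:R : K) *: dp x n.+1 = dp x n * x.
Proof. by rewrite /divided_power scalerA invfactS exprSr scalerAl. Qed.

Lemma dpM x p q : dp x p * dp x q = ('C(p + q, p)%:R : K) *: dp x (p + q).
Proof.
rewrite /divided_power -scalerAl -scalerAr !scalerA -exprD; congr (_ *: _).
have := bin_fact (leq_addr q p) => /(congr1 (fun j => j%:R : K)).
rewrite addKn !natrM => <-.
have hp := fact_neq0 char0 p; have hq := fact_neq0 char0 q.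
have hC : ('C(p + q, p)%:R : K) != 0.
  by move/pcharf0P: char0 => ->; rewrite -lt0n bin_gt0 leq_addr.
by field; rewrite hp hq hC.
Qed.

Lemma dbin0 x : bin x 0 = 1.
Proof. by rewrite /divided_binomial big_ord0 invr1 scale1r. Qed.

Lemma dbinS x n : (n.+1%:R : K) *: bin x n.+1 = bin x n * (x - n%:R).
Proof. by rewrite /divided_binomial scalerA invfactS big_ord_recr /= scalerAl. Qed.

Lemma dbin1 x : bin x 1 = x.
Proof. by have := dbinS x 0; rewrite scale1r dbin0 mul1r subr0. Qed.

Lemma comm_scale y z (a : K) : GRing.comm y z -> GRing.comm y (a *: z).
Proof. by rewrite /GRing.comm -scalerAl -scalerAr => ->. Qed.

Lemma bin_comm x y n : GRing.comm y x -> GRing.comm y (bin x n).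
Proof.
move=> yx; apply: comm_scale; apply: big_ind => [||i _].
- exact: commr1.
- by move=> a b; apply: commrM.
- by apply: commrB => //; apply: commr_nat.
Qed.

Lemma dbinSl x n : (n.+1%:R : K) *: bin x n.+1 = (x - n%:R) * bin x n.
Proof.
rewrite dbinS; apply/commr_sym/bin_comm/commr_sym; apply: commrB => //.
exact: commr_nat.
Qed.

Definition binK (a : K) n : K := (n`!%:R)^-1 * \prod_(k < n) (a - k%:R).

Lemma bin_scalar a n : bin (a *: 1) n = binK a n *: 1.
Proof.
rewrite /divided_binomial /binK -scalerA; congr (_ *: _).
elim: n => [|n IH]; first by rewrite !big_ord0 scale1r.
by rewrite !big_ord_recr /= IH natr_scale1 -scalerBl -scalerAl mul1r scalerA.
Qed.

(** Vandermonde's identity. After multiplication by n + 1 the last factor x + y - n is split as (x -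
    i) + (y - (n - i)), and each half raises one of the two indices. *)
Lemma dbinD x y n : GRing.comm x y -> bin (x + y) n = \sum_(i < n.+1) bin x i * bin y (n - i).
Proof.
move=> xy; elim: n => [|n IH]; first by rewrite big_ord1 !dbin0 mulr1.
apply: (@natK_lcancel n); rewrite dbinS IH mulr_suml.
pose G i := (i%:R : K) *: (bin x i * bin y (n.+1 - i)).
pose G' i := ((n.+1 - i)%:R : K) *: (bin x i * bin y (n.+1 - i)).
have -> : \sum_(i < n.+1) bin x i * bin y (n - i) * (x + y - n%:R) =
    \sum_(i < n.+1) (G i.+1 + G' i).
  apply: eq_bigr => i _; have le_in : (i <= n)%N by rewrite -ltnS.
  have -> : x + y - n%:R = (x - i%:R) + (y - (n - i)%:R).
    by rewrite natrB // opprB [RHS](AC (2*(1*2)) ((1*3*5)*(2*4))) /= addNr addr0.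
  have cy : GRing.comm (bin y (n - i)) (x - i%:R).
    by apply: commrB; [apply/commr_sym/bin_comm | apply: commr_nat].
  rewrite mulrDr -[X in X + _]mulrA cy mulrA -dbinS -[X in _ + X]mulrA -dbinS.
  rewrite /G /G' subSS (subSn le_in); congr (_ + _); first by rewrite scalerAl.
  by rewrite scalerAr.
have -> : (n.+1%:R : K) *: (\sum_(i < n.+2) bin x i * bin y (n.+1 - i)) = \sum_(i < n.+2) (G i + G' i).
  rewrite scaler_sumr; apply: eq_bigr => i _.
  by rewrite /G /G' -scalerDl -natrD subnKC // (leq_trans (leq_ord i)).
rewrite !big_split /=; congr (_ + _).
  by rewrite [RHS]big_ord_recl /G scale0r add0r.
by rewrite [RHS]big_ord_recr /= /G' subnn scale0r addr0.
Qed.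

Lemma bin_shift x y (c : K) n : y * x = x * (y + c *: 1) -> bin y n * x = x * bin (y + c *: 1) n.
Proof.
move=> yx; elim: n => [|n IH]; first by rewrite !dbin0 mulr1 mul1r.
apply: (@natK_lcancel n); rewrite scalerAl dbinS scalerAr dbinS mulrA -IH -!mulrA; congr (_ * _).
by rewrite mulrBr mulrBl yx mulr_natZl mulr_natZr.
Qed.

Lemma bin_shift_exp x y (c : K) n q : y * x = x * (y + c *: 1) ->
  bin y n * x ^+ q = x ^+ q * bin (y + (q%:R * c) *: 1) n.
Proof.
move=> yx; elim: q => [|q IH]; first by rewrite mul0r scale0r addr0 mulr1 mul1r.
rewrite exprSr mulrA IH -!mulrA; congr (_ * _).
have -> : y + (q.+1%:R * c) *: 1 = y + (q%:R * c) *: 1 + c *: 1.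
  by rewrite -addrA -scalerDl -[in LHS]addn1 natrD mulrDl mul1r.
apply: bin_shift; rewrite mulrDl yx -scalerAl mul1r -addrA !mulrDr -!scalerAr !mulr1.
by rewrite -addrA [_ + c *: x]addrC.
Qed.

Lemma binKS a n : n.+1%:R * binK a n.+1 = binK a n * (a - n%:R).
Proof. by rewrite /binK mulrA invfactS big_ord_recr mulrA. Qed.

Lemma binK0 a : binK a 0 = 1.
Proof. by rewrite /binK big_ord0 invr1 mulr1. Qed.

Lemma binK_pascal a n : binK (a + 1) n.+1 = binK a n.+1 + binK a n.
Proof.
have nz i := natK_neq0 char0 i.
elim: n => [|n IH].
  by have := binKS (a + 1) 0; have := binKS a 0; rewrite !binK0 !mul1r => -> ->; rewrite !subr0.
apply: (mulfI (nz n.+1)); rewrite mulrDr !binKS IH.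
have := binKS a n; rewrite -!natr1 => E.
apply/eqP; rewrite -subr_eq0; apply/eqP.
transitivity (binK a n * (a - n%:R) - (n%:R + 1) * binK a n.+1); first by ring.
by rewrite -E subrr.
Qed.

(** Pascal's rule transports integrality between a and a + 1 in both directions, starting at a = 0,
    where the coefficient vanishes. *)
Lemma binK_Zint a n : Zint a -> Zint (binK a n).
Proof.
have sZ := Zint_subring K.
elim: n a => [|n IH] a Za; first by rewrite binK0; apply: subring1.
case: Za => z ->.
have Z0 : Zint (binK 0 n.+1).
  by rewrite /binK big_ord_recl subrr mul0r mulr0; apply: subring0.
elim/int_ind: z => [//|m Hm|m Hm].
  rewrite -addn1 PoszD rmorphD /= binK_pascal; apply: subringD => //.
  exact/IH/Zint_int.
have := binK_pascal (- m.+1%:Z)%:~R n.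
have -> : (- m.+1%:Z)%:~R + 1 = (- m%:Z)%:~R :> K by rewrite -[1]/(1%:~R) -rmorphD /=; congr (_%:~R); lia.
move=> E; rewrite -(addrK (binK (- m.+1%:Z)%:~R n) (binK _ n.+1)) -E.
by apply: subringB => //; apply/IH/Zint_int.
Qed.

(** Here z k stands for (ad x)^k z / k!. The identity is the part of degree p in x of exp(x) z =
    (exp(ad x) z) exp(x). *)
Lemma dp_mul_ad x (z : nat -> U) p :
  (forall k, x * z k = z k * x + (k.+1%:R : K) *: z k.+1) ->
  dp x p * z 0%N = \sum_(k < p.+1) z k * dp x (p - k).
Proof.
move=> xz; elim: p => [|p IH]; first by rewrite big_ord1 dp0 mul1r mulr1.
apply: (@natK_lcancel p); rewrite scalerAl dpS -mulrA IH mulr_sumr.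
pose G k := ((p.+1 - k)%:R : K) *: (z k * dp x (p.+1 - k)).
pose G' k := (k%:R : K) *: (z k * dp x (p.+1 - k)).
have -> : \sum_(i < p.+1) x * (z i * dp x (p - i)) = \sum_(i < p.+1) (G i + G' i.+1).
  apply: eq_bigr => i _; have le_ip : (i <= p)%N by rewrite -ltnS.
  by rewrite mulrA xz mulrDl -mulrA -dpS /G /G' subSS subSn // scalerAr scalerAl.
have -> : (p.+1%:R : K) *: (\sum_(k < p.+2) z k * dp x (p.+1 - k)) = \sum_(k < p.+2) (G k + G' k).
  rewrite scaler_sumr; apply: eq_bigr => i _.
  by rewrite /G /G' -scalerDl -natrD subnK // (leq_trans (leq_ord i)).
rewrite !big_split /=; congr (_ + _).
  by rewrite [RHS]big_ord_recr /= /G subnn scale0r addr0.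
by rewrite [RHS]big_ord_recl /G' scale0r add0r.
Qed.

Lemma bin_pascal y n : bin (y + 1) n.+1 = bin y n.+1 + bin y n.
Proof.
elim: n => [|n IH]; first by rewrite !dbin1 dbin0.
apply: (@natK_lcancel n.+1); rewrite scalerDr !dbinS IH.
have -> : y + 1 - n.+1%:R = y - n%:R by rewrite -natr1 [n%:R + 1]addrC addrKA.
have -> : y - n.+1%:R = y - n%:R - 1 by rewrite -natr1 opprD addrA.
rewrite mulrDl -(dbinS y n) [in RHS]mulrBr mulr1 -addrA; congr (_ + _).
by rewrite -[n.+2]addn1 natrD scalerDl scale1r [RHS]addrC addrK.
Qed.

Section SL2.
Variables (e f h : U).
Hypothesis efh : e * f = f * e + h.
Hypothesis eh : e * h = (h - 2%:R) * e.
Hypothesis hf : h * f = f * (h - 2%:R).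

Lemma sl2_e_dp n : e * dp f n.+1 = dp f n.+1 * e + dp f n * (h - n%:R).
Proof.
elim: n => [|n IH]; first by rewrite dp1 dp0 mul1r subr0.
apply: (@natK_lcancel n.+1).
have E1 : dp f n * (h - n%:R) * f = (n.+1%:R : K) *: (dp f n.+1 * (h - n%:R - 2%:R)).
  rewrite scalerAl dpSr -!mulrA; congr (_ * _).
  by rewrite mulrBl hf mulr_natl -(mulr_natr f) -mulrBr addrAC.
rewrite scalerAr dpSr mulrA IH mulrDl E1 -mulrA efh mulrDr mulrA -addrA.
rewrite [in RHS]scalerDr [in RHS]scalerAl dpSr; congr (_ + _).
rewrite !scalerAr -mulrDr; congr (_ * _).
rewrite !natr_scale1 !scalerBr !scalerA -{1}[h]scale1r !addrA -scalerDl -!addrA -!opprD -!scalerDl.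
by congr (_ *: _ - _ *: _); rewrite ?nat1r // -!natrM -!natrD; congr (_%:R); lia.
Qed.

(** The default 0 lets the sum of [sl2_commutation] run up to m even when m exceeds n. *)
Definition dpz n k : U := if (k <= n)%N then dp f (n - k) else 0.

Lemma sl2_e_dpz n k : e * dpz n k = dpz n k * e + dpz n k.+1 * (h - n%:R + k.+1%:R).
Proof.
rewrite /dpz; case: (ltngtP k n) => [lt|gt|->].
- rewrite -[(n - k)%N]subnSK // sl2_e_dp; congr (_ + _ * _).
  by rewrite natrB // opprB addrA addrAC.
- by rewrite !mul0r mulr0 addr0.
- by rewrite subnn dp0 mul1r mulr1 mul0r addr0.
Qed.

(** Kostant's formula in rank 1, by induction on m. A further e passes the power of f by [sl2_e_dpz]
    and the binomial by shifting its argument by 2. *)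
Lemma sl2_commutation m n : dp e m * dp f n =
  \sum_(k < m.+1) dpz n k * bin (h + ((2 * k)%:R - (m + n)%:R)) k * dp e (m - k).
Proof.
elim: m => [|m IH].
  by rewrite big_ord1 /dpz subn0 dbin0 dp0 mulr1 mul1r mulr1.
apply: (@natK_lcancel m); rewrite scalerAl dpS -mulrA IH mulr_sumr.
pose y j : U := h + ((2 * j)%:R - (m + n)%:R - 2%:R).
pose G j := ((m.+1 - j)%:R : K) *: (dpz n j * bin (y j) j * dp e (m.+1 - j)).
pose G' j := if j is i.+1 then dpz n j * ((h - n%:R + j%:R) * bin (y j) i) * dp e (m.+1 - j) else 0.
have -> : \sum_(i < m.+1) e * (dpz n i * bin (h + ((2 * i)%:R - (m + n)%:R)) i * dp e (m - i))
   = \sum_(i < m.+1) (G i + G' i.+1).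
  apply: eq_bigr => i _; have le_im : (i <= m)%N by rewrite -ltnS.
  have -> : h + ((2 * i)%:R - (m + n)%:R) = y i + 2%:R by rewrite /y -addrA subrK.
  rewrite !mulrA sl2_e_dpz !mulrDl /G /G' subSS subSn //; congr (_ + _).
    have eb : e * bin (y i + 2%:R) i = bin (y i) i * e.
      have cz : GRing.comm e ((2 * i)%:R - (m + n)%:R - 2%:R).
        by do !apply: commrB; apply: commr_nat.
      symmetry; have := @bin_shift e (y i) 2%:R i; rewrite -natr_scale1; apply.
      rewrite mulrDr /y; move: (_ - 2%:R) cz => z cz.
      by rewrite mulrDl mulrDr eh cz mulrBl [2%:R * e]mulr_natl -[e *+ 2]mulr_natr addrAC subrK.
    by rewrite -(mulrA _ e) eb !mulrA -(mulrA _ e) -dpS scalerAr.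
  rewrite (mulrA (dpz n i.+1)); congr (_ * _ * bin _ _ * _).
  rewrite /y -!addrA; congr (_ + _); rewrite mulnS [(2 + 2 * i)%N]addnC (natrD _ (2 * i) 2) -!addrA.
  by congr (_ + _); rewrite addNr addr0 addrA [RHS]addrC -addrA addNr addr0.
rewrite big_split /=.
have -> : \sum_(i < m.+1) G i = \sum_(i < m.+2) G i.
  by rewrite [RHS]big_ord_recr /= /G subnn scale0r addr0.
have -> : \sum_(i < m.+1) G' i.+1 = \sum_(i < m.+2) G' i.
  by rewrite [RHS]big_ord_recl /= add0r.
rewrite -big_split /= scaler_sumr; apply: eq_bigr => j _.
have le_jm : (j <= m.+1)%N by rewrite -ltnS.
have -> : h + ((2 * j)%:R - (m.+1 + n)%:R) = y j + 1.
  rewrite /y -!addrA; congr (_ + (_ + _)).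
  by rewrite addSn -addn1 natrD opprD; congr (_ + _); rewrite -[2%:R]/(1 + 1) opprD subrK.
rewrite /G /G'; case: (nat_of_ord j) le_jm => [|i] le_im.
  by rewrite subn0 !dbin0 addr0.
(* Multiplication by y - i raises the index of the binomial and completes the coefficient m + 1 of
   the term from [G]; the summand m + 1 gives the other half of Pascal's rule. *)
have -> : h - n%:R + i.+1%:R = (y i.+1 - i%:R) + m.+1%:R.
  rewrite /y !natr_scale1 -!scalerBl -!addrA -!scaleNr -!scalerDl; congr (_ + _ *: _).
  by rewrite natrM natrD -!natr1; ring.
rewrite subSS mulrDl -dbinSl mulr_natZl bin_pascal.
move: (bin _ i.+1) (bin _ i) (dp e _) => b' b c.
rewrite !mulrDr !mulrDl scalerDr -!scalerAr -!scalerAl.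
by rewrite addrA -scalerDl -natrD addnS subnK.
Qed.
End SL2.
End DividedPowers.

(** * Root data and the adjoint representation *)

Lemma span_normal (K : fieldType) (V : lmodType K) (A : K -> Prop) (T : eqType)
    (P : T -> Prop) (b : T -> V) x : subring_pred A ->
  span A (fun u => exists e, P e /\ u = b e) x ->
  exists s (c : T -> K), [/\ uniq s, (forall e, e \in s -> P e), (forall e, A (c e))
    & x = \sum_(e <- s) c e *: b e].
Proof.
move=> sA; elim=> [|a _ y Aa [e [Pe ->]] _ [s [c [us Ps Ac ->]]]].
  by exists [::], (fun=> 0); split=> // [_|]; [apply: subring0 | rewrite big_nil].
have [es | es] := boolP (e \in s).
  exists s, (fun t => if t == e then a + c t else c t); split=> //.
    by move=> t; case: eqP => // _; apply: subringD.
  rewrite (bigD1_seq e) //= [in RHS](bigD1_seq e) //= eqxx scalerDl -addrA; congr (_ + (_ + _)).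
  by apply: eq_bigr => t /negPf ->.
exists (e :: s), (fun t => if t == e then a else c t); split=> //=.
- by rewrite es.
- by move=> t; rewrite inE => /orP[/eqP -> // | /Ps].
- by move=> t; case: eqP.
rewrite big_cons eqxx; congr (_ + _); apply: eq_big_seq => t ts.
by case: eqP => // te; move: es; rewrite -te ts.
Qed.

(* If some n j is odd, subtract a multiple of the relation; likewise for m; if
   all are even, the sum is divisible by 4. *)
Lemma int_bezout2 (J : finType) (n m : J -> int) : \sum_j n j * m j = 2 ->
  exists al be : J -> int, \sum_j al j * n j + \sum_j be j * m j = 1.
Proof.
move=> nm2.
have key (n1 m1 : J -> int) j t : \sum_j n1 j * m1 j = 2 -> n1 j = 2 * t + 1 ->
    exists al be : J -> int, \sum_j al j * n1 j + \sum_j be j * m1 j = 1.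
  move=> nm1 nj; exists (fun i => (i == j)%:R), (fun i => - t * n1 i).
  have -> : \sum_i - t * n1 i * m1 i = - t * \sum_i n1 i * m1 i.
    by rewrite mulr_sumr; apply: eq_bigr => i _; rewrite mulrA.
  rewrite nm1 (bigD1 j) //= big1 => [|i /negPf ->]; last by rewrite mul0r.
  rewrite eqxx nj mulr1n mul1r addr0; ring.
have dec (z : int) : (exists t, z = 2 * t + 1) \/ (exists t, z = 2 * t).
  have := divz_eq z 2; have := modz_ge0 z (isT : (2 : int) != 0).
  have := ltz_pmod z (isT : 0 < (2 : int)).
  case: (z %% 2)%Z => [[|[|//]]|//] _ _ E; [right|left]; exists (z %/ 2)%Z; rewrite {1}E; ring.
have [[j [t nj]] | nodd] := pselect (exists j t, n j = 2 * t + 1); first exact: key nj.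
have [[j [t mj]] | modd] := pselect (exists j t, m j = 2 * t + 1).
  have mn2 : \sum_j m j * n j = 2 by rewrite -nm2; apply: eq_bigr => i _; rewrite mulrC.
  by have [al [be E]] := key _ _ _ _ mn2 mj; exists be, al; rewrite addrC.
have /choice[n' n'E] : forall j, exists t, n j = 2 * t.
  by move=> j; case: (dec (n j)) => // -[t E]; case: nodd; exists j, t.
have /choice[m' m'E] : forall j, exists t, m j = 2 * t.
  by move=> j; case: (dec (m j)) => // -[t E]; case: modd; exists j, t.
have : \sum_j n j * m j = 4 * \sum_j n' j * m' j.
  by rewrite mulr_sumr; apply: eq_bigr => i _; rewrite n'E m'E; ring.
by rewrite nm2; move: (\sum_j _) => z; lia.
Qed.

Section KostantData.
Variables (K : fieldType) (char0 : [pchar K] =i pred0) (g : lieSuper K) (h : {vspace g}).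
Variables (D : seq (hdual h)) (H : 'I_(\dim h) -> subvs_of h) (X : hdual h -> g).

Local Notation I := (pbw_index D).

Definition root_vec (k : I) : g :=
  match k with inl a => X (ssval a) | inr i => val (H i) end.

Definition root_par (k : I) : bool :=
  if k is inl a then X (ssval a) \notin spart g false else false.

Definition lattice (x : g) := span Zint (fun u => exists k, u = root_vec k) x.

(** Signs and exact structure constants are forgotten. What survives is integrality, together with
    two divisibilities: by k! for the k-fold bracket with an even root vector ([kd_dp]), and by 2
    for the bracket of an odd root vector with itself ([kd_odd]), these being what products of
    divided powers and squares of odd vectors require. *)
Record kostant_data : Prop := KostantData {
  kd_basis : basis_of fullv ([seq val (H i) | i <- enum 'I_(\dim h)] ++ [seq X a | a <- D]);
  kd_uniq : uniq D;
  kd_zero : 0 \notin D;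
  kd_hom : forall a, a \in D -> exists p, X a \in spart g p;
  kd_h : (h <= spart g false)%VS;
  kd_HH : forall i j, sbr (val (H i)) (val (H j)) = 0;
  kd_HX : forall i a, a \in D -> sbr (val (H i)) (X a) = a (H i) *: X a;
  kd_weight : forall i a, a \in D -> Zint (a (H i) : K);
  kd_opp : forall a, a \in D -> - a \in D ->
    span Zint (fun u => exists i, u = val (H i)) (sbr (X a) (X (- a)));
  kd_sum : forall a b, a \in D -> b \in D -> a != - b ->
    sbr (X a) (X b) = 0 \/
    exists c, [/\ Zint c, a + b \in D & sbr (X a) (X b) = c *: X (a + b)];
  kd_even : forall a, a \in D -> X a \in spart g false ->
    [/\ - a \in D, a + a \notin D
      & exists2 u : subvs_of h, sbr (X a) (X (- a)) = val u & a u = 2];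
  kd_dp : forall a b k, a \in D -> X a \in spart g false -> b \in D ->
    lattice ((k`!%:R)^-1 *: iter k (sbr (X a)) (X b));
  kd_odd : forall a, a \in D -> X a \notin spart g false ->
    lattice (2^-1 *: sbr (X a) (X a));
  kd_center : forall x : g, (forall y : g, sbr x y = 0) -> x = 0 }.

Lemma root_vec_par (kd : kostant_data) k : root_vec k \in spart g (root_par k).
Proof.
case: k => [a|i] /=; last by apply: (subvP (kd_h kd)); apply: subvsP.
have [[] Xp] := kd_hom kd (ssvalP a).
  by have [X0 | //] := boolP (X _ \in spart g false).
by rewrite Xp.
Qed.

Lemma fam_perm (T : finType) (V : vectType K) (F : T -> V) (s : seq T) :
  uniq s -> (forall t, t \in s) -> perm_eq (fam F) [seq F t | t <- s].
Proof.
move=> us sT; have -> : tval (fam F) = [seq F t | t <- [seq enum_val i | i <- enum 'I_#|T|]].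
  by rewrite -map_comp; apply: (eq_from_nth (x0 := 0)); rewrite ?size_tuple ?size_map ?size_enum_ord // => i lt;
     rewrite (fam_nth F (Ordinal lt)) (nth_map (Ordinal lt)) ?size_enum_ord //= nth_ord_enum' //.
apply: perm_map; apply: uniq_perm => //.
  by rewrite map_inj_uniq ?enum_uniq //; apply: enum_val_inj.
move=> t; rewrite sT; apply/mapP; exists (enum_rank t); rewrite ?mem_enum //.
by rewrite enum_rankK.
Qed.

Section Basis.
Hypothesis HX_basis : basis_of fullv ([seq val (H i) | i <- enum 'I_(\dim h)] ++ [seq X a | a <- D]).
Hypothesis D_uniq : uniq D.

Lemma root_vec_basis : basis_of fullv (fam root_vec).
Proof.
pose s : seq I := [seq inr i | i <- enum 'I_(\dim h)] ++ [seq inl a | a <- enum {: seq_sub D}].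
suff E : perm_eq (fam root_vec) ([seq val (H i) | i <- enum 'I_(\dim h)] ++ [seq X a | a <- D]).
  by rewrite (perm_basis _ E) HX_basis.
have us : uniq s.
  rewrite cat_uniq; apply/and3P; split.
  - by rewrite map_inj_uniq ?enum_uniq // => ? ? [].
  - by apply/hasPn => _ /mapP[a _ ->]; apply/mapP => -[].
  - by rewrite map_inj_uniq ?enum_uniq // => ? ? [].
apply: perm_trans (fam_perm _ us _) _.
  by case=> x; rewrite mem_cat; apply/orP; [right|left]; apply: map_f; rewrite mem_enum.
rewrite map_cat; apply: perm_cat; rewrite -map_comp //.
suff E : perm_eq [seq ssval a | a <- enum {: seq_sub D}] D.
  by have := perm_map X E; rewrite -map_comp.
apply: uniq_perm => [||a]; last 1 first.
- apply/mapP/idP => [[b _ ->]|aD]; first exact: ssvalP.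
  by exists (SeqSub aD); rewrite ?mem_enum.
- by rewrite map_inj_uniq ?enum_uniq //; apply: val_inj.
exact: D_uniq.
Qed.

Lemma root_vec_free : free_family root_vec.
Proof. by apply/free_familyP/(basis_free root_vec_basis). Qed.

Lemma root_vec_span x : x = \sum_k fcoord root_vec k x *: root_vec k.
Proof. by apply: fcoord_expand; rewrite (span_basis root_vec_basis) memvf. Qed.

End Basis.
End KostantData.

Lemma intK_inj (K : fieldType) (char0 : [pchar K] =i pred0) (m n : int) :
  m%:~R = n%:~R :> K -> m = n.
Proof.
move/eqP; rewrite -subr_eq0 -rmorphB /= => mn; apply/eqP; rewrite -subr_eq0.
move: (m - n) mn => z; have /pcharf0P c0 := char0.
by case: z => z; rewrite ?NegzE ?rmorphN /= ?oppr_eq0 -pmulrn c0.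
Qed.

Lemma root_neq_opp (K : fieldType) (char0 : [pchar K] =i pred0) (g : lieSuper K) (h : {vspace g})
    (D : seq (hdual h)) (D0 : 0 \notin D) a : a \in D -> a != - a.
Proof.
move=> aD; apply: contraNneq D0 => E; suff -> : 0 = a by [].
have : (2%:R : K) *: a = 0 by rewrite scaler_nat mulr2n {2}E subrr.
by move/eqP; rewrite scaler_eq0 (negPf (natK_neq0 char0 1)) => /eqP.
Qed.

Section Functionals.
Variables (K : fieldType) (char0 : [pchar K] =i pred0) (g : lieSuper K) (h : {vspace g}).
Variables (D : seq (hdual h)) (H : 'I_(\dim h) -> subvs_of h) (X : hdual h -> g).
Hypothesis kd : kostant_data D H X.

Local Notation I := (pbw_index D).
Local Notation rv := (@root_vec K g h D H X).
Local Notation rpar := (@root_par K g h D X).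
Local Notation co := (fcoord rv).
Local Notation lattice := (lattice D H X).

Let sZ := Zint_subring K.
Let rv_par := root_vec_par kd.
Let rv_free := root_vec_free (kd_basis kd) (kd_uniq kd).
Let rv_span := root_vec_span (kd_basis kd) (kd_uniq kd).

Lemma sbr_even_anti x y : x \in spart g false -> y \in spart g false -> sbr x y = - sbr y x.
Proof. by move=> x0 y0; rewrite (sbr_anti x0 y0) scale1r. Qed.

Lemma sbr_even_self x : x \in spart g false -> sbr x x = 0.
Proof.
move=> x0; have := sbr_even_anti x0 x0 => /eqP; rewrite -addr_eq0 -mulr2n -scaler_nat scaler_eq0.
by rewrite (negPf (natK_neq0 char0 1)) => /eqP.
Qed.

Lemma H_even i : val (H i) \in spart g false.
Proof. by apply: (subvP (kd_h kd)); apply: subvsP. Qed.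

Lemma sbr_even_H a i : a \in D -> X a \in spart g false ->
  sbr (X a) (val (H i)) = - a (H i) *: X a.
Proof.
by move=> aD Xa; rewrite sbr_even_anti ?H_even // (kd_HX kd) // scaleNr.
Qed.

Lemma sbr_X_H a i p : a \in D -> X a \in spart g p ->
  sbr (X a) (val (H i)) = - a (H i) *: X a.
Proof.
move=> aD Xa; rewrite (sbr_anti Xa (H_even i)) andbF scale1r (kd_HX kd) // scaleNr.
by [].
Qed.

Lemma lattice_X a : a \in D -> lattice (X a).
Proof. by move=> aD; apply: span_in => //; exists (inl (SeqSub aD)). Qed.

Lemma lattice_co x k : lattice x -> Zint (co k x).
Proof.
elim=> [|a _ y Za [j ->] _ IH]; first by rewrite /fcoord linear0; apply: subring0.
rewrite fcoordD fcoordZ (fcoord_basis rv_free); apply: subringD => //; apply: subringM => //; exact: subring_nat.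
Qed.

Lemma lattice_ad a k j : a \in D -> X a \in spart g false ->
  lattice ((k`!%:R)^-1 *: iter k (sbr (X a)) (rv j)).
Proof.
move=> aD Xa; case: j => [b|i] /=; first exact/(kd_dp kd)/ssvalP.
case: k => [|[|k]] /=.
- by rewrite invr1 scale1r; apply: span_in => //; exists (inr i).
- rewrite invr1 scale1r sbr_even_H //; apply: spanZ (lattice_X aD) => //.
  by apply: (subringN sZ); apply: (kd_weight kd).
suff -> : sbr (X a) (sbr (X a) (iter k (sbr (X a)) (val (H i)))) = 0.
  by rewrite scaler0; constructor.
elim: k => [|k /= ->]; first by rewrite /= sbr_even_H // sbrZr sbr_even_self // scaler0.
exact: (linear_fun0 (@sbr_linr K g (X a))).
Qed.

Definition even_index (k : I) : Prop := exists2 a, k = inl a & X (ssval a) \in spart g false.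
Definition even_root_vec (x : g) : Prop := exists a, [/\ a \in D, X a \in spart g false & x = X a].

Definition cartan_lattice (x : g) := span Zint (fun u => exists i, u = val (H i)) x.

Lemma cartan_latticeP (u : subvs_of h) : cartan_lattice (val u) ->
  exists n : 'I_(\dim h) -> int, u = \sum_i (n i)%:~R *: H i.
Proof.
move=> uZ; have {uZ} : span Zint (fun w => exists i, True /\ w = val (H i)) (val u).
  by apply: span_sub uZ => // w [i ->]; exists i.
move/(span_normal sZ) => [s [c [us _ cZ uE]]].
have /choice[n nE] i : exists n : int, (if i \in s then c i else 0) = n%:~R.
  by case: ifP => _; [apply: cZ | exists 0].
exists n; under eq_bigr => i _ do rewrite -nE.
apply: val_inj; rewrite uE (big_uniq _ us) /= big_mkcond.
elim/big_rec2: _ => [|i y1 y2 _ ->]; first by rewrite linear0.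
by rewrite linearP; case: ifP => _ //=; rewrite scale0r.
Qed.

(* With [X_a, X_-a] = sum_i n_i H_i and m_i = a(H_i), the matrix coefficients of
   ad X_a at (H_i, X_-a) and (X_a, H_i) are n_i and - m_i; since
   sum_i n_i m_i = 2, an integral combination of them takes the value 1. *)
Lemma even_functional k : even_index k -> exists Q : 'M[K]_(#|I| + 2),
  [/\ forall b, \tr (Q *m mxP (ad1_par K rpar) b) = 0,
      forall j, \tr (Q *m ad1_mx rv (rv j)) = (j == k)%:R
    & intmx Q].
Proof.
case=> d -> Xd; set a := ssval d; have aD : a \in D := ssvalP d.
have [naD _ [u Xu au2]] := kd_even kd aD Xd.
pose nd : seq_sub D := SeqSub naD.
have a0 : a != - a := root_neq_opp char0 (kd_zero kd) aD.
have /choice[m mE] i : exists m : int, a (H i) = m%:~R by apply: (kd_weight kd).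
have [n uE] : exists n : 'I_(\dim h) -> int, u = \sum_i (n i)%:~R *: H i.
  by apply: cartan_latticeP; rewrite /cartan_lattice -Xu; apply: (kd_opp kd).
have nE : val u = \sum_i (n i)%:~R *: val (H i).
  by rewrite uE linear_sum; apply: eq_bigr => i _; rewrite linearZ.
have nm2 : \sum_i n i * m i = 2.
  have : a u = \sum_i (n i * m i)%:~R.
    rewrite uE linear_sum; apply: eq_bigr => i _.
    by rewrite linearZ /= mE rmorphM.
  by rewrite au2 -rmorph_sum /= => E; apply: (intK_inj char0); rewrite -E.
have [al [be E1]] := int_bezout2 nm2.
(* All matrix entries used are off the diagonal, so Q kills 1 and the parity operator. They also
   vanish on ad X_b for b <> a: its bracket with X_-a has no Cartan component, and its brackets with
   the H_i are multiples of X_b. *)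
exists (\sum_i (al i)%:~R *: entry_mx K (inr i : I) (inl nd)
        + \sum_i (- be i)%:~R *: entry_mx K (inl d : I) (inr i)); split.
- move=> b; rewrite mulmxDl !mulmx_suml mxtraceD !raddf_sum /=.
  by rewrite !big1 ?addr0 // => i _; rewrite -scalemxAl mxtraceZ entry_par ?mulr0.
- move=> j; rewrite mulmxDl !mulmx_suml mxtraceD !raddf_sum /=.
  under eq_bigr => i _ do rewrite -scalemxAl mxtraceZ entry_ad.
  under [X in _ + X]eq_bigr => i _ do rewrite -scalemxAl mxtraceZ entry_ad.
  case: j => [b|j] /=; last first.
    rewrite !big1 ?addr0 // => i _.
      by rewrite (kd_HH kd) /fcoord linear0 mulr0.
    rewrite (kd_HX kd) // fcoordZ.
    by rewrite -[X (- a)]/(rv (inl nd)) (fcoord_basis rv_free) mulr0 mulr0.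
  have bD := ssvalP b.
  have [p Xp] := kd_hom kd bD.
  have E2 i : co (inl d) (sbr (X (ssval b)) (val (H i))) = - ssval b (H i) * (b == d)%:R.
    by rewrite (sbr_X_H _ bD Xp) fcoordZ -[X _]/(rv (inl b)) (fcoord_basis rv_free).
  under [X in _ + X]eq_bigr => i _ do rewrite E2.
  case: (eqVneq b d) => [-> | bd].
    rewrite [_ == _]eqxx -[X _]/(X a) Xu.
    have -> : \sum_i (al i)%:~R * co (inr i) (val u) = \sum_i (al i * n i)%:~R :> K.
      apply: eq_bigr => i _; rewrite rmorphM nE fcoord_bigsum /= (bigD1 i) //= fcoordZ -[val _]/(rv (inr i)).
      rewrite (fcoord_basis rv_free) eqxx mulr1 big1 ?addr0 // => i' ii'.
      by rewrite fcoordZ -[val _]/(rv (inr i')) (fcoord_basis rv_free) [_ == _](negPf ii') mulr0.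
    have -> : \sum_i (- be i)%:~R * (- ssval d (H i) * 1) = \sum_i (be i * m i)%:~R :> K.
      by apply: eq_bigr => i _; rewrite -/a mE mulr1 rmorphN mulrNN rmorphM.
    by rewrite -!rmorph_sum -rmorphD E1.
  rewrite [_ == _](negPf bd) [X in _ + X]big1 => [|i _]; last by rewrite !mulr0.
  rewrite big1 ?addr0 // => i _.
  have ba : ssval b != - - a by rewrite opprK; apply: contra bd => /eqP E; apply/eqP/val_inj.
  have [->|[c [_ sD ->]]] := kd_sum kd bD naD ba.
    by rewrite /fcoord linear0 mulr0.
  by rewrite fcoordZ -[X _]/(rv (inl (SeqSub sD))) (fcoord_basis rv_free) !mulr0.
- apply: intmxD; apply: intmx_sum => i _; apply: intmxZ (intmx_entry _ _ _); exact: Zint_int.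
Qed.

Definition root_functional (js : seq I) n (P : 'M[K]_n) s Q :=
  word_functional rv rpar even_index even_root_vec js P s Q.

Lemma root_functional_exists js : exists n (P : 'M[K]_n) s Q, root_functional js P s Q.
Proof.
have /choice[Q0 Q0E] : forall k, exists Q : 'M[K]_(#|I| + 2),
  [/\ forall b, \tr (Q *m mxP (ad1_par K rpar) b) = 0,
      forall j, \tr (Q *m ad1_mx rv (rv j)) = (j == k)%:R
    & even_index k -> intmx Q].
  move=> k; have [ek | nk] := pselect (even_index k).
    by have [Q [Q1 Q2 Q3]] := even_functional ek; exists Q.
  have [Q [Q1 Q2]] := ad1_functional char0 rv_par rv_free rv_span (kd_center kd) k.
  by exists Q.
apply: (word_functional_exists char0 rv_par (ad1_rep rv_par rv_free rv_span) (Q0 := Q0)).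
- by move=> k b; have [] := Q0E k.
- by move=> k j; have [] := Q0E k.
- by move=> k [a -> /= ->].
- by move=> k; have [] := Q0E k.
- by move=> x [a [_ Xa ->]].
move=> x k [a [aD Xa ->]]; apply: (intmx_ad1 rv_free rv_span) => k' i j.
by apply: lattice_co; apply: lattice_ad.
Qed.

End Functionals.

(** * Coefficients of ordered monomials *)

Section Monomials.
Variables (K : fieldType) (char0 : [pchar K] =i pred0) (g : lieSuper K) (h : {vspace g}).
Variables (D : seq (hdual h)) (H : 'I_(\dim h) -> subvs_of h) (X : hdual h -> g).
Hypothesis kd : kostant_data D H X.
Variables (U : algType K) (iota : g -> U).
Hypothesis Uenv : universal_enveloping iota.

Local Notation I := (pbw_index D).
Local Notation rv := (@root_vec K g h D H X).
Local Notation rpar := (@root_par K g h D X).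
Local Notation gen := (@pbw_factor K U g h D H X iota).
Local Notation dp := (@divided_power K U).
Local Notation bin := (@divided_binomial K U).

Let sZ := Zint_subring K.
Let sK := @all_subring K.
Let Ktrue := fun _ : K => True.

Definition exponent_ok (k : I) (n : nat) : bool := rpar k ==> (n <= 1)%N.

Lemma iota_lin : linear iota. Proof. by case: Uenv => -[]. Qed.

Lemma iota_br a b x y : x \in spart g a -> y \in spart g b ->
  iota (sbr x y) = iota x * iota y - (-1) ^+ (a && b) * (iota y * iota x).
Proof. by case: Uenv => -[_ br _]; apply: br. Qed.

Lemma iota0 : iota 0 = 0. Proof. exact: linear_fun0 iota_lin. Qed.
Lemma iotaZ a x : iota (a *: x) = a *: iota x. Proof. exact: linear_funZ iota_lin. Qed.

Lemma gen0 k : gen k 0 = 1.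
Proof. by case: k => k /=; [apply: dp0 | apply: dbin0]. Qed.

Lemma gen1 k : gen k 1 = iota (rv k).
Proof. by case: k => k /=; [apply: dp1 | apply: dbin1]. Qed.

Lemma exponent_ok0 k : exponent_ok k 0. Proof. by rewrite /exponent_ok implybT. Qed.
Lemma exponent_ok1 k : exponent_ok k 1. Proof. by rewrite /exponent_ok implybT. Qed.

(** Since only exponent 1 is admissible for these letters, the degree of a word is its length, and
    [rspan m] is spanned over K by the products of fewer than m root vectors or H_i. *)
Definition raw (k : I) (n : nat) : U := iota (rv k).
Definition raw_ok (k : I) (n : nat) := n == 1%N.
Local Notation rspan := (wspan Ktrue raw raw_ok (enum I)).

Lemma rspan_raw k m : (1 < m)%N -> rspan m (iota (rv k)).
Proof. by move=> m1; apply: (@wspan_gen K U Ktrue sK I raw raw_ok _ k 1%N); rewrite ?mem_enum. Qed.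

Lemma gen_lead k n : rspan n (gen k n - (n`!%:R : K)^-1 *: iota (rv k) ^+ n).
Proof.
case: k => [a|i] /=; first by rewrite subrr; constructor.
elim: n => [|n IH]; first by rewrite dbin0 expr0 invr1 scale1r subrr; constructor.
have nz := natK_neq0 char0 n; set x := iota _ in IH *.
have -> : bin x n.+1 - (n.+1`!%:R : K)^-1 *: x ^+ n.+1 =
    (n.+1%:R : K)^-1 *: ((bin x n - (n`!%:R)^-1 *: x ^+ n) * x - (n%:R : K) *: bin x n).
  apply: (natK_lcancel char0 (n := n)); rewrite scalerA mulfV // scale1r scalerBr dbinS //.
  rewrite scalerA invfactS // mulrBl mulrBr -(scalerAl _ (x ^+ n)) -exprSr mulr_natZr.
  by rewrite addrAC.
have Rx : rspan 2 x by apply: (rspan_raw (inr i)).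
have Rb : rspan n.+1 (bin x n).
  rewrite -[bin x n](subrK ((n`!%:R)^-1 *: x ^+ n)); apply: spanD.
    exact: wspan_le IH.
  apply: spanZ => //; elim: (n) => [|m IHm]; first by apply: wspan1.
  by rewrite exprS; apply: wspanM Rx IHm.
apply: spanZ => //; apply: spanB => //; last exact: spanZ.
by apply: wspanM IH Rx; rewrite ?addn2.
Qed.

Definition rword (J : seq I) : U := \prod_(k <- J) iota (rv k).

Lemma rspan_rword J : rspan (size J).+1 (rword J).
Proof.
rewrite /rword; elim: J => [|k J IH]; first by rewrite big_nil; apply: wspan1.
by rewrite big_cons; apply: wspanM (rspan_raw k (ltnSn _)) IH.
Qed.

Lemma rword_cat J J' : rword (J ++ J') = rword J * rword J'.
Proof. by rewrite /rword big_cat. Qed.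

Lemma rword_nseq n k : rword (nseq n k) = iota (rv k) ^+ n.
Proof. by rewrite /rword big_nseq; elim: n => //= n ->; rewrite exprS. Qed.

Lemma mon_lead e l :
  rspan (mdeg e l) (mon gen e l - (\prod_(k <- l) ((e k)`!%:R : K)^-1) *: rword (eword e l)).
Proof.
elim: l => [|k l IH].
  by rewrite /mon /rword !big_nil scale1r subrr; constructor.
rewrite /mon /mdeg !big_cons /= -/(mon gen e l) -/(mdeg e l) rword_cat rword_nseq.
have Rx := rspan_rword (nseq (e k) k); rewrite size_nseq rword_nseq in Rx.
have RW := rspan_rword (eword e l); rewrite size_eword in RW.
have RA := gen_lead k (e k).
move: (iota (rv k) ^+ _) (rword _) (mon _ _ _) (gen _ _) (\prod_(j <- l) _) Rx RW RA IH => x w m y b Rx RW RA RB.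
have Rm : rspan (mdeg e l).+1 m.
  rewrite -[m](subrK (b *: w)); apply: spanD; last exact: spanZ.
  exact: wspan_le RB.
set a := (_)^-1 in RA *.
have -> : y * m - (a * b) *: (x * w) = (y - a *: x) * m + a *: (x * (m - b *: w)).
  by rewrite mulrBl mulrBr scalerBr -!scalerAl -!scalerAr scalerA addrA subrK.
apply: spanD; first by apply: wspanM RA Rm; rewrite ?addnS.
by apply: spanZ => //; apply: wspanM Rx RB; rewrite ?addSn.
Qed.

Section Phi.
Variables (js : seq I) (n : nat) (P : 'M[K]_n) (s : g -> 'M[K]_n) (Q : 'M[K]_n).
Hypothesis wf : root_functional H X js P s Q.
Variable F : U -> 'M[K]_n.
Hypotheses (Flin : linear F) (F1 : F 1 = 1%:M) (FM : forall x y, F (x * y) = F x *m F y)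
  (Fi : forall x, F (iota x) = s x).

Definition Phi (u : U) : K := \tr (Q *m F u).

Lemma Phi_linear : linear (Phi : U -> K^o).
Proof. by move=> a x y; rewrite /Phi Flin mulmxDr -scalemxAr mxtraceD mxtraceZ. Qed.

Lemma F_rword J : F (rword J) = rep_word rv s J.
Proof.
rewrite /rword; elim: J => [|k J IH]; first by rewrite big_nil.
by rewrite big_cons FM IH Fi.
Qed.

Lemma Phi_rspan m u : (m <= size js)%N -> rspan m u -> Phi u = 0.
Proof.
move=> le; elim=> [|a _ y _ [w [wo wd ->]] _ IH]; first exact: linear_fun0 Phi_linear.
rewrite Phi_linear IH addr0.
have -> : wval raw w = rword [seq x.1 | x <- w].
  by rewrite /rword big_map.
have ws : wdeg w = size w.
  move: wo; rewrite /wok /wdeg; elim: (w) => [|x w' IHw] /=; first by rewrite big_nil.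
  by rewrite big_cons => /andP[/andP[_ /eqP ->] /IHw ->].
rewrite /Phi F_rword.
have := wf_short wf (J := [seq x.1 | x <- w]) false; rewrite /= mulmx1 => ->.
  by rewrite scaler0.
by rewrite size_map -ws; apply: leq_trans le.
Qed.

Lemma Phi_mon_short e l : (mdeg e l < size js)%N -> Phi (mon gen e l) = 0.
Proof.
move=> lt; have := mon_lead e l; set c := \prod_(_ <- _) _; set w := rword _ => R.
rewrite -[mon _ _ _](subrK (c *: w)) (linear_funD _ _ Phi_linear) (Phi_rspan (ltnW lt) R) add0r.
apply: (@Phi_rspan (mdeg e l).+1) => //; apply: spanZ => //.
by rewrite /w; have := rspan_rword (eword e l); rewrite size_eword.
Qed.

(** Modulo lower degree the monomial is its word divided by the factorials of the exponents, and
    these cancel the factorials counting the matchings. *)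
Lemma Phi_mon e l : uniq l -> {subset js <= l} -> (forall k, exponent_ok k (e k)) ->
  size js = mdeg e l -> exists b : bool,
  Phi (mon gen e l) = (-1) ^+ b * (all (fun k => count_mem k js == e k) l)%:R.
Proof.
move=> ul sub oke sz; have := mon_lead e l; set c := \prod_(_ <- _) _; set w := rword _ => R.
rewrite -[mon _ _ _](subrK (c *: w)) (linear_funD _ _ Phi_linear) (Phi_rspan _ R) ?sz // add0r.
rewrite (linear_funZ _ _ Phi_linear) /Phi F_rword (wf_val wf) ?size_eword //.
have epar k : rpar k -> (e k <= 1)%N by move=> pk; have := oke k; rewrite /exponent_ok pk.
have [b ->] := matching_value_eword K ul sub epar sz.
exists b; rewrite /GRing.scale /= mulrCA; congr (_ * _).
case: ifP => _; last by rewrite mulr0.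
rewrite /c -big_split /= big1 // => k _; rewrite mulVf //; exact: fact_neq0.
Qed.

End Phi.

End Monomials.

Lemma seq_argmax (T : eqType) (f : T -> nat) x s :
  exists2 y, y \in x :: s & forall z, z \in x :: s -> (f z <= f y)%N.
Proof.
elim: s x => [|x' s IH] x; first by exists x => [|z]; rewrite inE // => /eqP ->.
have [y ys ymax] := IH x'.
have [le | lt] := leqP (f x) (f y).
  by exists y => [|z]; rewrite inE ?ys ?orbT // => /orP[/eqP -> //|/ymax].
exists x => [|z]; rewrite inE ?eqxx // => /orP[/eqP -> //|/ymax le].
exact: leq_trans le (ltnW lt).
Qed.

Section Coefficients.
Variables (K : fieldType) (char0 : [pchar K] =i pred0) (g : lieSuper K) (h : {vspace g}).
Variables (D : seq (hdual h)) (H : 'I_(\dim h) -> subvs_of h) (X : hdual h -> g).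
Hypothesis kd : kostant_data D H X.
Variables (U : algType K) (iota : g -> U).
Hypothesis Uenv : universal_enveloping iota.

Local Notation I := (pbw_index D).
Local Notation rv := (@root_vec K g h D H X).
Local Notation rpar := (@root_par K g h D X).
Local Notation gen := (@pbw_factor K U g h D H X iota).
Local Notation ok := (@exponent_ok K g h D X).

Let sZ := Zint_subring K.
Let sK := @all_subring K.
Let Ktrue := fun _ : K => True.

Variable l : seq I.
Hypothesis ul : uniq l.

(** The support condition makes e determined by its restriction to l, so that distinct admissible
    exponents are separated by the functionals. *)
Definition admissible (e : {ffun I -> nat}) : Prop :=
  (forall k, ok k (e k)) /\ (forall k, k \notin l -> e k = 0%N).

(** The functional built from the letters of e0 kills every monomial of smaller degree, and among
    those of the same degree it detects e0 alone. *)
Lemma top_coefficient (s : seq {ffun I -> nat}) (c : {ffun I -> nat} -> K) e0 :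
  uniq s -> (forall e, e \in s -> admissible e) -> e0 \in s ->
  (forall e, e \in s -> (mdeg e l <= mdeg e0 l)%N) ->
  forall n (P : 'M[K]_n) t Q F, root_functional H X (eword e0 l) P t Q ->
  linear F -> F 1 = 1%:M -> (forall x y, F (x * y) = F x *m F y) ->
  (forall x, F (iota x) = t x) ->
  exists b : bool, Phi Q F (\sum_(e <- s) c e *: mon gen e l) = (-1) ^+ b * c e0.
Proof.
move=> us sadm e0s emax n P t Q F wf Flin F1 FM Fi.
have Pl := Phi_linear Q Flin.
rewrite (linear_fun_sum _ _ _ Pl) (bigD1_seq e0) //= (linear_funZ _ _ Pl).
have sz : size (eword e0 l) = mdeg e0 l by rewrite size_eword.
have sub : {subset eword e0 l <= l} by apply: eword_sub.
have [ok0 supp0] := sadm _ e0s.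
have [b ->] := Phi_mon char0 wf Flin F1 FM Fi ul sub ok0 sz.
have -> : all (fun k => count_mem k (eword e0 l) == e0 k) l.
  by apply/allP => k kl; rewrite count_eword.
exists b; rewrite big_seq_cond big1 ?addr0 => [|e /andP[es ne]].
  by rewrite /GRing.scale /= mulr1 mulrC.
have [oke supp] := sadm _ es.
rewrite (linear_funZ _ _ Pl); have := emax _ es; rewrite leq_eqVlt => /orP[/eqP dE | lt]; last first.
  by rewrite (Phi_mon_short char0 wf Flin F1 FM Fi) ?sz // scaler0.
have [b' ->] := Phi_mon char0 wf Flin F1 FM Fi ul sub oke (etrans sz (esym dE)).
case: allP => [A | _]; last by rewrite mulr0 scaler0.
case/eqP: ne; apply/ffunP => k; have [kl | kl] := boolP (k \in l).
  by have := A k kl; rewrite count_eword // => /eqP.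
by rewrite supp // supp0.
Qed.

Lemma functional_env (js : seq I) : exists n (P : 'M[K]_n) t Q F, [/\ root_functional H X js P t Q,
  linear F, F 1 = 1%:M, (forall x y, F (x * y) = F x *m F y) & forall x : g, F (iota x : U) = t x].
Proof.
have [n [P [t [Q wf]]]] := root_functional_exists char0 kd js.
have [F [F1 F2 F3 F4]] := env_rep Uenv (wf_rep wf).
by exists n, P, t, Q, F.
Qed.

(** A relation is tested at an exponent of greatest degree among those with nonzero coefficient; the
    others are filtered out first, so that this degree is the top one. *)
Lemma mon_free (s : seq {ffun I -> nat}) (c : {ffun I -> nat} -> K) :
  uniq s -> (forall e, e \in s -> admissible e) ->
  \sum_(e <- s) c e *: mon gen e l = 0 -> forall e, e \in s -> c e = 0.
Proof.
move=> us sadm sum0 e0 e0s; apply: contrapT => c0.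
pose s' := [seq e <- s | c e != 0].
have e0s' : e0 \in s' by rewrite mem_filter e0s andbT; apply/eqP.
have [e1 e1s' emax] : exists2 e1, e1 \in s' & forall e, e \in s' -> (mdeg e l <= mdeg e1 l)%N.
  by case: s' e0s' => // e s1 _; apply: seq_argmax.
have us' : uniq s' by rewrite filter_uniq.
have sub e : e \in s' -> e \in s by rewrite mem_filter => /andP[].
have [n [P [t [Q [F [wf F1 F2 F3 F4]]]]]] := functional_env (eword e1 l).
have [b] := top_coefficient c us' (fun e es => sadm e (sub e es)) e1s' emax wf F1 F2 F3 F4.
rewrite big_filter [X in Phi Q F X](_ : _ = 0); last first.
  rewrite -[RHS]sum0 [RHS](bigID (fun e => c e == 0)) /= [X in _ = X + _]big1 ?add0r // => e /eqP ->.
  by rewrite scale0r.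
rewrite (linear_fun0 (Phi_linear Q F1)) => /esym/eqP; rewrite mulf_eq0 signr_eq0 /=.
by move: e1s'; rewrite mem_filter => /andP[/negPf ->].
Qed.

(* A K-combination of ordered monomials in even root vectors whose values under
   all the functionals are integral has integral coefficients: read off the
   coefficients of top degree, subtract, and descend. *)
Definition intval (u : U) : Prop := forall (js : seq I) n (P : 'M[K]_n) t Q F,
  {subset js <= l} -> root_functional H X js P t Q ->
  linear F -> F 1 = 1%:M -> (forall x y, F (x * y) = F x *m F y) ->
  (forall x, F (iota x) = t x) -> Zint (Phi Q F u).

Lemma intvalB u w : intval u -> intval w -> intval (u - w).
Proof.
move=> iu iw js n P t Q F sub wf Fl F1 FM Fi.
have Pl := Phi_linear Q Fl.
rewrite (linear_funD _ _ Pl) -scaleN1r (linear_funZ _ _ Pl).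
apply: (subringD sZ); first exact: (iu _ _ _ _ _ _ sub wf Fl F1 FM Fi).
apply: (subringM sZ); first exact: (subringN sZ (subring1 sZ)).
exact: (iw _ _ _ _ _ _ sub wf Fl F1 FM Fi).
Qed.

Lemma intvalZ a u : Zint a -> intval u -> intval (a *: u).
Proof.
move=> ia iu js n P t Q F sub wf Fl F1 FM Fi.
rewrite (linear_funZ _ _ (Phi_linear Q Fl)).
by apply: (subringM sZ) => //; exact: (iu _ _ _ _ _ _ sub wf Fl F1 FM Fi).
Qed.

Lemma intval0 : intval 0.
Proof.
move=> js n P t Q F sub wf Fl F1 FM Fi.
by rewrite (linear_fun0 (Phi_linear Q Fl)); apply: (subring0 sZ).
Qed.

Lemma intval_sum J r (A : pred J) (G : J -> U) :
  (forall i, A i -> intval (G i)) -> intval (\sum_(i <- r | A i) G i).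
Proof.
move=> iG; apply: big_ind => //; first exact: intval0.
move=> x y ix iy; rewrite -[y]opprK; apply: intvalB => //.
by rewrite -sub0r; apply: intvalB => //; apply: intval0.
Qed.

Hypothesis leven : forall k, k \in l -> even_index X k.

Lemma gen_intmx n (P : 'M[K]_n) t Q F (js : seq I) k p : k \in l -> root_functional H X js P t Q ->
  linear F -> F 1 = 1%:M -> (forall x y, F (x * y) = F x *m F y) ->
  (forall x, F (iota x) = t x) -> intmx (F (gen k p)).
Proof.
move=> kl wf Fl F1 FM Fi; have [a -> Xa] := leven kl.
have -> : F (gen (inl a) p) = mxdp (t (X (ssval a))) p.
  rewrite /= /divided_power (linear_funZ _ _ Fl) /mxdp -Fi; congr (_ *: _).
  by elim: p => [|p IH]; rewrite ?expr0 // !exprS FM IH.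
by apply: (wf_E wf); exists (ssval a); split=> //; apply: ssvalP.
Qed.

Lemma intval_word w : all (fun x => x.1 \in l) w -> intval (wval gen w).
Proof.
move=> wl js n P t Q F sub wf Fl F1 FM Fi; apply: intmx_trace; apply: intmxM.
  by apply: (wf_int wf) => k kjs; apply: leven; apply: sub.
rewrite /wval; elim: w wl => [|x w IH] /=; first by rewrite big_nil F1 => _; apply: intmx1.
move=> /andP[xl wl]; rewrite big_cons FM; apply: intmxM; last exact: IH.
exact: gen_intmx xl wf Fl F1 FM Fi.
Qed.

Lemma intval_mon (e : I -> nat) : intval (mon gen e l).
Proof.
have -> : mon gen e l = wval gen [seq (k, e k) | k <- l] by rewrite /wval big_map.
by apply: intval_word; apply/allP => _ /mapP[k kl ->].
Qed.

Lemma mspan_normal (A : K -> Prop) m u : subring_pred A -> mspan A gen ok l m u ->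
  exists s (c : {ffun I -> nat} -> K), [/\ uniq s,
    forall e, e \in s -> admissible e /\ (mdeg e l < m)%N, forall e, A (c e)
    & u = \sum_(e <- s) c e *: mon gen e l].
Proof.
move=> sA Su; have {Su} : span A (fun x => exists e : {ffun I -> nat},
    (admissible e /\ (mdeg e l < m)%N) /\ x = mon gen e l) u.
  apply: span_sub Su => // _ [e [oke de ->]].
  exists [ffun k => if k \in l then e k else 0%N].
  have E : {in l, e =1 [ffun k => if k \in l then e k else 0%N]} by move=> k kl; rewrite ffunE kl.
  rewrite -(eq_mon _ E) -(eq_mdeg E); split=> //; split=> //.
  split=> k; rewrite ffunE; last by move/negPf ->.
  by case: ifP => _ //; apply: exponent_ok0.
move/(span_normal sA) => [s [c [us sP cA ->]]].
by exists s, c.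
Qed.

Lemma integral_mspan m u : mspan Ktrue gen ok l m u -> intval u -> mspan Zint gen ok l m u.
Proof.
elim: m u => [|m IH] u Su iu.
  by case: Su => [|a x y _ [e [_ //]]]; constructor.
have [s [c [us sP _ uE]]] := mspan_normal sK Su.
have topZ e : e \in s -> mdeg e l = m -> Zint (c e).
  move=> es dm; have [n [P [t [Q [F [wf F1 F2 F3 F4]]]]]] := functional_env (eword e l).
  have emax e' : e' \in s -> (mdeg e' l <= mdeg e l)%N by move=> /sP[_]; rewrite dm.
  have [b] := top_coefficient c us (fun e es => (sP e es).1) es emax wf F1 F2 F3 F4.
  rewrite -uE => E; have := iu _ _ _ _ _ _ (@eword_sub _ _ _) wf F1 F2 F3 F4; rewrite E.
  by case: b {E}; rewrite /= ?mul1r // mulN1r => /(subringN sZ); rewrite opprK.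
pose top := \sum_(e <- s | mdeg e l == m) c e *: mon gen e l.
have Zt : mspan Zint gen ok l m.+1 top.
  rewrite /top big_seq_cond; apply: span_sum => // e /andP[es /eqP dm].
  apply: spanZ => //; first exact: topZ.
  by apply: span_in => //; exists e; split=> //; have [[oke _] de] := sP e es.
have it : intval top.
  rewrite /top big_seq_cond; apply: intval_sum => e /andP[es /eqP dm].
  by apply: intvalZ; [apply: topZ | apply: intval_mon].
rewrite -[u](subrK top); apply: spanD => //.
have : mspan Zint gen ok l m (u - top).
  apply: IH; last exact: intvalB.
  rewrite uE (bigID (fun e : {ffun I -> nat} => mdeg e l == m)) /= -/top addrC addrK.
  rewrite big_seq_cond; apply: span_sum => // e /andP[es dm].
  apply: spanZ => //; apply: span_in => //; exists e; have [[oke _] de] := sP e es; split=> //.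
  by rewrite ltn_neqAle dm -ltnS.
by apply: span_sub => // _ [e [oke de ->]]; exists e; split=> //; apply: leqW.
Qed.

End Coefficients.

(** * Commutation relations *)

Lemma cartan_integers_gt0 (i j : nat) (x y : int) : (0 < i + j)%N ->
  i%:Z * 2 + j%:Z * x = 0 -> i%:Z * y + j%:Z * 2 = 0 -> (0 < i)%N /\ (0 < j)%N.
Proof.
move=> ij E1 E2; split.
  by case: (posnP i) => // i0; rewrite i0 mul0r in E2; lia.
by case: (posnP j) => // j0; rewrite j0 mul0r in E1; lia.
Qed.

(** The integers x and y play the role of b(H_a) and a(H_b) for two roots with a i + b j = 0. The
    equations force x y = 4 with both negative, so x is -1, -2 or -4, which are the three
    conclusions. *)
Lemma cartan_integers (i j : nat) (x y : int) : (0 < i)%N -> (0 < j)%N ->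
  i%:Z * 2 + j%:Z * x = 0 -> i%:Z * y + j%:Z * 2 = 0 ->
  j = (2 * i)%N \/ i = j \/ i = (2 * j)%N.
Proof.
move=> i0 j0 E1 E2.
have E1' : j%:Z * x = - (i%:Z * 2) by lia.
have E2' : i%:Z * y = - (j%:Z * 2) by lia.
have xy : x * y = 4.
  have : (i%:Z * j%:Z) * (x * y - 4) = 0.
    transitivity ((j%:Z * x) * (i%:Z * y) - 4 * (i%:Z * j%:Z)); first by ring.
    by rewrite E1' E2'; ring.
  by move/eqP; rewrite mulf_eq0; lia.
have x0 : x < 0 by nia.
have y0 : y <= -1 by clear -xy x0; nia.
have x4 : -4 <= x by clear -xy x0 y0; nia.
have : x = -1 \/ x = -2 \/ x = -3 \/ x = -4 by lia.
by case=> [|[|[|]]] xv; rewrite xv in E1 xy; lia.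
Qed.

Section Relations.
Variables (K : fieldType) (char0 : [pchar K] =i pred0) (g : lieSuper K) (h : {vspace g}).
Variables (D : seq (hdual h)) (H : 'I_(\dim h) -> subvs_of h) (X : hdual h -> g).
Hypothesis kd : kostant_data D H X.
Variables (U : algType K) (iota : g -> U).
Hypothesis Uenv : universal_enveloping iota.

Local Notation I := (pbw_index D).
Local Notation rv := (@root_vec K g h D H X).
Local Notation rpar := (@root_par K g h D X).
Local Notation gen := (@pbw_factor K U g h D H X iota).
Local Notation ok := (@exponent_ok K g h D X).
Local Notation cartan_lattice := (cartan_lattice H).
Local Notation dp := (@divided_power K U).
Local Notation bin := (@divided_binomial K U).

Let sZ := Zint_subring K.
Let sK := @all_subring K.
Let Ktrue := fun _ : K => True.

Lemma sbr_cartan (u : subvs_of h) b : cartan_lattice (val u) -> b \in D ->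
  sbr (val u) (X b) = b u *: X b.
Proof.
move=> /cartan_latticeP [n ->] bD.
elim/big_rec: _ => [|i y _ IH]; first by rewrite !linear0 scale0r (linear_fun0 (@sbr_linl K g _)).
by rewrite !linearP /= sbr_linl IH (kd_HX kd) // scalerA -scalerDl.
Qed.

Lemma cartan_weight (u : subvs_of h) b : cartan_lattice (val u) -> b \in D -> Zint (b u : K).
Proof.
move=> /cartan_latticeP [n ->] bD.
rewrite linear_sum; apply: (subring_sum _ sZ) => i _; rewrite linearZ /=.
by apply: (subringM sZ); [apply: Zint_int | apply: (kd_weight kd)].
Qed.

Lemma even_coroot a : a \in D -> X a \in spart g false -> exists u : subvs_of h,
  [/\ sbr (X a) (X (- a)) = val u, a u = 2 & cartan_lattice (val u)].
Proof.
move=> aD Xa; have [naD _ [u Xu au]] := kd_even kd aD Xa.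
by exists u; rewrite /cartan_lattice -Xu; split=> //; apply: (kd_opp kd).
Qed.

Lemma hdual_mulrn_eq0 (a : hdual h) n : a *+ n.+1 = 0 -> a = 0.
Proof.
move/eqP; rewrite -scaler_nat scaler_eq0.
by rewrite (negPf (natK_neq0 char0 n)) => /eqP.
Qed.

(* A relation a i + b j = 0 would make the Cartan integers multiply to 4, forcing
   b to be - a, - 2a or - a/2. *)
Lemma even_roots_positive a b i j : a \in D -> b \in D -> X a \in spart g false ->
  X b \in spart g false -> a != - b -> (0 < i + j)%N -> a *+ i + b *+ j != 0.
Proof.
move=> aD bD Xa Xb ab ij; apply/eqP => E.
have [u [_ au uZ]] := even_coroot aD Xa.
have [w [_ bw wZ]] := even_coroot bD Xb.
have [naD a2 _] := kd_even kd aD Xa.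
have [nbD b2 _] := kd_even kd bD Xb.
have [x xE] := cartan_weight uZ bD.
have [y yE] := cartan_weight wZ aD.
have formal_eval (t : subvs_of h) : (i%:R * (a t : K) + j%:R * (b t : K)) = 0.
  have := congr1 (fun f : hdual h => f t) E.
  by rewrite add_lfunE -!scaler_nat !scale_lfunE zero_lfunE.
have E1 : (i%:Z * 2 + j%:Z * x)%R = 0.
  apply: (intK_inj char0); rewrite rmorphD !rmorphM /= -xE.
  by have := formal_eval u; rewrite au.
have E2 : (i%:Z * y + j%:Z * 2)%R = 0.
  apply: (intK_inj char0); rewrite rmorphD !rmorphM /= -yE.
  by have := formal_eval w; rewrite bw.
have [i_gt0 j_gt0] := cartan_integers_gt0 ij E1 E2.
have [j2i | [iej | i2j]] := cartan_integers i_gt0 j_gt0 E1 E2.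
- have i0 : i = i.-1.+1 by rewrite prednK.
  have : (a + (b + b)) *+ i.-1.+1 = 0.
    by rewrite -i0 -E j2i !mulrnDl -mulrnDr addnn -mul2n.
  move/hdual_mulrn_eq0/eqP; rewrite addrC addr_eq0 => /eqP bb.
  by move: b2; rewrite bb naD.
- have i0 : i = i.-1.+1 by rewrite prednK.
  have : (a + b) *+ i.-1.+1 = 0 by rewrite -i0 mulrnDl {2}iej.
  by move/hdual_mulrn_eq0/eqP; rewrite addr_eq0 (negPf ab).
- have j0 : j = j.-1.+1 by rewrite prednK.
  have : (a + a + b) *+ j.-1.+1 = 0.
    by rewrite -j0 -E i2j !mulrnDl -mulrnDr addnn -mul2n.
  move/hdual_mulrn_eq0/eqP; rewrite addr_eq0 => /eqP aa.
  by move: a2; rewrite aa nbD.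
Qed.

(* When l is a closed set of even roots, the commutator of two divided powers is
   straightened over K inside l first; [integral_mspan] then shows that the
   coefficients are integers, whatever the root strings look like. *)
Section Closed.
Variable l : seq I.
Hypotheses (ul : uniq l) (leven : forall k, k \in l -> even_index X k).
Hypothesis lclosed : forall j k, j \in l -> k \in l ->
  span Ktrue (fun u => exists2 m, m \in l & u = rv m) (sbr (rv j) (rv k)).

Local Notation Wl := (wspan Ktrue gen ok l).

Let even_vec k : k \in l -> rv k \in spart g false.
Proof. by move=> /leven [a ->]. Qed.

Let W_iota k : k \in l -> Wl 2 (iota (rv k)).
Proof. by move=> kl; rewrite -(gen1 char0); apply: (wspan_gen sK _ kl (exponent_ok1 _ _)). Qed.

Let W_exp k p : k \in l -> Wl p.+1 (iota (rv k) ^+ p).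
Proof.
move=> kl; elim: p => [|p IH]; first by apply: wspan1.
by rewrite exprS; apply: wspanM (W_iota kl) IH.
Qed.

Lemma closed_comm1 j k : j \in l -> k \in l ->
  Wl 2 (iota (rv j) * iota (rv k) - iota (rv k) * iota (rv j)).
Proof.
move=> jl kl; have := iota_br Uenv (even_vec jl) (even_vec kl); rewrite mul1r => <-.
apply: (span_linear sK (iota_lin Uenv) _ (lclosed jl kl)) => _ [m ml ->].
exact: W_iota.
Qed.

Lemma closed_comm j k p q : j \in l -> k \in l ->
  Wl (p + q) (iota (rv j) ^+ p * iota (rv k) ^+ q - iota (rv k) ^+ q * iota (rv j) ^+ p).
Proof.
move=> jl kl.
have Cq q' : Wl q'.+1 (iota (rv j) * iota (rv k) ^+ q' - iota (rv k) ^+ q' * iota (rv j)).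
  elim: q' => [|q' IH]; first by rewrite mulr1 mul1r subrr; constructor.
  set x := iota (rv j) in IH *; set y := iota (rv k) in IH *.
  have -> : x * y ^+ q'.+1 - y ^+ q'.+1 * x = (x * y - y * x) * y ^+ q' + y * (x * y ^+ q' - y ^+ q' * x).
    by rewrite exprS mulrBl mulrBr !mulrA addrA subrK.
  apply: spanD => //; first by apply: wspanM (closed_comm1 jl kl) (W_exp _ kl).
  by apply: wspanM (W_iota kl) IH.
elim: p => [|p IH]; first by rewrite mulr1 mul1r subrr; constructor.
set x := iota (rv j) in Cq IH *; set y := _ ^+ q in IH *.
have -> : x ^+ p.+1 * y - y * x ^+ p.+1 = x * (x ^+ p * y - y * x ^+ p) + (x * y - y * x) * x ^+ p.
  by rewrite exprS mulrBl mulrBr !mulrA addrA subrK.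
apply: spanD => //; first by apply: wspanM (W_iota jl) IH.
by apply: (wspanM sK _ (Cq q) (W_exp p jl)); lia.
Qed.

Let gen_exp k p : k \in l -> gen k p = (p`!%:R : K)^-1 *: iota (rv k) ^+ p.
Proof. by move=> /leven [a ->]. Qed.

Let ok_l k p : k \in l -> ok k p.
Proof. by move=> /leven [a -> Xa]; rewrite /exponent_ok /= Xa. Qed.

Let closed_gen j k p q : j \in l -> k \in l ->
  Wl (p + q) (gen j p * gen k q - gen k q * gen j p).
Proof.
move=> jl kl; rewrite !gen_exp // -!scalerAl -!scalerAr !scalerA mulrC -scalerBr.
by apply: spanZ => //; apply: closed_comm.
Qed.

Lemma closed_swap j k p q : j \in l -> k \in l ->
  wspan Zint gen ok l (p + q) (gen j p * gen k q - gen k q * gen j p).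
Proof.
move=> jl kl; set u := _ - _.
have Su : mspan Ktrue gen ok l (p + q) u.
  apply: straighten (closed_gen p q jl kl) => //.
  - exact: gen0.
  - exact: exponent_ok0.
  - move=> k' p' q' kl' _ _; exists ('C(p' + q', p')%:R); split=> //.
      by move=> _; apply: ok_l.
    have [a -> _] := leven kl'.
    by rewrite /= dpM // subrr; constructor.
  - move=> j' k' p' q' jl' kl' _ _ _; exists 1; split=> //.
    by rewrite scale1r; apply: closed_gen.
have iu : intval H X iota l u.
  have iw w : all (fun x => x.1 \in l) w -> intval H X iota l (wval gen w).
    by move=> wl; apply: intval_word.
  have := intvalB (iw [:: (j, p); (k, q)] _) (iw [:: (k, q); (j, p)] _).
  by rewrite /wval !big_cons big_nil !mulr1 /= jl kl; apply.
have := integral_mspan char0 kd Uenv ul leven Su iu.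
apply: span_sub => // _ [e [oke de ->]]; exists [seq (i, e i) | i <- l]; split.
- by apply/allP => _ /mapP[i il ->] /=; rewrite il oke.
- by rewrite /wdeg big_map.
- by rewrite /wval big_map.
Qed.

End Closed.
End Relations.

(** * Straightening over the integers for all pairs of factors *)

Section Spanning.
Variables (K : fieldType) (char0 : [pchar K] =i pred0) (g : lieSuper K) (h : {vspace g}).
Variables (D : seq (hdual h)) (H : 'I_(\dim h) -> subvs_of h) (X : hdual h -> g).
Hypothesis kd : kostant_data D H X.
Variables (U : algType K) (iota : g -> U).
Hypothesis Uenv : universal_enveloping iota.

Local Notation I := (pbw_index D).
Local Notation rv := (@root_vec K g h D H X).
Local Notation rpar := (@root_par K g h D X).
Local Notation gen := (@pbw_factor K U g h D H X iota).
Local Notation ok := (@exponent_ok K g h D X).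
Local Notation dp := (@divided_power K U).
Local Notation bin := (@divided_binomial K U).
Local Notation lattice := (lattice D H X).
Local Notation cartan_lattice := (cartan_lattice H).

Let sZ := Zint_subring K.

Variable L : seq I.
Hypotheses (uL : uniq L) (Lall : forall k, k \in L).

Local Notation W := (wspan Zint gen ok L).

Let il := iota_lin Uenv.

Lemma wspan_letter k p : ok k p -> W p.+1 (gen k p).
Proof. by move=> okp; apply: (wspan_gen sZ _ (Lall k) okp). Qed.

Lemma wspan_lattice x : lattice x -> W 2 (iota x).
Proof.
apply: (span_linear sZ il) => _ [k ->].
by rewrite -(gen1 char0); apply: wspan_letter; apply: exponent_ok1.
Qed.

Lemma cartan_lattice_sub x : cartan_lattice x -> lattice x.
Proof. by apply: (span_sub sZ) => _ [i ->]; exists (inr i). Qed.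

(** The sl2 formula produces binomials of coroots shifted by integers, not of the H_i themselves.
    This property is stable under the operations that build such elements from the H_i. *)
Definition integral_binomials (x : U) := forall n, W n.+1 (bin x n).

Lemma binomials_scalar c : Zint c -> integral_binomials (c *: 1).
Proof.
move=> Zc n; rewrite bin_scalar; apply: (spanZ sZ); first exact: binK_Zint.
by apply: (wspan1 sZ).
Qed.

Lemma binomialsD x y : GRing.comm x y -> integral_binomials x -> integral_binomials y ->
  integral_binomials (x + y).
Proof.
move=> xy ix iy n; rewrite dbinD //; apply: span_sum => i _.
by apply: (wspanM sZ _ (ix i) (iy _)); have := ltn_ord i; lia.
Qed.

(** Expand binom(x - x, n + 1) = 0 by Vandermonde and solve for the term binom(- x, n + 1); the
    other terms involve smaller binomials of - x. *)
Lemma binomialsN x : integral_binomials x -> integral_binomials (- x).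
Proof.
move=> ix; elim/ltn_ind=> -[|n] IH; first by rewrite dbin0; apply: (wspan1 sZ).
have : bin (x - x) n.+1 = 0.
  have := bin_scalar U 0 n.+1; rewrite subrr scale0r => ->.
  by rewrite /binK big_ord_recl subrr mul0r mulr0 scale0r.
rewrite dbinD //; last exact/commrN.
rewrite big_ord_recl dbin0 mul1r subn0 => /eqP; rewrite addr_eq0 => /eqP ->.
apply: (spanN sZ); apply: span_sum => i _.
apply: (wspanM sZ _ (ix _) (IH _ _)); rewrite /= /bump /=; have := ltn_ord i; lia.
Qed.

Lemma binomials_int x (a : K) : Zint a -> integral_binomials x -> integral_binomials (a *: x).
Proof.
move=> [z ->] ix; elim/int_ind: z => [|m IH|m IH].
- by rewrite scale0r -(scale0r 1); apply: binomials_scalar; apply: (subring0 sZ).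
- rewrite -addn1 PoszD rmorphD /= scalerDl scale1r; apply: binomialsD => //.
  by apply/commr_sym/comm_scale.
- rewrite rmorphN /= -addn1 PoszD rmorphD /= opprD scalerDl scaleN1r; apply: binomialsD => //.
    by apply/commrN/commr_sym/comm_scale.
  + by move: IH; rewrite rmorphN.
  + exact: binomialsN.
Qed.

Lemma iota_comm_even x y : x \in spart g false -> y \in spart g false -> sbr x y = 0 ->
  GRing.comm (iota x) (iota y).
Proof.
move=> x0 y0 xy; have := iota_br Uenv x0 y0.
by rewrite xy (iota0 Uenv) mul1r => /esym/eqP; rewrite subr_eq0 => /eqP.
Qed.

Lemma comm_cartan i x : cartan_lattice x -> GRing.comm (iota (val (H i))) (iota x).
Proof.
elim=> [|a _ y _ [j ->] _ IH]; first by rewrite (iota0 Uenv); apply: commr0.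
rewrite il; apply: commrD => //; apply: comm_scale.
by apply: iota_comm_even; rewrite ?(H_even kd) ?(kd_HH kd).
Qed.

Lemma binomials_cartan x c : cartan_lattice x -> Zint c -> integral_binomials (iota x + c *: 1).
Proof.
move=> cx Zc; elim: cx => [|a _ y Za [i ->] cy IH].
  by rewrite (iota0 Uenv) add0r; apply: binomials_scalar.
rewrite il -addrA; apply: binomialsD => //.
  apply/commr_sym/comm_scale/commr_sym/commrD; first exact: comm_cartan.
  by apply: comm_scale; apply: commr1.
apply: binomials_int => // n; exact: (wspan_letter (k := inr i) (p := n)).
Qed.

Lemma gen_same_rel k p q : ok k p -> ok k q ->
  exists a, [/\ Zint a, (a != 0 -> ok k (p + q)%N)
    & W (p + q) (gen k p * gen k q - a *: gen k (p + q)%N)].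
Proof.
case: k => [a|i].
  have [Xa | Xa] := boolP (X (ssval a) \in spart g false).
    move=> _ _; exists ('C(p + q, p)%:R); split.
    - exact: (subring_nat _ sZ).
    - by rewrite /exponent_ok /= Xa.
    - by rewrite /= dpM // subrr; constructor.
  rewrite /exponent_ok /= Xa /=.
  have triv : (p == 0)%N || (q == 0)%N -> (p <= 1)%N -> (q <= 1)%N ->
     exists a0, [/\ Zint a0, a0 != 0 -> (p + q <= 1)%N &
       W (p + q) (gen (inl a) p * gen (inl a) q - a0 *: gen (inl a) (p + q)%N)].
    move=> pq p1 q1; exists 1; split; [exact: subring1 sZ | by lia |].
    case/orP: pq => /eqP ->; rewrite gen0 ?add0n ?addn0 ?mul1r ?mulr1 scale1r subrr; constructor.
  case: (posnP p) => [p0 | p0 p1 q1]; first by apply: triv => //; rewrite p0.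
  case: (posnP q) => [q0 | q0]; first by apply: triv => //; rewrite q0 orbT.
  have -> : p = 1%N by lia.
  have -> : q = 1%N by lia.
  (* The square X_a^2 = [X_a, X_a] / 2 lies in the lattice, hence in degree 1: the leading
     coefficient is 0. *)
  exists 0; split; [exact: subring0 sZ | by rewrite eqxx |].
  rewrite scale0r subr0 addn1 !dp1.
  have Xt := root_vec_par kd (inl a); rewrite /= Xa in Xt.
  have := wspan_lattice (kd_odd kd (ssvalP a) Xa).
  rewrite (iotaZ Uenv) (iota_br Uenv Xt Xt) /= expr1 mulN1r opprK -mulr2n -scaler_nat scalerA.
  by rewrite mulVf ?scale1r // (natK_neq0 char0 1).
move=> _ _; exists ('C(p + q, p)%:R); split=> //; first exact: (subring_nat _ sZ).
rewrite /=; set x := iota _.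
(* The product binom(x, p) binom(x - p, q) is C(p + q, p) binom(x, p + q). Vandermonde expands
   binom(x - p, q) into binom(x, q) and integral multiples of the binom(x, j) with j < q. *)
have shift : bin (x + (- p%:R) *: 1) q = \sum_(j < q.+1) bin x j * (binK (- p%:R : K) (q - j) *: 1).
  rewrite dbinD //; last by apply: comm_scale; apply: commr1.
  by apply: eq_bigr => j _; rewrite bin_scalar.
have E : bin x p * bin (x + (- p%:R) *: 1) q = ('C(p + q, p)%:R : K) *: bin x (p + q).
  elim: q {shift} => [|q IH]; first by rewrite addn0 binn dbin0 mulr1 scale1r.
  apply: (natK_lcancel char0 (n := q)); rewrite scalerAr dbinS // mulrA IH -scalerAl.
  have -> : x + (- p%:R) *: 1 - q%:R = x - (p + q)%:R by rewrite natrD opprD addrA scaleNr -natr_scale1.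
  rewrite -dbinS // !scalerA -!natrM addnS mulnC.
  by have := mul_bin_down (p + q).+1 p; rewrite /= subSn ?leq_addr // addKn => ->.
rewrite -E shift big_ord_recr /= subnn binK0 scale1r mulr1 mulrDr opprD addrCA subrr addr0.
apply: (spanN sZ); rewrite mulr_sumr; apply: span_sum => j _.
rewrite -scalerAr mulr1 -scalerAr; apply: (spanZ sZ).
  by apply: binK_Zint => //; apply: (subringN sZ); apply: (subring_nat _ sZ).
by apply: (wspanM sZ _ (wspan_letter (k := inr i) (p := p) _) (wspan_letter (k := inr i) (p := j) _)) => //; have := ltn_ord j; lia.
Qed.

Definition commutes (j k : I) (p q : nat) := W (p + q) (gen j p * gen k q - gen k q * gen j p).

Lemma commutes_sym j k p q : commutes j k p q -> commutes k j q p.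
Proof. by rewrite /commutes addnC => /(spanN sZ); rewrite opprB. Qed.

Lemma commutes0l j k q : commutes j k 0 q.
Proof. by rewrite /commutes gen0 mul1r mulr1 subrr; constructor. Qed.

Lemma commutes_cartan i i' p q : commutes (inr i) (inr i') p q.
Proof.
rewrite /commutes /=.
have c : GRing.comm (iota (val (H i))) (iota (val (H i'))).
  by apply: iota_comm_even; rewrite ?(H_even kd) ?(kd_HH kd).
have -> : GRing.comm (bin (iota (val (H i))) p) (bin (iota (val (H i'))) q).
  by apply/bin_comm/commr_sym/bin_comm/commr_sym.
by rewrite subrr; constructor.
Qed.

Lemma cartan_X u b : cartan_lattice (val u) -> b \in D ->
  iota (val u) * iota (X b) = iota (X b) * (iota (val u) + b u *: 1).
Proof.
move=> cu bD; have [p Xb] := kd_hom kd bD.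
have uh : val u \in spart g false by apply: (subvP (kd_h kd)); apply: subvsP.
have := iota_br Uenv uh Xb; rewrite mul1r (sbr_cartan kd cu bD) (iotaZ Uenv) => E.
by rewrite mulrDr -scalerAr mulr1 E addrC subrK.
Qed.

(** Passing X_a^(q) shifts the argument of the binomial by the integer q a(H_i); Vandermonde
    isolates the unshifted binomial from terms of lower degree. *)
Lemma commutes_cartan_root i (a : seq_sub D) p q : ok (inl a) q -> commutes (inr i) (inl a) p q.
Proof.
move=> okq; have aD := ssvalP a; rewrite /commutes /=.
set x := iota (X _); set y := iota _.
have yx : y * x = x * (y + ssval a (H i) *: 1).
  by apply: cartan_X => //; apply: (span_in sZ); exists i.
have -> : bin y p * dp x q = dp x q * bin (y + (q%:R * (ssval a (H i) : K)) *: 1) p.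
  by rewrite /divided_power -scalerAr (bin_shift_exp char0 p q yx) -scalerAl.
rewrite dbinD //; last by apply: comm_scale; apply: commr1.
rewrite big_ord_recr /= subnn dbin0 mulr1 mulrDr addrK mulr_sumr; apply: span_sum => j _.
rewrite bin_scalar -scalerAr mulr1 -scalerAr; apply: (spanZ sZ).
  apply: binK_Zint => //; apply: (subringM sZ); first exact: (subring_nat _ sZ).
  exact: (kd_weight kd).
by apply: (wspanM sZ _ (wspan_letter (k := inl a) (p := q) okq) (wspan_letter (k := inr i) (p := j) _)) => //; have := ltn_ord j; lia.
Qed.

Lemma commutes_opposite (a b : seq_sub D) p q : X (ssval a) \in spart g false ->
  ssval b = - ssval a -> commutes (inl a) (inl b) p q.
Proof.
move=> Xa bE; have aD := ssvalP a.
have [u [Xu au cu]] := even_coroot kd aD Xa.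
(* If X_-a were odd, [X_a, X_-a] would be odd, while it lies in h and so is even; it would vanish,
   against a(u) = 2. *)
have Xb : X (- ssval a) \in spart g false.
  have := ssvalP b; rewrite bE => naD; have [[] Xn] := kd_hom kd naD => //.
  have u0 : val u = 0.
    apply: (spart_disjoint (g := g)); first by apply: (subvP (kd_h kd)); apply: subvsP.
    by rewrite -Xu; have := sbr_part Xa Xn.
  by have := au; rewrite (_ : u = 0) ?linear0; [move/eqP; rewrite eq_sym (negPf (natK_neq0 char0 1)) | apply: val_inj].
have naD : - ssval a \in D by rewrite -bE ssvalP.
rewrite /commutes /= bE; set e := iota (X _); set f := iota (X _); pose t := iota (val u).
have We n : W n.+1 (dp e n).
  have okn : ok (inl a) n by rewrite /exponent_ok /= Xa.
  exact: wspan_letter okn.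
have Wf n : W n.+1 (dp f n).
  have okn : ok (inl b) n by rewrite /exponent_ok /= bE Xb.
  by have := wspan_letter okn; rewrite /= bE.
have efh : e * f = f * e + t.
  have := iota_br Uenv Xa Xb; rewrite mul1r Xu -/t -/e -/f => ->.
  by rewrite addrC subrK.
have te : t * e = e * (t + 2%:R *: 1) by rewrite -au; apply: cartan_X.
have eh : e * t = (t - 2%:R) * e.
  by rewrite mulrBl te mulrDr -scalerAr mulr1 mulr_natZl addrK.
have hf : t * f = f * (t - 2%:R).
  have := cartan_X cu naD; rewrite opp_lfunE au scaleNr -natr_scale1; exact.
(* The term k = 0 is f^(q) e^(p), which cancels; the term of index k has degree p + q - k. *)
rewrite (sl2_commutation char0 efh eh hf) big_ord_recl /= {1}/dpz leq0n subn0 dbin0 mulr1 subn0.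
rewrite addrC addKr; apply: span_sum => k _.
rewrite /dpz /bump /= add1n; case: (leqP k.+1 q) => [kq | _]; last by rewrite !mul0r; constructor.
rewrite !natr_scale1 -scalerBl; have kp := ltn_ord k.
have Wb := binomials_cartan cu (subringB sZ (subring_nat (2 * k.+1) sZ) (subring_nat (p + q) sZ)).
have Wfb : W q.+1 (dp f (q - k.+1) * bin (t + ((2 * k.+1)%:R - (p + q)%:R) *: 1) k.+1).
  by apply: (wspanM sZ _ (Wf _) (Wb _)); lia.
by apply: (wspanM sZ _ Wfb (We _)); lia.
Qed.

(* The closed set is that of the even roots a i + b j with i, j natural. *)
Lemma commutes_even a b p q : X (ssval a) \in spart g false -> X (ssval b) \in spart g false ->
  ssval a != - ssval b -> commutes (inl a) (inl b) p q.
Proof.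
move=> Xa Xb ab; have aD := ssvalP a; have bD := ssvalP b.
pose C (d : hdual h) := exists i j, (0 < i + j)%N /\ d = ssval a *+ i + ssval b *+ j.
pose P (k : I) := exists d : seq_sub D, [/\ k = inl d, X (ssval d) \in spart g false & C (ssval d)].
pose l := [seq k <- L | `[< P k >]].
have lP k : reflect (P k) (k \in l).
  by rewrite mem_filter Lall andbT; apply: asboolP.
have al : inl a \in l.
  by apply/lP; exists a; split=> //; exists 1%N, 0%N; rewrite mulr1n mulr0n addr0.
have bl : inl b \in l.
  by apply/lP; exists b; split=> //; exists 0%N, 1%N; rewrite mulr1n mulr0n add0r.
have ul : uniq l by rewrite filter_uniq.
have leven k : k \in l -> even_index X k by move=> /lP [d [-> Xd _]]; exists d.
have lclosed j k : j \in l -> k \in l ->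
    span (fun _ => True) (fun u => exists2 m, m \in l & u = rv m) (sbr (rv j) (rv k)).
  move=> /lP [d [-> Xd [i1 [j1 [ij1 dE]]]]] /lP [d' [-> Xd' [i2 [j2 [ij2 d'E]]]]] /=.
  have sE : ssval d + ssval d' = ssval a *+ (i1 + i2) + ssval b *+ (j1 + j2).
    by rewrite dE d'E !mulrnDr addrACA.
  have dd' : ssval d != - ssval d'.
    by rewrite -addr_eq0 sE; apply: (even_roots_positive char0 kd aD bD Xa Xb ab); rewrite addnACA ltn_addr.
  have [-> | [c [_ sD E]]] := kd_sum kd (ssvalP d) (ssvalP d') dd'; first by constructor.
  rewrite E; case: (eqVneq c 0) => [-> | c0]; first by rewrite scale0r; constructor.
  apply: spanZ => //; apply: span_in => //; exists (inl (SeqSub sD)) => //; apply/lP.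
  exists (SeqSub sD); split.
  - by [].
  - rewrite -[X _](scalerK c0) -E; apply: memvZ; exact: (sbr_part Xd Xd').
  - exists (i1 + i2)%N, (j1 + j2)%N; split; last exact: sE.
    by rewrite addnACA ltn_addr.
have := closed_swap char0 kd Uenv ul leven lclosed p q al bl.
apply: (span_sub sZ) => _ [w [wo wd ->]]; exists w; split=> //.
by apply/allP => x xw; rewrite Lall /=; have /andP[] := allP wo x xw.
Qed.

(** In the expansion of [dp_mul_ad] the term k = 0 is the product in the other order. The remaining
    ones combine a lattice element, by [kd_dp], with X_a^(p - k), hence have degree at most p. *)
Lemma commutes_even_any a b p : X (ssval a) \in spart g false -> commutes (inl a) (inl b) p 1.
Proof.
move=> Xa; have [t Xb] := kd_hom kd (ssvalP b); rewrite /commutes /= dp1.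
set x := iota (X (ssval a)).
pose w k := iter k (sbr (X (ssval a))) (X (ssval b)).
have wt k : w k \in spart g t by elim: k => [|k IH] //=; apply: (sbr_part Xa IH).
pose z k := iota ((k`!%:R)^-1 *: w k).
have xz k : x * z k = z k * x + (k.+1%:R : K) *: z k.+1.
  have := iota_br Uenv Xa (wt k); rewrite mul1r -/x => E.
  have Ew : iota (w k.+1) = x * iota (w k) - iota (w k) * x by [].
  rewrite /z !(iotaZ Uenv) scalerA invfactS // Ew scalerBr -scalerAr -scalerAl.
  by rewrite addrC subrK.
have := dp_mul_ad char0 p xz; rewrite {1}/z invr1 scale1r => ->.
rewrite big_ord_recl subn0 {1}/z invr1 scale1r addrC addKr; apply: span_sum => k _.
have Wz : W 2 (z (bump 0 k)) by apply: wspan_lattice; apply: (kd_dp kd) => //; apply: ssvalP.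
apply: (wspanM sZ _ Wz (wspan_letter (k := inl a) (p := (p - bump 0 k)%N) _)).
  by rewrite /bump /=; have := ltn_ord k; lia.
by rewrite /exponent_ok /= Xa.
Qed.

(** The anticommutator of two odd vectors is the image of their bracket, an element of the lattice
    and so of degree 1. *)
Lemma anticommute_odd a b : X (ssval a) \notin spart g false -> X (ssval b) \notin spart g false ->
  W 2 (gen (inl a) 1 * gen (inl b) 1 + gen (inl b) 1 * gen (inl a) 1).
Proof.
move=> Xa Xb; rewrite !gen1 //.
have Ya := root_vec_par kd (inl a); rewrite /= Xa in Ya.
have Yb := root_vec_par kd (inl b); rewrite /= Xb in Yb.
have := iota_br Uenv Ya Yb; rewrite expr1 mulN1r opprK => <-.
apply: wspan_lattice; case: (eqVneq (ssval a) (- ssval b)) => [ab | ab].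
  apply: cartan_lattice_sub.
  have -> : ssval b = - ssval a by rewrite ab opprK.
  by apply: (kd_opp kd); rewrite ?ssvalP // ab opprK ssvalP.
have [-> | [c [Zc sD ->]]] := kd_sum kd (ssvalP a) (ssvalP b) ab; first by constructor.
by apply: (spanZ sZ) => //; apply: lattice_X.
Qed.

Lemma gen_swap_rel j k p q : j != k -> ok j p -> ok k q ->
  exists s, Zint s /\ W (p + q) (gen j p * gen k q - s *: (gen k q * gen j p)).
Proof.
move=> jk okp okq.
suff: commutes j k p q \/ [/\ p = 1%N, q = 1%N & W 2 (gen j 1 * gen k 1 + gen k 1 * gen j 1)].
  case=> [C | [-> -> C]]; first by exists 1; split; [exact: subring1 sZ | rewrite scale1r].
  exists (-1); split; first exact: (subringN sZ (subring1 sZ)).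
  by rewrite scaleN1r opprK.
case: j k jk okp okq => [a|i] [b|i'] jk okp okq; last 1 first.
- by left; apply: commutes_cartan.
- have [Xa | Xa] := boolP (X (ssval a) \in spart g false).
    left; have [Xb | Xb] := boolP (X (ssval b) \in spart g false).
      case: (eqVneq (ssval a) (- ssval b)) => [ab | ab]; last exact: commutes_even.
      by apply: commutes_opposite => //; rewrite ab opprK.
    move: okq; rewrite /exponent_ok /= Xb /=; case: q => [|[|//]] _; last exact: commutes_even_any.
    exact/commutes_sym/commutes0l.
  move: okp; rewrite /exponent_ok /= Xa /=; case: p => [|[|//]] _; first by left; apply: commutes0l.
  have [Xb | Xb] := boolP (X (ssval b) \in spart g false).
    by left; apply/commutes_sym; apply: commutes_even_any.
  move: okq; rewrite /exponent_ok /= Xb /=; case: q => [|[|//]] _.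
    by left; apply/commutes_sym/commutes0l.
  by right; split=> //; apply: anticommute_odd.
- by left; apply/commutes_sym; apply: commutes_cartan_root.
- by left; apply: commutes_cartan_root.
Qed.

Theorem kostant_span m x : W m x -> mspan Zint gen ok L m x.
Proof.
apply: (straighten sZ) => //.
- exact: gen0.
- exact: exponent_ok0.
- by move=> k p q _; apply: gen_same_rel.
- by move=> j k p q _ _; apply: gen_swap_rel.
Qed.

End Spanning.

(** * The Kostant basis *)

(** Freeness is stated with no predicate on the index type, so the indices are cut down to the
    subtype of those satisfying P. *)
Lemma Zbasis_free (K : fieldType) (U : algType K) (S : U -> Prop) (I : eqType)
    (P : I -> Prop) (b : I -> U) :
  is_Zbasis S P b -> is_Zfree S.
Proof.
case=> bS bfree bspan; pose Pb := [pred i : I | `[< P i >]].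
have PbP i : reflect (P i) (Pb i) by apply: asboolP.
exists {i : I | Pb i}, (fun i => b (val i)); split.
- by move=> [i /= /PbP Pi] _; apply: bS.
- move=> s c us _ sum0 i si.
  pose c' (j : I) := if insub j is Some j' then c j' else 0.
  have c'E (j : {i : I | Pb i}) : c' (val j) = c j by rewrite /c' valK.
  rewrite -c'E; apply: (bfree [seq val j | j <- s] c'); last exact: map_f.
  + by rewrite map_inj_uniq //; apply: val_inj.
  + by move=> _ /mapP[j _ ->]; apply/PbP/(valP j).
  + by rewrite big_map -[RHS]sum0; apply: eq_bigr => j _; rewrite c'E.
move=> x /bspan [s [c [sP ->]]].
exists (pmap insub s), (fun i => c (val i)); split=> //.
rewrite -(big_map val xpredT (fun j => b j *~ c j)) pmap_filter; last exact: insubK.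
congr bigop; apply/esym/all_filterP/allP => i /sP /PbP Pi.
by rewrite isSome_insub.
Qed.

Section KostantBasis.
Variables (K : fieldType) (char0 : [pchar K] =i pred0) (g : lieSuper K) (h : {vspace g}).
Variables (D : seq (hdual h)) (H : 'I_(\dim h) -> subvs_of h) (X : hdual h -> g).
Hypothesis kd : kostant_data D H X.
Hypothesis evenP : forall a, even_root a <-> a \in D /\ X a \in spart g false.
Hypothesis oddP : forall a, odd_root a <-> a \in D /\ X a \notin spart g false.
Variables (U : algType K) (iota : g -> U).
Hypothesis Uenv : universal_enveloping iota.

Local Notation I := (pbw_index D).
Local Notation gen := (@pbw_factor K U g h D H X iota).
Local Notation ok := (@exponent_ok K g h D X).

Let sZ := Zint_subring K.

Variable L : seq I.
Hypotheses (uL : uniq L) (Lall : forall k, k \in L).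

Local Notation W := (wspan Zint gen ok L).

Lemma exponent_okP (e : {ffun I -> nat}) : (forall k, ok k (e k)) <-> pbw_exponent e.
Proof.
split=> [oke a /oddP[_ Xa] | pe [a|i]]; last by rewrite /exponent_ok.
  by have := oke (inl a); rewrite /exponent_ok /= Xa.
by rewrite /exponent_ok /=; apply/implyP => Xa; apply: pe; apply/oddP; rewrite ssvalP.
Qed.

Lemma kostant_factor k n : ok k n -> kostant H X iota (gen k n).
Proof.
case: k => [a|i] okn; last by apply/GenIn/KostantCartan.
have [Xa | Xa] := boolP (X (ssval a) \in spart g false).
  by apply/GenIn/KostantEven/evenP; rewrite ssvalP.
move: okn; rewrite /exponent_ok /= Xa /=; case: n => [|[|//]] _; first by rewrite dp0; apply: Gen1.
by rewrite dp1; apply/GenIn/KostantOdd/oddP; rewrite ssvalP.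
Qed.

Lemma kostant_mon (e : I -> nat) : (forall k, ok k (e k)) -> kostant H X iota (mon gen e L).
Proof.
move=> oke; rewrite /mon; apply: big_ind => [|x y|k _]; [exact: Gen1 | exact: GenM |].
exact: kostant_factor.
Qed.

Lemma kostant_wspan x : kostant H X iota x -> exists m, W m x.
Proof.
have gW k n : ok k n -> exists m, W m (gen k n).
  by move=> okn; exists n.+1; apply: (wspan_gen sZ _ (Lall k) okn).
elim=> {x} [x Gx | | x y _ [m Wx] _ [n Wy] | x y _ [m Wx] _ [n Wy]].
- case: Gx => [a n /evenP[aD Xa] | a /oddP[aD Xa] | i n].
  + by apply: (gW (inl (SeqSub aD)) n); rewrite /exponent_ok /= Xa.
  + by rewrite -(dp1 (iota (X a))); apply: (gW (inl (SeqSub aD)) 1%N); apply: exponent_ok1.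
  + exact: (gW (inr i) n).
- by exists 1%N; apply: (wspan1 sZ).
- exists (maxn m n); apply: (spanB sZ).
    by apply: (wspan_le sZ _ Wx); rewrite leq_maxl.
  by apply: (wspan_le sZ _ Wy); rewrite leq_maxr.
- by exists (m + n)%N; apply: (wspanM sZ _ Wx Wy).
Qed.

Theorem kostant_Zbasis : is_Zbasis (kostant H X iota) (@pbw_exponent _ _ _ D)
  (fun e : {ffun I -> nat} => mon gen e L).
Proof.
split.
- by move=> e /exponent_okP; apply: kostant_mon.
- move=> s c us sP sum0 e es; apply: (intK_inj char0); rewrite [RHS]/=.
  apply: (mon_free char0 kd Uenv uL (c := fun e => (c e)%:~R) us) => // [e' /sP /exponent_okP oke|].
    by split=> // k; rewrite Lall.
  by rewrite -[RHS]sum0; apply: eq_bigr => i _; rewrite scaler_int.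
- move=> x /kostant_wspan [m Wx].
  have Sx := kostant_span char0 kd Uenv uL Lall Wx.
  have [s [c [_ sP cZ ->]]] := mspan_normal sZ Sx.
  have /choice[z zE] : forall e, exists z : int, c e = z%:~R by [].
  exists s, z; split; first by move=> e /sP [[oke _] _]; apply/exponent_okP.
  by apply: eq_bigr => e _; rewrite zE scaler_int.
Qed.

End KostantBasis.

(** * Weights and coroots *)

Lemma inIntSpan_span (K : fieldType) (V : lmodType K) (s : seq V) v :
  inIntSpan (in_tuple s) v -> span Zint (fun u => u \in s) v.
Proof.
case=> c ->; apply: span_sum => i _; rewrite -scaler_int.
apply: (spanZ (Zint_subring K)); first exact: Zint_int.
by apply: (span_in (Zint_subring K)); apply: mem_nth.
Qed.

Lemma mem_inIntSpan (V : zmodType) (s : seq V) v : v \in s -> inIntSpan (in_tuple s) v.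
Proof.
move=> vs; have lt : (index v s < size s)%N by rewrite index_mem.
exists [ffun i => (i == Ordinal lt)%:Z]; rewrite (bigD1 (Ordinal lt)) //= ffunE eqxx mulr1z nth_index //.
by rewrite big1 ?addr0 // => i /negPf ni; rewrite ffunE ni mulr0z.
Qed.

Lemma seq_not_injective (T : eqType) (f : nat -> T) (s : seq T) :
  injective f -> exists n, f n \notin s.
Proof.
move=> fi; apply: contrapT => no.
have sub : {subset [seq f i | i <- iota 0 (size s).+1] <= s}.
  move=> _ /mapP[i _ ->]; apply: contrapT => /negP fis; apply: no; by exists i.
have := uniq_leq_size _ sub; rewrite map_inj_uniq // iota_uniq size_map size_iota => /(_ isT).
by rewrite ltnn.
Qed.

Section LieSuper.
Variables (K : fieldType) (g : lieSuper K).

Lemma sbrx0 (x : g) : sbr x 0 = 0. Proof. exact: (linear_fun0 (@sbr_linr K g x)). Qed.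
Lemma sbr0x (x : g) : sbr 0 x = 0. Proof. exact: (linear_fun0 (@sbr_linl K g x)). Qed.

(** The two homogeneous parts of a central element are central, their brackets with a homogeneous y
    having different parities. A homogeneous central element spans an ideal, which cannot be all of
    g because g is not abelian. *)
Lemma classical_center : classical g -> forall x : g, (forall y : g, sbr x y = 0) -> x = 0.
Proof.
case=> -[x0 [y0 nonab]] simple _ x xc.
have hom p z : z \in spart g p -> (forall y : g, sbr z y = 0) -> z = 0.
  move=> zp zc; have zc' (y : g) : sbr y z = 0.
    have [u [w [u0 w1 ->]]] := spart_decomp y.
    by rewrite sbrDl (sbr_anti u0 zp) (sbr_anti w1 zp) !zc !scaler0 oppr0 addr0.
  case: (simple <[z]>%VS); last 1 first.
  - move=> full; have all y : exists c, y = c *: z.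
      by apply/vlineP; rewrite full memvf.
    have [c xE] := all x0; have [d yE] := all y0.
    by case: nonab; rewrite xE yE sbrZl sbrZr zc !scaler0.
  - split; last by move=> u y /vlineP[c ->]; rewrite sbrZr zc' scaler0 mem0v.
    apply/eqP; rewrite eqEsubv subv_add !capvSl !andbT.
    rewrite -memvE; have : z \in (<[z]> :&: spart g p)%VS by rewrite memv_cap memv_line.
    by case: (p); apply: subvP; [exact: addvSr | exact: addvSl].
  - by move=> z0; apply/eqP; rewrite -memv0 -z0 memv_line.
have [u [w [u0 w1 xE]]] := spart_decomp x.
have part0 p y : y \in spart g p -> sbr u y = 0 /\ sbr w y = 0.
  move=> yp; have := xc y; rewrite xE sbrDl => /eqP; rewrite addr_eq0 => /eqP uw.
  have up := sbr_part u0 yp; have wp := sbr_part w1 yp; rewrite /= in up wp.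
  have w0 : sbr w y = 0.
    by case: p yp up wp => _ up wp; apply: spart_disjoint => //; rewrite -memvN -uw.
  by rewrite uw w0 oppr0.
have all0 y : sbr u y = 0 /\ sbr w y = 0.
  have [y0' [y1' [h0 h1 ->]]] := spart_decomp y.
  by rewrite !sbrDr; have [-> ->] := part0 _ _ h0; have [-> ->] := part0 _ _ h1; rewrite !addr0.
rewrite xE (hom _ u u0 (fun y => (all0 y).1)) (hom _ w w1 (fun y => (all0 y).2)).
by rewrite addr0.
Qed.

Lemma jacobi_even (u x z : g) : u \in spart g false ->
  sbr u (sbr x z) = sbr (sbr u x) z + sbr x (sbr u z).
Proof.
move=> u0; have [x0 [x1 [h0 h1 ->]]] := spart_decomp x.
rewrite sbrDl !sbrDr sbrDl (sbr_jacobi z u0 h0) (sbr_jacobi z u0 h1) !scale1r.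
by rewrite sbrDl addrACA.
Qed.

(* If [e, f] = t acts by tau on e, and f kills a vector of t-weight c, then
   applying f to the chain of the (ad e)^j x forces 2 c to be a multiple of tau. *)
Lemma sl2_weight (char0 : [pchar K] =i pred0) (e f t x : g) (tau c : K) :
  e \in spart g false -> f \in spart g false -> t \in spart g false -> sbr e f = t ->
  sbr t e = tau *: e -> sbr t x = c *: x -> sbr f x = 0 -> x <> 0 ->
  (exists J, iter J (sbr e) x = 0) -> exists j : nat, 2 * c = - (tau * j%:R).
Proof.
move=> e0 f0 t0 eft te tx fx xn0 exJ.
pose w j := iter j (sbr e) x.
have tw j : sbr t (w j) = (c + j%:R * tau) *: w j.
  elim: j => [|j IH]; first by rewrite /w /= tx mul0r addr0.
  rewrite [w _.+1]/(sbr e (w j)) jacobi_even // te IH sbrZl sbrZr -scalerDl; congr (_ *: _).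
  by rewrite -natr1; ring.
pose S j := \sum_(i < j) (c + i%:R * tau).
have fw j : sbr f (w j.+1) = - S j.+1 *: w j.
  have fe : sbr f e = - t by rewrite (sbr_anti f0 e0) scale1r eft.
  elim: j => [|j IH].
    rewrite /w /= jacobi_even // fe fx sbrx0 addr0 -scaleN1r sbrZl tx scalerA mulN1r.
    by rewrite /S big_ord_recr big_ord0 /= mul0r addr0 add0r.
  rewrite [w j.+2]/(sbr e (w j.+1)) jacobi_even // fe IH sbrZr -scaleN1r sbrZl tw scalerA.
  rewrite -[sbr e (w j)]/(w j.+1) -scalerDl; congr (_ *: _).
  by rewrite /S [in RHS]big_ord_recr /= opprD mulN1r addrC.
have S2 j : 2 * S j.+1 = j.+1%:R * (2 * c + tau * j%:R).
  elim: j => [|j IH]; first by rewrite /S big_ord_recr big_ord0 /=; ring.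
  rewrite /S big_ord_recr /= -/(S j.+1) mulrDr IH -!natr1; ring.
(* Let w j be the last nonzero vector of the chain. Applying f to w (j + 1) = 0 gives S (j + 1) = 0,
   and [S2] turns this into 2 c = - tau j. *)
have exJ' : exists J, w J == 0 by case: exJ => J wJ; exists J; apply/eqP.
case: (ex_minnP exJ') => -[|j] /eqP wj minj; first by [].
have wjn : w j != 0 by apply/negP => /minj; rewrite ltnn.
exists j; apply/eqP; rewrite -addr_eq0.
have : - S j.+1 *: w j == 0 by rewrite -fw wj sbrx0.
rewrite scaler_eq0 (negPf wjn) orbF oppr_eq0 => /eqP Sj.
have := S2 j; rewrite Sj mulr0 => /esym/eqP.
by rewrite mulf_eq0 (negPf (natK_neq0 char0 j)).
Qed.

End LieSuper.

Section Weights.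
Variables (K : fieldType) (char0 : [pchar K] =i pred0) (g : lieSuper K) (h : {vspace g}).
Variables (D : seq (hdual h)) (H : 'I_(\dim h) -> subvs_of h) (X : hdual h -> g).
Hypothesis D_uniq : uniq D.
Hypothesis D_roots : forall a : hdual h, a \in D <-> is_root a.
Hypothesis h_even : (h <= spart g false)%VS.
Hypothesis HX_basis : basis_of fullv ([seq val (H i) | i <- enum 'I_(\dim h)] ++ [seq X a | a <- D]).
Hypothesis X_hom : forall a, a \in D -> exists p, X a \in spart g p.
Hypothesis H_basis : basis_of fullv [seq H i | i <- enum 'I_(\dim h)].
Hypothesis HH0 : forall i j, sbr (val (H i)) (val (H j)) = 0.
Hypothesis HXw : forall i a, a \in D -> sbr (val (H i)) (X a) = a (H i) *: X a.

Local Notation I := (pbw_index D).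
Local Notation rv := (@root_vec K g h D H X).
Local Notation co := (fcoord rv).

Let rfree := root_vec_free HX_basis D_uniq.
Let rspan := root_vec_span HX_basis D_uniq.

Lemma cartan_span (u : subvs_of h) : exists c : 'I_(\dim h) -> K, u = \sum_i c i *: H i.
Proof.
have : u \in <<[tuple H i | i < \dim h]>>%VS by rewrite (span_basis H_basis) memvf.
move/coord_span => ->; exists (fun i => coord [tuple H i | i < \dim h] i u).
by apply: eq_bigr => i _; rewrite -tnth_nth tnth_mktuple.
Qed.

Lemma hdual_ext (a b : hdual h) : (forall i, a (H i) = b (H i)) -> a = b.
Proof.
move=> E; apply/lfunP => u; have [c ->] := cartan_span u.
by rewrite !linear_sum; apply: eq_bigr => i _; rewrite !linearZ /= E.
Qed.

Lemma X_root_space a : a \in D -> in_root_space a (X a).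
Proof.
move=> aD u; have [c ->] := cartan_span u; rewrite !linear_sum scaler_suml.
rewrite (linear_fun_sum _ _ _ (@sbr_linl K g _)); apply: eq_bigr => i _.
by rewrite !linearZ /= sbrZl HXw // scalerA.
Qed.

Lemma cartan_even (u : subvs_of h) : val u \in spart g false.
Proof. by apply: (subvP h_even); apply: subvsP. Qed.

Lemma X_neq0 a : a \in D -> X a != 0.
Proof.
move=> aD; apply/eqP => X0.
have := fcoord_basis rfree (inl (SeqSub aD)) (inl (SeqSub aD)).
by rewrite eqxx /= X0 /fcoord linear0 => /esym/eqP; rewrite oner_eq0.
Qed.

Lemma co_bracket_H i x k : co k (sbr (val (H i)) x) =
  (if k is inl a then ssval a (H i) else 0) * co k x.
Proof.
rewrite {1}[x]rspan sbr_sumr fcoord_bigsum (bigD1 k) //= sbrZr fcoordZ.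
rewrite big1 ?addr0 => [|j jk]; rewrite ?sbrZr ?fcoordZ; last first.
  case: j jk => [b|j] jk /=; last by rewrite HH0 /fcoord linear0 mulr0.
  by rewrite HXw ?ssvalP // fcoordZ -[X _]/(rv (inl b)) (fcoord_basis rfree) (negPf jk) !mulr0.
case: k => [a|j] /=; last by rewrite HH0 /fcoord linear0 mulr0 mul0r.
by rewrite HXw ?ssvalP // fcoordZ -[X _]/(rv (inl a)) (fcoord_basis rfree) eqxx mulr1 mulrC.
Qed.

Lemma root_space_co (mu : hdual h) x (a : seq_sub D) :
  in_root_space mu x -> co (inl a) x != 0 -> ssval a = mu.
Proof.
move=> xmu ca; apply: hdual_ext => i; apply: (mulIf ca).
by have := co_bracket_H i x (inl a); rewrite (xmu (H i)) fcoordZ /= => ->.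
Qed.

Lemma root_space_coH (mu : hdual h) x i :
  in_root_space mu x -> co (inr i) x != 0 -> mu = 0.
Proof.
move=> xmu ca; apply: hdual_ext => j; rewrite zero_lfunE; apply: (mulIf ca).
by have := co_bracket_H j x (inr i); rewrite (xmu (H j)) fcoordZ /= mul0r.
Qed.

Lemma root_space_mem (mu : hdual h) x : in_root_space mu x -> x != 0 -> mu \in 0 :: D.
Proof.
move=> xmu x0; have [k ck] : exists k, co k x != 0.
  apply: contrapT => no; case/eqP: x0; rewrite [x]rspan big1 // => k _.
  by case: (eqVneq (co k x) 0) => [-> | ck]; [rewrite scale0r | case: no; exists k].
case: k ck => [a|i] ck; first by rewrite inE -(root_space_co xmu ck) ssvalP orbT.
by rewrite (root_space_coH xmu ck) mem_head.
Qed.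

(** The basis has a single vector for each root, so the spaces of nonzero weight are lines; this is
    what lets the parity of a root be read off X a. *)
Lemma root_space_line (a : hdual h) x : a != 0 -> in_root_space a x -> exists c, x = c *: X a.
Proof.
move=> a0 xa; case: (eqVneq x 0) => [-> | x0]; first by exists 0; rewrite scale0r.
have := root_space_mem xa x0; rewrite inE (negPf a0) /= => aD.
exists (co (inl (SeqSub aD)) x); rewrite {1}[x]rspan (bigD1 (inl (SeqSub aD))) //= big1 ?addr0 // => k kn.
case: (eqVneq (co k x) 0) => [-> | ck]; first by rewrite scale0r.
case: k kn ck => [b|i] kn ck; last by move: a0; rewrite (root_space_coH xa ck) eqxx.
by case/eqP: kn; congr inl; apply: val_inj; rewrite /= (root_space_co xa ck).
Qed.

Lemma root_space_bracket (a b : hdual h) x y : in_root_space a x -> in_root_space b y ->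
  in_root_space (a + b) (sbr x y).
Proof.
move=> xa yb u; rewrite (jacobi_even _ _ (cartan_even u)) (xa u) (yb u).
by rewrite sbrZl sbrZr -scalerDl add_lfunE.
Qed.

Hypothesis D0 : 0 \notin D.

Lemma scale_even c x p : c != 0 -> c *: x \in spart g p -> x \in spart g p.
Proof. by move=> c0 cx; rewrite -[x](scalerK c0); apply: memvZ. Qed.

Lemma hom_odd a : a \in D -> X a \notin spart g false -> X a \in spart g true.
Proof. by move=> /X_hom [[] // Xa]; rewrite Xa. Qed.

Lemma even_rootP a : even_root a <-> a \in D /\ X a \in spart g false.
Proof.
split=> [[/eqP a0 [x [/eqP x0 xe xa]]] | [aD Xa]]; last first.
  split; first by move=> a0; move: D0; rewrite -a0 aD.
  by exists (X a); split=> //; [apply/eqP/X_neq0 | apply: X_root_space].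
have aD : a \in D by apply/D_roots; left; split; [apply/eqP | exists x; split=> //; apply/eqP].
split=> //; have [c xE] := root_space_line a0 xa.
apply: (@scale_even c); rewrite -?xE //.
by apply: contra x0; rewrite xE => /eqP ->; rewrite scale0r.
Qed.

Lemma odd_rootP a : odd_root a <-> a \in D /\ X a \notin spart g false.
Proof.
split=> [[x [/eqP x0 xo xa]] | [aD Xa]]; last first.
  exists (X a); split; [exact/eqP/X_neq0 | exact: hom_odd | exact: X_root_space].
have aD : a \in D by apply/D_roots; right; exists x; split=> //; apply/eqP.
have a0 : a != 0 by apply: contraNneq D0 => <-.
split=> //; have [c xE] := root_space_line a0 xa.
have c0 : c != 0 by apply: contra x0; rewrite xE => /eqP ->; rewrite scale0r.
apply/negP => Xe; case/eqP: x0; apply: spart_disjoint xo.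
by rewrite xE; apply: memvZ.
Qed.

Lemma iter_root_space (a mu : hdual h) x j : a \in D -> in_root_space mu x ->
  in_root_space (mu + a *+ j) (iter j (sbr (X a)) x).
Proof.
move=> aD xmu; elim: j => [|j IH]; first by rewrite addr0.
by rewrite iterS mulrS addrCA; apply: root_space_bracket IH; apply: X_root_space.
Qed.

(** In characteristic 0 the weights mu + a j are pairwise distinct, and only finitely many of them
    can occur. *)
Lemma ad_nilpotent (a mu : hdual h) x : a \in D -> in_root_space mu x ->
  exists J, iter J (sbr (X a)) x = 0.
Proof.
move=> aD xmu; have a0 : a != 0 by apply: contraNneq D0 => <-.
have inj : injective (fun j => mu + a *+ j).
  move=> i j /addrI; wlog le_ij : i j / (i <= j)%N.
    by move=> W; have [le | /ltnW le] := leqP i j; [apply: W | move/esym => E; apply/esym/W].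
  move=> E; have : a *+ (j - i) = 0 by rewrite mulrnBr // E subrr.
  move/eqP; rewrite -scaler_nat scaler_eq0 (negPf a0) orbF.
  by have /pcharf0P -> := char0; rewrite subn_eq0 => le_ji; apply/eqP; rewrite eqn_leq le_ij.
have [n nD] := seq_not_injective (0 :: D) inj; exists n.
apply: contrapT => /eqP xn; move/negP: nD; apply.
exact: root_space_mem (iter_root_space n aD xmu) xn.
Qed.

(* Apply [sl2_weight] to the bottom of the a-string through x. *)
Lemma coroot_weight a (w : subvs_of h) (b : hdual h) : a \in D -> - a \in D ->
  X a \in spart g false -> X (- a) \in spart g false -> sbr (X a) (X (- a)) = val w ->
  b \in D -> exists z : int, 2 * (b w : K) = (a w : K) * z%:~R.
Proof.
move=> aD naD Xa Xna XX bD.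
have [J0 J00] := ad_nilpotent naD (X_root_space bD).
have ex : exists J, iter J (sbr (X (- a))) (X b) == 0 by exists J0; apply/eqP.
case: (ex_minnP ex) => -[|J] /eqP xJ minJ.
  by move: xJ => /= /eqP; rewrite (negPf (X_neq0 bD)).
set x := iter J (sbr (X (- a))) (X b).
have x0 : x <> 0 by move=> /eqP xz; have := minJ J xz; rewrite ltnn.
have xw : in_root_space (b + (- a) *+ J) x := iter_root_space J naD (X_root_space bD).
have exJ := ad_nilpotent aD xw.
have [j E] := sl2_weight char0 Xa Xna (cartan_even w) XX (X_root_space aD w) (xw w) xJ x0 exJ.
(* The bottom of the string has weight b - J a, so 2 (b - J a)(w) = - a(w) j. *)
exists (2 * J%:Z - j%:Z); move: E.
rewrite add_lfunE -scaler_nat scale_lfunE opp_lfunE => E.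
rewrite rmorphB rmorphM /=.
have -> : 2 * (b w : K) = 2 * (b w + J%:R *: - a w : K) + 2 * (J%:R * a w).
  by rewrite /GRing.scale /=; ring.
by rewrite E; ring.
Qed.

End Weights.

(** * From Chevalley bases to root data *)

Lemma pm_natS_neq0 (K : fieldType) (char0 : [pchar K] =i pred0) (c : K) n : pm c n.+1%:R -> c != 0.
Proof. by case=> ->; rewrite ?oppr_eq0 natK_neq0. Qed.

Lemma pm_Zint (K : fieldType) (c x : K) : Zint x -> pm c x -> Zint c.
Proof. by move=> Zx [] -> //; apply: (subringN (Zint_subring K)). Qed.

Section Common.
Variables (K : fieldType) (char0 : [pchar K] =i pred0) (g : lieSuper K) (h : {vspace g}).
Variables (D : seq (hdual h)) (H : 'I_(\dim h) -> subvs_of h) (X : hdual h -> g).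
Hypothesis D_uniq : uniq D.
Hypothesis D_roots : forall a : hdual h, a \in D <-> is_root a.
Hypothesis h_even : (h <= spart g false)%VS.
Hypothesis centerless : forall x : g, (forall y : g, sbr x y = 0) -> x = 0.
Variables (form : subvs_of h -> subvs_of h -> K) (cor : hdual h -> subvs_of h).
Variables (M : zmodType) (lift : hdual h -> M).
Variables (exc : hdual h -> hdual h -> Prop) (negodd : hdual h -> Prop).
Hypothesis chev : chevalley_axioms form cor lift exc negodd D H X.

Local Notation lifts := [seq lift a | a <- D].

Lemma chev_basis : basis_of fullv ([seq val (H i) | i <- enum 'I_(\dim h)] ++ [seq X a | a <- D]).
Proof. by case: chev => -[]. Qed.
Lemma chev_hom a : a \in D -> exists p, X a \in spart g p.
Proof. by case: chev => -[_ Xp] _ _ _ _; apply: Xp. Qed.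
Lemma chev_Hbasis : basis_of fullv [seq H i | i <- enum 'I_(\dim h)].
Proof. by case: chev => _ []. Qed.
Lemma chev_HH i j : sbr (val (H i)) (val (H j)) = 0.
Proof. by case: chev => _ _ []. Qed.
Lemma chev_HX i a : a \in D -> sbr (val (H i)) (X a) = a (H i) *: X a.
Proof. by case: chev => _ _ [_ HX] _ _; apply: HX. Qed.

Let ZK := Zint_subring K.

Lemma chev_cor_lattice a : a \in D -> - a \in D ->
  span Zint (fun u => exists i, u = val (H i)) (val (cor a)).
Proof.
case: chev => _ [_ spanE] _ _ _ aD naD.
have /spanE/inIntSpan_span Hs : inIntSpan (in_tuple [seq cor a | a <- D & - a \in D]) (cor a).
  by apply: mem_inIntSpan; apply: map_f; rewrite mem_filter naD aD.
have lval : linear (val : subvs_of h -> g) by move=> c u w; rewrite linearP.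
apply: (span_linear ZK lval _ Hs) => _ /mapP[i _ ->].
by apply: (span_in ZK); exists i.
Qed.

Lemma chev_opp a : a \in D -> - a \in D ->
  sbr (X a) (X (- a)) = val (cor a) \/ sbr (X a) (X (- a)) = - val (cor a).
Proof.
case: chev => _ _ _ XX _ aD naD; have [E1 E2] := XX a aD naD.
by have [/E1 -> | /E2 ->] := EM (negodd a); [right | left].
Qed.

Hypothesis D0 : 0 \notin D.
(** The converse cannot be asked for: in P(2) one has beta_12 + beta_23 = - beta_13 as functionals
    on h, but not formally. *)
Hypothesis liftD : forall a b s, a \in D -> b \in D -> s \in D ->
  lift s = lift a + lift b -> s = a + b.
Hypothesis liftN : forall a, a \in D -> - a \in D -> lift (- a) = - lift a.
Hypothesis lift2 : forall a, a \in D -> X a \in spart g false -> a + a \in D ->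
  lift (a + a) = lift a + lift a.
Hypothesis even_symm : forall a, a \in D -> X a \in spart g false -> - a \in D.
Hypothesis even_aniso : forall a, a \in D -> X a \in spart g false -> anisotropic form a.
Hypothesis even_cor : forall a, a \in D -> X a \in spart g false -> a (cor a) = 2.
Hypothesis even_negodd : forall a, a \in D -> X a \in spart g false -> ~ negodd a.
Hypothesis even_exc : forall a b, a \in D -> X a \in spart g false -> ~ exc a b.
Hypothesis iso_int : forall a b, a \in D -> b \in D -> ~ anisotropic form a ->
  ~ anisotropic form b -> Zint (b (cor a) : K).
Hypothesis cor_int : forall a b, a \in D -> - a \in D -> b \in D -> Zint (b (cor a) : K).

Lemma chev_add a b : a \in D -> b \in D -> a != - b ->
  sbr (X a) (X b) = 0 \/ exists s c, [/\ s \in D, lift s = lift a + lift b, s = a + b,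
    structure_constant form cor lift exc D a b c & sbr (X a) (X b) = c *: X s].
Proof.
case: chev => _ _ _ _ XX aD bD ab; have [E1 E2] := XX a b aD bD ab.
case: (boolP (lift a + lift b \in lifts)) => [/mapP[s sD sE] | /E1]; last by left.
right; have [c c1 c2] := E2 s sD (esym sE).
by exists s, c; split=> //; apply: liftD.
Qed.

Lemma structure_constant_Zint a b c : a \in D -> b \in D ->
  structure_constant form cor lift exc D a b c -> Zint c.
Proof.
move=> aD bD [c1 c2]; have [an | nan] := EM (anisotropic form a \/ anisotropic form b).
  have [r _ [E1 E2]] := c1 an.
  by have [/E2 | /E1] := EM (exc a b); apply: pm_Zint; apply: (subring_nat _ ZK).
have [na nb] : ~ anisotropic form a /\ ~ anisotropic form b by split=> ?; apply: nan; auto.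
exact: pm_Zint (iso_int aD bD na nb) (c2 (conj na nb)).
Qed.

Lemma structure_constant_even a b c : a \in D -> X a \in spart g false ->
  structure_constant form cor lift exc D a b c ->
  exists2 r, string_lower lift D a b r & pm c r.+1%:R.
Proof.
move=> aD Xa [c1 _]; have [|r sr [E _]] := c1; first by left; apply: even_aniso.
by exists r => //; apply: E; apply: even_exc.
Qed.

(** An even vector has zero bracket with itself, while a root at twice a would give this bracket the
    coefficient r + 1 up to sign, nonzero in characteristic 0. *)
Lemma even_no_double a s : a \in D -> X a \in spart g false -> s \in D ->
  lift s <> lift a + lift a.
Proof.
case: chev => _ _ _ _ XX aD Xa sD sE.
have [_ E2] := XX a a aD aD (root_neq_opp char0 D0 aD); have [c cs] := E2 s sD sE.
have [r _ /(pm_natS_neq0 char0) c0] := structure_constant_even aD Xa cs.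
move/esym/eqP; rewrite (sbr_even_self char0 Xa) // scaler_eq0 (negPf c0) /=.
by rewrite (negPf (X_neq0 D_uniq chev_basis sD)).
Qed.

Lemma even_opp_even a : a \in D -> X a \in spart g false -> X (- a) \in spart g false.
Proof.
move=> aD Xa; have naD := even_symm aD Xa; have [[] // Xn] := chev_hom naD.
have cor0 : val (cor a) = 0.
  apply: spart_disjoint; first exact: cartan_even.
  have := sbr_part Xa Xn; case: (chev_opp aD naD) => -> //.
  by rewrite memvN.
have := even_cor aD Xa; rewrite (_ : cor a = 0) ?linear0; last exact: val_inj.
by move/eqP; rewrite eq_sym (negPf (natK_neq0 char0 1)).
Qed.

Lemma string_succ a b s r : string_lower lift D a b r -> s \in D ->
  lift s = lift a + lift b -> string_lower lift D a s r.+1.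
Proof.
move=> [S1 S2] sD sE; have shift j : lift s - lift a *+ j.+1 = lift b - lift a *+ j.
  by rewrite sE mulrS opprD addrACA subrr add0r.
split; last by rewrite shift.
move=> [|j] jr; last by rewrite shift; apply: S1.
by rewrite mulr0n subr0 inE map_f ?orbT.
Qed.

Lemma string_uniq a b r r' : string_lower lift D a b r -> string_lower lift D a b r' -> r = r'.
Proof.
move=> [S1 S2] [S1' S2']; apply/eqP; rewrite eqn_leq.
by apply/andP; split; rewrite leqNgt; apply/negP => lt; [move: S2'; rewrite S1 | move: S2; rewrite S1'].
Qed.

(* The lower length of the a-string grows by one at each step, so the structure
   constants multiply to a rising factorial, divisible by k!. *)
Lemma string_iter a b r k : a \in D -> X a \in spart g false -> b \in D -> b != - a ->
  string_lower lift D a b r ->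
  iter k (sbr (X a)) (X b) = 0 \/ exists s c, [/\ s \in D,
    pm c (\prod_(i < k) (r.+1 + i)%:R) & iter k (sbr (X a)) (X b) = c *: X s].
Proof.
move=> aD Xa; elim: k b r => [|k IH] b r bD ba sr.
  by right; exists b, 1; rewrite big_ord0 scale1r; split=> //; left.
have ab : a != - b by apply: contra ba => /eqP ->; rewrite opprK.
rewrite iterSr; have [-> | [s [c [sD sE sab cs ->]]]] := chev_add aD bD ab.
  by left; elim: k {IH} => [|k IHk] //=; rewrite IHk sbrx0.
have [r' sr' pc] := structure_constant_even aD Xa cs.
have r'E := string_uniq sr sr'; subst r'.
have lin : iter k (sbr (X a)) (c *: X s) = c *: iter k (sbr (X a)) (X s).
  by elim: (k) => //= j ->; rewrite sbrZr.
(* Otherwise b would be the double of the even root - a. *)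
have sna : s != - a.
  apply/eqP => sna; have naD := even_symm aD Xa.
  apply: (even_no_double naD (even_opp_even aD Xa) bD).
  by rewrite (liftN aD naD) -opprD; apply/eqP; rewrite -addr_eq0 addrC -addrA -sE sna (liftN aD naD) addrN.
rewrite lin; have [-> | [s' [c' [s'D pc' ->]]]] := IH s r.+1 sD sna (string_succ sr sD sE).
  by left; rewrite scaler0.
right; exists s', (c * c'); split=> //; last by rewrite scalerA.
rewrite big_ord_recl addn0.
have -> : \prod_(i < k) (r.+1 + fintype.lift ord0 i)%:R = \prod_(i < k) (r.+2 + i)%:R :> K.
  by apply: eq_bigr => i _; rewrite lift0 addnS.
by case: pc => ->; case: pc' => ->; rewrite ?mulrN ?mulNr ?opprK; [left|right|right|left].
Qed.

Lemma prod_rising r k : \prod_(i < k) ((r.+1 + i)%:R : K) = k`!%:R * 'C(r + k, k)%:R.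
Proof.
elim: k => [|k IH]; first by rewrite big_ord0 bin0 mulr1.
rewrite big_ord_recr /= IH -!natrM addnS factS; congr _%:R.
have /= E := mul_bin_diag (r + k).+1 k.
by rewrite addSn -mulnA [('C(_, _) * _)%N]mulnC E [LHS]mulnCA mulnA.
Qed.

Lemma chev_dp a b k : a \in D -> X a \in spart g false -> b \in D ->
  lattice D H X ((k`!%:R)^-1 *: iter k (sbr (X a)) (X b)).
Proof.
move=> aD Xa bD.
have latX s : s \in D -> lattice D H X (X s).
  by move=> sD; apply: (span_in ZK); exists (inl (SeqSub sD)).
(* For b = - a the chain runs through h, where strings give no structure constant. It is explicit:
   up to sign X_-a, H_a, 2 X_a, 0, and 2! divides the third term. *)
have [-> | ba] := eqVneq b (- a).
  have naD := even_symm aD Xa.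
  have lc : lattice D H X (val (cor a)).
    by apply: (span_sub ZK) (chev_cor_lattice aD naD) => _ [i ->]; exists (inr i).
  have lXX : lattice D H X (sbr (X a) (X (- a))).
    by case: (chev_opp aD naD) => ->; [|apply: (spanN ZK)].
  have XXX : sbr (X a) (val (cor a)) = - 2 *: X a.
    rewrite (sbr_anti Xa (cartan_even h_even _)) scale1r.
    by rewrite (X_root_space chev_Hbasis chev_HX aD) even_cor // scaleNr.
  case: k => [|[|[|k]]] /=.
  - by rewrite invr1 scale1r; apply: latX.
  - by rewrite invr1 scale1r.
  - have n2 : (2 : K) != 0 := natK_neq0 char0 1.
    case: (chev_opp aD naD) => ->.
      by rewrite XXX scalerA mulrN mulVf // scaleN1r; apply: (spanN ZK); apply: latX.
    rewrite -scaleN1r sbrZr XXX !scalerA mulrN1 mulrNN mulVf // scale1r; exact: latX.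
  - suff -> : sbr (X a) (sbr (X a) (sbr (X a) (iter k (sbr (X a)) (X (- a))))) = 0.
      by rewrite scaler0; constructor.
    elim: k => [|k /= ->]; last by rewrite sbrx0.
    rewrite /=; have : sbr (X a) (sbr (X a) (val (cor a))) = 0.
      by rewrite XXX sbrZr (sbr_even_self char0 Xa) // scaler0.
    by case: (chev_opp aD naD) => -> // E; rewrite -scaleN1r !sbrZr E scaler0.
case: k => [|k]; first by rewrite /= invr1 scale1r; apply: latX.
have ab : a != - b by apply: contra ba => /eqP ->; rewrite opprK.
have [E | [s [c [sD sE sab cs _]]]] := chev_add aD bD ab.
  suff -> : iter k.+1 (sbr (X a)) (X b) = 0 by rewrite scaler0; constructor.
  by rewrite iterSr E; elim: (k) => //= j ->; rewrite sbrx0.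
have [r sr _] := structure_constant_even aD Xa cs.
have [-> | [s' [c' [s'D pc' ->]]]] := string_iter k.+1 aD Xa bD ba sr.
  by rewrite scaler0; constructor.
rewrite scalerA; apply: (spanZ ZK); last exact: latX.
move: pc'; rewrite prod_rising; set f := _`!%:R => pc'.
have f0 : f != 0 by apply: fact_neq0.
by case: pc' => ->; rewrite ?mulrN mulKf //; [|apply: (subringN ZK)]; apply: (subring_nat _ ZK).
Qed.

Hypothesis odd_square : forall a, a \in D -> X a \notin spart g false ->
  lattice D H X (2^-1 *: sbr (X a) (X a)).

Theorem chevalley_kostant_data : kostant_data D H X.
Proof.
split=> //.
- exact: chev_basis.
- exact: chev_hom.
- exact: chev_HH.
- exact: chev_HX.
(* By condition (a) each H_i is an integral combination of coroots, on which roots take integral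
   values. *)
- move=> i a aD; case: chev => _ [_ spanE] _ _ _.
  have /spanE/inIntSpan_span Hs : inIntSpan (in_tuple [seq H i | i <- enum 'I_(\dim h)]) (H i).
    by apply: mem_inIntSpan; apply: map_f; rewrite mem_enum.
  elim: Hs => [|c _ y Zc /mapP[b + ->] _ IH]; first by rewrite linear0; apply: (subring0 ZK).
  rewrite mem_filter => /andP[nbD bD]; rewrite linearP; apply: (subringD ZK) => //.
  by apply: (subringM ZK) => //; apply: cor_int.
- move=> a aD naD; have := chev_cor_lattice aD naD.
  by case: (chev_opp aD naD) => -> //; apply: (spanN ZK).
- move=> a b aD bD ab; have [-> | [s [c [sD _ sE cs ->]]]] := chev_add aD bD ab; first by left.
  right; exists c; rewrite -sE; split=> //.
  exact: (structure_constant_Zint aD bD cs).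
- move=> a aD Xa; split; [exact: even_symm | |].
    by apply/negP => a2; apply: (even_no_double aD Xa a2); apply: lift2.
  exists (cor a); last exact: even_cor.
  case: chev => _ _ _ XX _; have [_ E] := XX a aD (even_symm aD Xa).
  by apply: E; apply: even_negodd.
- exact: chev_dp.
Qed.

End Common.

(** * Types other than P(n) *)

Section Basic.
Variables (K : fieldType) (char0 : [pchar K] =i pred0) (g : lieSuper K) (h : {vspace g}).
Variables (D : seq (hdual h)) (H : 'I_(\dim h) -> subvs_of h) (X : hdual h -> g).
Hypothesis D_uniq : uniq D.
Hypothesis D_roots : forall a : hdual h, a \in D <-> is_root a.
Hypothesis h_even : (h <= spart g false)%VS.
Hypothesis centerless : forall x : g, (forall y : g, sbr x y = 0) -> x = 0.
Variables (B : g -> g -> K) (cor : hdual h -> subvs_of h) (neg : hdual h -> Prop).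
Hypothesis B_form : even_invariant_form B.
Local Notation form := (fun u v : subvs_of h => B (val u) (val v)).
Hypothesis B_cor : basic_coroots form D cor.
Hypothesis chev : chevalley_axioms form cor id (fun _ _ => False)
  (fun a => odd_root a /\ neg a) D H X.

Let ZK := Zint_subring K.
Let n2 : (2 : K) != 0 := natK_neq0 char0 1.
Let HXb := chev_basis chev.
Let Hb := chev_Hbasis chev.
Let HH := chev_HH chev.
Let HXw := chev_HX chev.
Let Xhom := chev_hom chev.

Lemma form_sym (u w : subvs_of h) : form u w = form w u.
Proof.
by case: B_form => _ _ sym _ _; rewrite (sym _ _ _ _ (cartan_even h_even u) (cartan_even h_even w)) mul1r.
Qed.

Lemma coroot_isotropic a : a \in D -> ~ anisotropic form a -> a (cor a) = 0.
Proof.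
move=> aD iso; have [[t [k [dt ->]]] _ _ _] := B_cor aD.
rewrite linearZ /= -(dt t); have [-> | ne] := EM (form t t = 0); first by rewrite scaler0.
by case: iso; exists t.
Qed.

Lemma isotropic_coroot_int a b : a \in D -> b \in D -> ~ anisotropic form a -> Zint (b (cor a) : K).
Proof.
move=> aD bD iso; have [_ _ /(_ iso) E _] := B_cor aD.
by apply/E; apply: mem_inIntSpan; apply/mapP; exists b.
Qed.

Lemma isotropic_coroot_nontrivial a : a \in D -> ~ anisotropic form a ->
  ~ (forall b, b \in D -> b (cor a) = 0).
Proof.
move=> aD iso all0; have [_ _ /(_ iso 1) E _] := B_cor aD.
have [_ /(_ (ex_intro _ 1 erefl)) [c cE]] := E.
have := oner_neq0 K; rewrite cE big1 ?eqxx // => i _.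
set s := in_tuple _; have : s`_i \in tval s by apply: mem_nth.
by case/mapP => b bD ->; rewrite all0 // mul0rz.
Qed.

(** The rule for opposite roots would give H_0 = - H_0, so H_0 = 0. Neither normalization allows
    this: 0(H_0) is not 2, and the values b(H_0) = 0 do not generate the integers. *)
Lemma basic_zero_notin : 0 \notin D.
Proof.
apply/negP => D0; have [_ aniso _ cN] := B_cor D0.
have c0 : cor 0 = 0.
  have /eqP : (2 : K) *: cor 0 = 0 by rewrite scaler_nat mulr2n {2}(_ : cor 0 = - cor 0) ?subrr // -{1}[0]oppr0.
  by rewrite scaler_eq0 (negPf n2) => /eqP.
have [/aniso /eqP | iso] := EM (anisotropic form 0).
  by rewrite zero_lfunE eq_sym (negPf n2).
by apply: (isotropic_coroot_nontrivial D0 iso) => b _; rewrite c0 linear0.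
Qed.

Lemma form_linr x a y z : B x (a *: y + z) = a * B x y + B x z.
Proof. by case: B_form => _ lin _ _ _; rewrite (lin x a y z). Qed.

Lemma form0r x : B x 0 = 0.
Proof. by case: B_form => _ lin _ _ _; have := linear_fun0 (lin x). Qed.

Lemma formZr x a y : B x (a *: y) = a * B x y.
Proof. by case: B_form => _ lin _ _ _; have := linear_funZ a y (lin x). Qed.

Lemma formZl x a y : B (a *: y) x = a * B y x.
Proof. by case: B_form => lin _ _ _ _; have := linear_funZ a y (lin x). Qed.

Lemma sbr_X_cartan a u : a \in D -> sbr (X a) (val u) = - (a u *: X a).
Proof.
move=> aD; have [p Xp] := Xhom aD.
by rewrite (sbr_anti Xp (cartan_even h_even u)) andbF scale1r (X_root_space Hb HXw aD).
Qed.

(** By invariance X_a pairs trivially with every basis vector whose weight is not - a, so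
    nondegeneracy makes - a a root; the form being even, the two root vectors have the same
    parity. *)
Lemma basic_symm a : a \in D ->
  - a \in D /\ forall p, X a \in spart g p -> X (- a) \in spart g p.
Proof.
move=> aD; have a0 : a != 0 by apply: contraNneq basic_zero_notin => <-.
have [y By] : exists y, B (X a) y != 0.
  apply: contrapT => no; case/eqP: (X_neq0 D_uniq HXb aD).
  case: B_form => _ _ _ _; apply=> y; apply/eqP; apply: contrapT => /negP By.
  by apply: no; exists y.
have [k Bk] : exists k, B (X a) (root_vec (D := D) H X k) != 0.
  apply: contrapT => no; case/eqP: By.
  rewrite [y](root_vec_span HXb D_uniq); elim/big_rec: _ => [|k z _ IH]; first exact: form0r.
  rewrite form_linr IH addr0; case: (eqVneq (B (X a) (root_vec H X k)) 0) => [-> | Bk].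
    by rewrite mulr0.
  by case: no; exists k.
have inv (u : subvs_of h) z : - a u * B (X a) z = B (X a) (sbr (val u) z).
  by case: B_form => _ _ _ inv _; rewrite -inv sbr_X_cartan // -scaleNr formZl.
case: k Bk => [b|i] /= Bk; last first.
  case/eqP: a0; apply: (hdual_ext Hb) => j; rewrite zero_lfunE; apply/eqP.
  have := inv (H j) (val (H i)); rewrite HH form0r => /eqP.
  by rewrite mulf_eq0 (negPf Bk) orbF oppr_eq0.
have bD := ssvalP b; have ba : ssval b = - a.
  apply: (hdual_ext Hb) => j; rewrite opp_lfunE; apply: (mulIf Bk).
  by rewrite inv HXw // formZr.
rewrite ba in bD Bk; split=> // p Xp; have [q Xq] := Xhom bD.
case: B_form => _ _ sym _ _; move: Bk; rewrite (sym _ _ _ _ Xp Xq).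
by case: (eqVneq p q) => [-> // | _]; rewrite eqxx.
Qed.

Lemma even_coroot_eq a : a \in D -> X a \in spart g false ->
  exists w, [/\ sbr (X a) (X (- a)) = val w, (w = cor a \/ w = - cor a)
    & forall b, b \in D -> exists z : int, 2 * (b w : K) = (a w : K) * z%:~R].
Proof.
move=> aD Xa; have [naD par] := basic_symm aD; have Xna := par _ Xa.
have [w Xw wE] : exists2 w, sbr (X a) (X (- a)) = val w & w = cor a \/ w = - cor a.
  case: (chev_opp chev aD naD) => ->; [exists (cor a) | exists (- cor a)]; rewrite ?linearN; auto.
exists w; split=> // b bD.
exact: (coroot_weight char0 D_uniq h_even HXb Hb HH HXw basic_zero_notin aD naD Xa Xna Xw bD).
Qed.

(** If a were isotropic then a(H_a) = 0, and the sl2 relation 2 b(H_a) = a(H_a) z would make every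
    root vanish at H_a, against the normalization of isotropic coroots. *)
Lemma basic_even_aniso a : a \in D -> X a \in spart g false -> anisotropic form a.
Proof.
move=> aD Xa; apply: contrapT => iso; apply: (isotropic_coroot_nontrivial aD iso) => b bD.
have [w [_ wE ww]] := even_coroot_eq aD Xa; have [z E] := ww b bD.
have aw : a w = 0 by case: wE => ->; rewrite ?linearN /= (coroot_isotropic aD iso) ?oppr0.
have bw : b w = 0 by apply/eqP; move/eqP: E; rewrite aw mul0r mulf_eq0 (negPf n2).
by case: wE bw => ->; rewrite ?linearN //= => /eqP; rewrite oppr_eq0 => /eqP.
Qed.

Lemma basic_even_cor a : a \in D -> X a \in spart g false -> a (cor a) = 2.
Proof. by move=> aD Xa; have [_ E _ _] := B_cor aD; apply/E/basic_even_aniso. Qed.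

Lemma basic_even_int a b : a \in D -> X a \in spart g false -> b \in D -> Zint (b (cor a) : K).
Proof.
move=> aD Xa bD; have [w [_ wE ww]] := even_coroot_eq aD Xa; have [z E] := ww b bD.
case: wE => wE; rewrite wE in E.
  by exists z; apply: (mulfI n2); rewrite E basic_even_cor.
exists z; apply: (mulfI n2); move: E; rewrite !linearN /= (basic_even_cor aD Xa) mulrN mulNr.
by move/oppr_inj.
Qed.

Lemma basic_neq_opp a : a \in D -> a != - a.
Proof. exact: (root_neq_opp char0 basic_zero_notin). Qed.

Lemma map_id_roots (s : seq (hdual h)) : [seq id a | a <- s] = s.
Proof. exact: map_id. Qed.

Lemma basic_bracket a b : a \in D -> b \in D -> a != - b ->
  (a + b \notin D -> sbr (X a) (X b) = 0) /\
  (a + b \in D -> exists2 c, structure_constant form cor id (fun _ _ => False) D a b c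
     & sbr (X a) (X b) = c *: X (a + b)).
Proof.
case: chev => _ _ _ _ XX aD bD ab; have [E1 E2] := XX a b aD bD ab.
by rewrite map_id_roots in E1; split=> // sD; apply: E2.
Qed.

Lemma basic_aniso_constant a b c : anisotropic form a ->
  structure_constant form cor id (fun _ _ => False) D a b c ->
  exists2 r, string_lower id D a b r & pm c r.+1%:R.
Proof. by move=> an [c1 _]; have [|r sr [E _]] := c1; [left | exists r => //; apply: E]. Qed.

(* A nonisotropic odd root a has 2a as a root, since [X_a, X_a] = 0 would force
   a(H_a) = 0 by the Jacobi identity. *)
Lemma basic_odd_aniso a : a \in D -> X a \notin spart g false -> anisotropic form a ->
  exists c, [/\ a + a \in D, X (a + a) \in spart g false, c != 0,
    structure_constant form cor id (fun _ _ => False) D a a c & sbr (X a) (X a) = c *: X (a + a)].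
Proof.
move=> aD Xa an; have Xo := hom_odd Xhom aD Xa.
have [naD par] := basic_symm aD; have [_ /(_ an) cor2 _ _] := B_cor aD.
have [E1 E2] := basic_bracket aD aD (basic_neq_opp aD).
have [a2D | /E1 XX0] := boolP (a + a \in D).
  have [c cs Ec] := E2 a2D; have [r _ /(pm_natS_neq0 char0) c0] := basic_aniso_constant an cs.
  exists c; split=> //; apply: (@scale_even _ _ c _ false c0).
  by rewrite -Ec; exact: (sbr_part Xo Xo).
have /eqP : sbr (X a) (sbr (X a) (X (- a))) = 0.
  have := sbr_jacobi (X (- a)) Xo Xo; rewrite XX0 sbr0x add0r scaleN1r => /eqP.
  rewrite -addr_eq0 -mulr2n -scaler_nat scaler_eq0 (negPf n2) => /eqP; exact.
have : sbr (X a) (val (cor a)) != 0.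
  by rewrite sbr_X_cartan // cor2 oppr_eq0 scaler_eq0 (negPf n2) (X_neq0 D_uniq HXb).
case: (chev_opp chev aD naD) => -> /negPf E; first by rewrite E.
by rewrite -scaleN1r sbrZr scaleN1r oppr_eq0 E.
Qed.

(** The new case is that of a nonisotropic odd root a: then 2a is an even root and b(H_a) = 2
    b(H_2a) for every root b. *)
Lemma basic_cor_int a b : a \in D -> b \in D -> Zint (b (cor a) : K).
Proof.
move=> aD bD; have [Xa | Xa] := boolP (X a \in spart g false); first exact: basic_even_int.
have [an | iso] := EM (anisotropic form a); last exact: isotropic_coroot_int.
have [_ [a2D X2 _ _ _]] := basic_odd_aniso aD Xa an.
have [[t [k [dt ck]]] /(_ an) c2 _ _] := B_cor aD.
have [[t' [k' [dt' ck']]] _ _ _] := B_cor a2D.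
have c2' := basic_even_cor a2D X2; have bi := basic_even_int a2D X2 bD.
(* It is enough to compare t' with 2 t on roots: by symmetry of the form, d t' is 2a evaluated at
   the element dual to d. *)
have tt' d : d \in D -> d t' = 2 * d t.
  move=> dD; have [[s [_ [ds _]]] _ _ _] := B_cor dD.
  rewrite -(ds t') -(ds t) !(form_sym s) dt dt' add_lfunE.
  by rewrite mulr_natl mulr2n.
move: c2 c2' bi; rewrite ck ck' !linearZ /= tt' // add_lfunE !tt' //= /GRing.scale /= => c2 c2' bi.
have -> : k * b t = 2 * (k' * (2 * b t)); last by apply: (subringM ZK) => //; exact: (subring_nat 2 ZK).
have kk : k = 4 * k'.
  have at0 : (a t : K) != 0 by apply: contraNneq n2 => E; rewrite -c2 E mulr0.
  apply: (mulIf at0); apply: (mulfI n2).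
  rewrite c2 -{1}c2'; ring.
by rewrite kk; ring.
Qed.

(** For a nonisotropic, the a-string through a reaches down to - 2a and stops there, so r = 3,
    [X_a, X_a] = 4 X_2a up to sign, and its half is integral. It stops because 3a is no root, the
    Jacobi identity giving [[X_a, X_a], X_a] = 0. For a isotropic the constant a(H_a) is 0. *)
Lemma basic_odd_square a : a \in D -> X a \notin spart g false ->
  lattice D H X (2^-1 *: sbr (X a) (X a)).
Proof.
move=> aD Xa; have Xo := hom_odd Xhom aD Xa.
have [an | iso] := EM (anisotropic form a); last first.
  suff -> : sbr (X a) (X a) = 0 by rewrite scaler0; constructor.
  have [E1 E2] := basic_bracket aD aD (basic_neq_opp aD).
  have [/E2 [c [_ cs] ->] | /E1 //] := boolP (a + a \in D).
  have := cs (conj iso iso); rewrite coroot_isotropic // => -[] ->; rewrite ?oppr0 scale0r //.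
have [c [a2D X2 c0 cs E]] := basic_odd_aniso aD Xa an.
have [naD _] := basic_symm aD; have [na2D _] := basic_symm a2D.
have a30 : a *+ 3 != 0.
  have a0 : a != 0 by apply: contraNneq basic_zero_notin => <-.
  by rewrite -scaler_nat scaler_eq0 (negPf (natK_neq0 char0 2)).
have a3D : a *+ 3 \notin D.
  apply/negP => a3D; have a3E : a + a + a = a *+ 3 by rewrite !mulrS mulr0n addr0 addrA.
  have ne : a + a != - a by rewrite -addr_eq0 a3E.
  have [_ E2] := basic_bracket a2D aD ne; rewrite a3E in E2.
  have [c' cs' E'] := E2 a3D.
  have [r _ /(pm_natS_neq0 char0) c'0] := basic_aniso_constant (basic_even_aniso a2D X2) cs'.
  have XXX : sbr (sbr (X a) (X a)) (X a) = 0.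
    have XXe := sbr_part Xo Xo; have := sbr_jacobi (X a) Xo Xo.
    rewrite (sbr_anti XXe Xo) /= scale1r scaleN1r => /eqP; rewrite -subr_eq0.
    set z := sbr _ _; rewrite opprD !opprK addrA -!mulr2n -mulrSr -scaler_nat scaler_eq0.
    by rewrite (negPf (natK_neq0 char0 2)) => /eqP ->; rewrite oppr0.
  move/eqP: XXX; rewrite E sbrZl E' !scaler_eq0 (negPf c0) (negPf c'0).
  by rewrite (negPf (X_neq0 D_uniq HXb a3D)).
have na3D : - (a *+ 3) \notin 0 :: D.
  rewrite inE oppr_eq0 negb_or a30; apply: contra a3D => /basic_symm [].
  by rewrite opprK.
have [r [S1 S2] pc] := basic_aniso_constant an cs.
rewrite map_id_roots in S1 S2.
have r3 : r = 3.
  have st j : (j <= 3)%N -> a - a *+ j \in 0 :: D.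
    case: j => [|[|[|[|//]]]] _.
    - by rewrite subr0 inE aD orbT.
    - by rewrite subrr inE eqxx.
    - by rewrite mulr2n opprD addrA subrr add0r inE naD orbT.
    - by rewrite !mulrS mulr0n addr0 opprD addrA subrr add0r inE na2D orbT.
  apply/eqP; rewrite eqn_leq; apply/andP; split; rewrite leqNgt; apply/negP => lt.
    move: na3D; rewrite -(_ : a - a *+ 4 = - (a *+ 3)) ?S1 //.
    by rewrite mulrS opprD addrA subrr add0r.
  by move: S2; rewrite st.
rewrite r3 in pc; rewrite E scalerA; apply: (spanZ ZK).
  have e4 : (4%:R : K) = 2 * 2 by rewrite -natrM.
  by case: pc => ->; rewrite e4 ?mulrN mulKf //; [|apply: (subringN ZK)]; apply: (subring_nat _ ZK).
by apply: (span_in ZK); exists (inl (SeqSub a2D)).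
Qed.

Theorem basic_kostant_data : kostant_data D H X.
Proof.
apply: (chevalley_kostant_data char0 D_uniq h_even centerless chev) => //.
- exact: basic_zero_notin.
- by move=> a aD _; have [] := basic_symm aD.
- exact: basic_even_aniso.
- exact: basic_even_cor.
- move=> a aD Xa [/(odd_rootP D_uniq D_roots HXb Xhom Hb HH HXw basic_zero_notin) [_]].
  by rewrite Xa.
- by move=> a b _ _ [].
- by move=> a b aD bD _ _; apply: basic_cor_int.
- by move=> a b aD _ bD; apply: basic_cor_int.
- exact: basic_odd_square.
Qed.

End Basic.

(** * Type P(n) *)

Section FormalRoots.
Variable n : nat.
Implicit Types (v w : 'rV[int]_n.+1) (i j k : 'I_n.+1).

(** Two vectors that agree on trace-zero diagonals differ by a multiple of (1, ..., 1), of height n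
    + 1. Formal roots have height 0, 2 or -2, so heights tell whether an equality of functionals
    lifts to a formal one. *)
Definition height v : int := \sum_i v 0 i.

Lemma heightD v w : height (v + w) = height v + height w.
Proof. by rewrite /height -big_split; apply: eq_bigr => i _; rewrite mxE. Qed.

Lemma heightN v : height (- v) = - height v.
Proof. by rewrite /height -sumrN; apply: eq_bigr => i _; rewrite mxE. Qed.

Lemma epsE i k : eps i 0 k = (k == i)%:R.
Proof. by rewrite mxE eqxx. Qed.

Lemma sum_eps (R : pzSemiRingType) (f : 'I_n.+1 -> R) i : \sum_k (k == i)%:R * f k = f i.
Proof.
rewrite (bigD1 i) //= eqxx mul1r big1 ?addr0 // => k /negPf ->.
by rewrite mul0r.
Qed.

Lemma height_eps i : height (eps i) = 1.
Proof. by rewrite -[RHS](sum_eps (fun=> 1) i); apply: eq_bigr => k _; rewrite epsE mulr1. Qed.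

Lemma formal_height v : P_formal_root v -> height v \in [:: 0; 2; -2].
Proof.
case=> [[i [j [_ [] ->]]] | [i ->]]; rewrite ?mulr2n ?heightN !heightD ?heightN !height_eps //.
Qed.

Lemma formal_neq0 v : P_formal_root v -> v != 0.
Proof.
move=> fv; apply/eqP => v0; case: fv => [[i [j [ij]]] | [i]]; last first.
  by move=> E; have := congr1 (fun w : 'rV[int]_n.+1 => w 0 i) (etrans (esym v0) E); rewrite mulr2n !mxE !eqxx.
by case=> E; have := congr1 (fun w : 'rV[int]_n.+1 => w 0 i) (etrans (esym v0) E); rewrite !mxE !eqxx (negPf ij).
Qed.

(** By heights only eps_i - eps_j could have a root as its double; that double has height 0 and a
    coordinate equal to 2, which no root has. *)
Lemma formal_double v : P_formal_root v -> ~ P_formal_root (v + v).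
Proof.
move=> fv fv2; have := formal_height fv2; rewrite heightD.
have := formal_height fv; rewrite !inE => hv hv2.
have h0 : height v = 0 by lia.
case: fv => [[i [j [ij vE]]] | [i vE]]; last first.
  by move: h0; rewrite vE mulr2n heightD height_eps.
have {}vE : v = eps i - eps j.
  by case: vE => vE //; move: h0; rewrite vE ?heightN heightD !height_eps.
have vi : (v + v) 0 i = 2 by rewrite vE !mxE !eqxx (negPf ij).
have hvv : height (v + v) = 0 by rewrite heightD h0.
case: fv2 => [[k [l [kl [] E]]] | [k E]].
- by move: vi; rewrite E !mxE; case: (i == k); case: (i == l).
- by move: hvv; rewrite E heightD !height_eps.
- by move: hvv; rewrite E heightN heightD !height_eps.
- by move: hvv; rewrite E mulr2n heightD !height_eps.
Qed.

Lemma formal_opp_double i : ~ P_formal_root (- (eps i *+ 2)).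
Proof.
move=> f; have hE : height (- (eps i *+ 2)) = -2 by rewrite heightN mulr2n heightD height_eps.
have vi : (- (eps i *+ 2)) 0 i = -2 by rewrite mulr2n !mxE !eqxx.
case: f => [[k [l [kl [] E]]] | [k E]].
- by move: hE; rewrite E heightD heightN !height_eps.
- by move: hE; rewrite E heightD !height_eps.
- move: vi; rewrite E !mxE; case: (eqVneq i k) => [-> | _]; last by case: (i == l).
  by rewrite (negPf kl).
- by move: hE; rewrite E mulr2n heightD !height_eps.
Qed.

Definition sqnorm v : int := \sum_k v 0 k * v 0 k.

(** The quantity is n + 1 times the squared length of the projection of v to the hyperplane of
    height 0, that is (n + 1)(a, a) when v lifts a root a. For n = 1 it would vanish at eps_0 +
    eps_1. *)
Lemma formal_norm v : (2 <= n)%N -> P_formal_root v -> n.+1%:Z * sqnorm v - height v * height v != 0.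
Proof.
move=> n2.
have sq2 i j (e : int) : i != j -> e * e = 1 -> sqnorm (eps i + e *: eps j) = 2.
  move=> ij ee; rewrite /sqnorm.
  under eq_bigr => k _ do rewrite !mxE eqxx /=.
  transitivity (\sum_k ((k == i)%:R * 1 + (k == j)%:R * 1) : int); last by rewrite big_split /= !sum_eps.
  apply: eq_bigr => k _; case: (eqVneq k i) => [-> | _].
    by rewrite (negPf ij) mulr0n mulr1n; ring.
  by case: (k == j); rewrite ?mulr0n ?mulr1n ?mulr0 ?mulr1 !add0r // mulr0.
case=> [[i [j [ij [] ->]]] | [i ->]].
- have -> : sqnorm (eps i - eps j) = 2 by rewrite -[RHS](sq2 i j (-1)) // scaleN1r.
  by rewrite heightD heightN !height_eps; lia.
- have -> : sqnorm (eps i + eps j) = 2 by rewrite -[RHS](sq2 i j 1) // scale1r.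
  by rewrite heightD !height_eps; lia.
- have -> : sqnorm (- (eps i + eps j)) = 2.
    rewrite -[RHS](sq2 i j 1) // scale1r; apply: eq_bigr => k _.
    by rewrite [X in X * X]mxE mulrNN.
  by rewrite heightN heightD !height_eps; lia.
- have -> : sqnorm (eps i *+ 2) = 4.
    rewrite -[RHS](sum_eps (fun=> 4) i); apply: eq_bigr => k _.
    by rewrite mulr2n !mxE eqxx; case: (k == i).
  by rewrite mulr2n heightD !height_eps; lia.
Qed.

End FormalRoots.

Section PCase.
Variables (K : fieldType) (char0 : [pchar K] =i pred0) (g : lieSuper K) (h : {vspace g}).
Variables (D : seq (hdual h)) (H : 'I_(\dim h) -> subvs_of h) (X : hdual h -> g).
Hypothesis D_uniq : uniq D.
Hypothesis D_roots : forall a : hdual h, a \in D <-> is_root a.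
Hypothesis h_even : (h <= spart g false)%VS.
Hypothesis centerless : forall x : g, (forall y : g, sbr x y = 0) -> x = 0.
Variables (n : nat) (psi : 'Hom('M[K]_(n.+1 + n.+1), g)).
Variables (lift : hdual h -> 'rV[int]_n.+1).
Variables (form : subvs_of h -> subvs_of h -> K) (cor : hdual h -> subvs_of h).
Hypothesis n2 : (2 <= n)%N.
Hypothesis n3 : n <> 3.
Hypothesis psi_model : P_model psi.
Hypothesis psi_cartan : P_cartan h psi.
Hypothesis psi_lift : P_lift psi D lift.
Hypothesis psi_form : P_form psi form.
Hypothesis psi_cor : P_coroots psi D lift cor.
Hypothesis chev : chevalley_axioms form cor lift (P_exceptional lift) (P_negative_odd lift) D H X.

Let ZK := Zint_subring K.
Let HXb := chev_basis chev.
Let Hb := chev_Hbasis chev.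
Let HH := chev_HH chev.
Let HXw := chev_HX chev.
Let Xhom := chev_hom chev.

Definition formal_eval (v : 'rV[int]_n.+1) (d : 'rV[K]_n.+1) : K := \sum_i (v 0 i)%:~R * d 0 i.

Lemma formal_evalD v w d : formal_eval (v + w) d = formal_eval v d + formal_eval w d.
Proof. by rewrite /formal_eval -big_split; apply: eq_bigr => i _; rewrite mxE rmorphD mulrDl. Qed.

Lemma formal_evalN v d : formal_eval (- v) d = - formal_eval v d.
Proof. by rewrite /formal_eval -sumrN; apply: eq_bigr => i _; rewrite mxE rmorphN mulNr. Qed.

Lemma formal_eval_eps i d : formal_eval (eps i) d = d 0 i.
Proof. by rewrite -(sum_eps (fun k => d 0 k) i); apply: eq_bigr => k _; rewrite epsE; case: (k == i). Qed.

Lemma coords_exist (d : 'rV[K]_n.+1) : \sum_i d 0 i = 0 -> exists u : subvs_of h, P_coords psi u d.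
Proof.
move=> d0; have uh : psi (P_diag d) \in h by apply/psi_cartan; exists d.
by exists (Subvs uh).
Qed.

Lemma coords_all (u : subvs_of h) : exists d, P_coords psi u d.
Proof. by have /psi_cartan [d [d0 E]] := subvsP u; exists d. Qed.

Lemma lift_ev a u d : a \in D -> P_coords psi u d -> a u = formal_eval (lift a) d.
Proof. by move=> aD ud; have [_ E] := psi_lift aD; apply: E. Qed.

Lemma lift_formal a : a \in D -> P_formal_root (lift a).
Proof. by move=> aD; have [] := psi_lift aD. Qed.

Definition coroot_diag (i j : 'I_n.+1) : 'rV[K]_n.+1 := P_coroot_diag K i j.

Lemma coroot_diagE i j k : coroot_diag i j 0 k = (k == i)%:R - (k == j)%:R.
Proof. by rewrite !mxE !eqxx. Qed.

Lemma coroot_diag_sum i j : \sum_k coroot_diag i j 0 k = 0.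
Proof.
under eq_bigr => k _ do rewrite coroot_diagE.
have s1 (l : 'I_n.+1) : \sum_k (k == l)%:R = 1 :> K.
  by rewrite -[RHS](sum_eps (fun=> 1) l); apply: eq_bigr => k _; rewrite mulr1.
by rewrite sumrB !s1 subrr.
Qed.

Lemma formal_eval_coroot v i j : formal_eval v (coroot_diag i j) = (v 0 i - v 0 j)%:~R.
Proof.
rewrite /formal_eval; under eq_bigr => k _ do rewrite coroot_diagE mulrBr mulrC [X in _ - X]mulrC.
by rewrite sumrB !sum_eps rmorphB.
Qed.

(* A formal weight vanishing on trace-zero diagonals is constant, hence has
   height divisible by n + 1; small heights force it to vanish unless n = 3. *)
Lemma formal_eval_separates v : (forall d : 'rV[K]_n.+1, \sum_i d 0 i = 0 -> formal_eval v d = 0) ->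
  height v \in [:: 0; 2; -2; 4; -4] -> v = 0.
Proof.
move=> v0 hv; have const i j : v 0 i = v 0 j.
  apply/eqP; rewrite -subr_eq0; apply/eqP/(intK_inj char0).
  by rewrite -formal_eval_coroot v0 // coroot_diag_sum.
have hE : height v = n.+1%:Z * v 0 0.
  rewrite /height (eq_bigr (fun=> v 0 0)) // sumr_const card_ord.
  by rewrite -mulr_natl natz.
have v00 : v 0 0 = 0.
  rewrite hE !inE in hv; move: (v 0 0) hv => z hv; have [z0 | z0] := EM (z = 0) => //.
  have [z1 | z1] : z <= -1 \/ 1 <= z by lia.
    have : n.+1%:Z * z <= - n.+1%:Z by nia.
    have [z2 | z2] : z = -1 \/ z <= -2 by lia.
      by rewrite z2 in hv *; lia.
    have : n.+1%:Z * z <= - (2 * n.+1%:Z) by nia.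
    by lia.
  have [z2 | z2] : z = 1 \/ 2 <= z by lia.
    by rewrite z2 in hv *; lia.
  have : 2 * n.+1%:Z <= n.+1%:Z * z by nia.
  by lia.
by apply/rowP => i; rewrite (const i 0) v00 mxE.
Qed.

Lemma P_liftD a b s : a \in D -> b \in D -> s \in D -> lift s = lift a + lift b -> s = a + b.
Proof.
move=> aD bD sD E; apply/lfunP => u; have [d ud] := coords_all u.
by rewrite add_lfunE !(lift_ev _ ud) // E formal_evalD.
Qed.

Lemma P_zero_notin : 0 \notin D.
Proof.
apply/negP => D0; have fv := lift_formal D0; case/eqP: (formal_neq0 fv).
apply: formal_eval_separates => [d d0|].
  by have [u ud] := coords_exist d0; rewrite -(lift_ev D0 ud) zero_lfunE.
by have := formal_height fv; rewrite !inE => /or3P[] ->; rewrite ?orbT.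
Qed.

Lemma P_liftN a : a \in D -> - a \in D -> lift (- a) = - lift a.
Proof.
move=> aD naD; apply/eqP; rewrite -addr_eq0; apply/eqP/formal_eval_separates => [d d0|].
  have [u ud] := coords_exist d0; rewrite formal_evalD -(lift_ev aD ud) -(lift_ev naD ud).
  by rewrite opp_lfunE addNr.
have := formal_height (lift_formal aD); have := formal_height (lift_formal naD).
by rewrite heightD !inE; lia.
Qed.

Lemma P_mx_model : mx_model (@P_mx K n) (fun M => M = 0) psi.
Proof. exact: psi_model. Qed.

Definition even_mx (A : 'M[K]_n.+1) : 'M[K]_(n.+1 + n.+1) := block_mx A 0 0 (- A^T).

Lemma even_mx_P A : \tr A = 0 -> P_mx (even_mx A).
Proof.
by move=> trA; split; rewrite ?block_mxKul ?block_mxKdr ?block_mxKur ?block_mxKdl ?trmx0 ?oppr0.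
Qed.

Lemma even_mx_part A : smx_part false (even_mx A) = even_mx A.
Proof. by rewrite /smx_part block_mxKul block_mxKdr. Qed.

Lemma P_diag_even d : P_diag d = even_mx (diag_mx d).
Proof. by rewrite /P_diag /even_mx tr_diag_mx. Qed.

Lemma even_mx_br A A' : smx_br (even_mx A) (even_mx A') = even_mx (A *m A' - A' *m A).
Proof.
rewrite /smx_br !big_bool !even_mx_part.
have part1 C : smx_part true (even_mx C) = 0 by rewrite /smx_part block_mxKur block_mxKdl block_mx0.
rewrite !part1 !mulmx0 !mul0mx !scaler0 !subr0 /= !add0r !scale1r /even_mx !mulmx_block.
rewrite !mulmx0 !mul0mx !addr0 !add0r opp_block_mx add_block_mx !subr0 !mulmxN !mulNmx !opprK.
by rewrite linearB /= !trmx_mul opprB.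
Qed.

Lemma even_mx_inj A A' : \tr A = 0 -> \tr A' = 0 -> psi (even_mx A) = psi (even_mx A') -> A = A'.
Proof.
move=> trA trA' E; have [_ _ _ ker] := P_mx_model.
have : even_mx (A - A') = 0.
  apply/(ker _ (even_mx_P _)); first by rewrite linearB /= trA trA' subrr.
  have -> : even_mx (A - A') = even_mx A - even_mx A'.
    rewrite /even_mx opp_block_mx add_block_mx !subr0 linearB /= opprB opprK; congr block_mx; exact: addrC.
  by rewrite linearB /= E subrr.
move/(congr1 (@ulsubmx K _ _ _ _)); rewrite block_mxKul => /eqP.
by rewrite [ulsubmx 0](_ : _ = 0) ?subr_eq0 => [/eqP //|]; apply/matrixP => i j; rewrite !mxE.
Qed.

Lemma even_mx_scale c A : even_mx (c *: A) = c *: even_mx A.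
Proof. by rewrite /even_mx scale_block_mx !scaler0 linearZ /= scalerN. Qed.

Lemma psi_diag_br (u : subvs_of h) d A : P_coords psi u d -> \tr A = 0 ->
  sbr (val u) (psi (even_mx A)) = psi (even_mx (\matrix_(i, j) ((d 0 i - d 0 j) * A i j))).
Proof.
move=> [d0 ->] trA; have [_ br _ _] := P_mx_model.
have trd : \tr (diag_mx d) = 0 by rewrite mxtrace_diag.
rewrite P_diag_even -br; try exact: even_mx_P.
rewrite even_mx_br; congr (psi (even_mx _)); apply/matrixP => i j.
by rewrite mul_diag_mx mul_mx_diag !mxE mulrBl [A i j * _]mulrC.
Qed.

Lemma even_vec_mx x : x \in spart g false -> exists2 A, \tr A = 0 & x = psi (even_mx A).
Proof.
move=> x0; have [pp _ sur _] := P_mx_model.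
have [M [M1 M2 M3 M4] E] := sur x.
exists (ulsubmx M) => //.
have ME : M = even_mx (ulsubmx M) + block_mx 0 (ursubmx M) (dlsubmx M) 0.
  by rewrite /even_mx add_block_mx !addr0 !add0r -M2 submxK.
set M' := block_mx _ _ _ _ in ME.
have P' : P_mx M'.
  split; rewrite ?block_mxKul ?block_mxKdr ?block_mxKur ?block_mxKdl ?mxtrace0 ?trmx0 ?oppr0 //.
have p1 : psi M' \in spart g true.
  by apply: pp => //; rewrite /smx_part block_mxKur block_mxKdl.
have p0 : psi (even_mx (ulsubmx M)) \in spart g false.
  by apply: pp; [exact: even_mx_P | exact: even_mx_part].
have xE : x = psi (even_mx (ulsubmx M)) + psi M' by rewrite -linearD -ME.
have M'0 : psi M' = 0.
  by apply: spart_disjoint p1; rewrite -[psi M'](addKr (psi (even_mx (ulsubmx M)))) -xE memvD // memvN.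
by rewrite {1}xE M'0 addr0.
Qed.

(** If the matrix A of X_a has a nonzero entry at (i, j), bracketing with diagonal matrices shows
    that a is d_i - d_j on h; the difference of the formal weights has height 0, 2 or -2 and must
    vanish. *)
Lemma even_lift a : a \in D -> X a \in spart g false ->
  exists i j, i != j /\ lift a = eps i - eps j.
Proof.
move=> aD Xa; have [A trA XE] := even_vec_mx Xa.
have A0 : A <> 0.
  move=> A0; have /eqP := X_neq0 D_uniq HXb aD; apply; rewrite XE A0.
  by rewrite /even_mx trmx0 oppr0 block_mx0 linear0.
have [i [j Aij]] : exists i j, A i j != 0.
  apply: contrapT => no; apply: A0; apply/matrixP => i j; rewrite mxE; apply/eqP.
  by apply: contrapT => /negP Aij; apply: no; exists i, j.
have aE u d : P_coords psi u d -> a u = d 0 i - d 0 j.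
  move=> ud; have := X_root_space Hb HXw aD u; rewrite XE (psi_diag_br ud trA) -linearZ -even_mx_scale.
  move/even_mx_inj => E; have {}E : \matrix_(i, j) ((d 0 i - d 0 j) * A i j) = a u *: A.
    apply: E; last by rewrite mxtraceZ trA mulr0.
    by rewrite /mxtrace big1 // => k _; rewrite mxE subrr mul0r.
  have := congr1 (fun M : 'M[K]_n.+1 => M i j) E; rewrite !mxE.
  by move/(mulIf Aij).
have ij : i != j.
  apply/eqP => ij; have := P_zero_notin; suff -> : 0 = a by rewrite aD.
  by apply/lfunP => u; have [d ud] := coords_all u; rewrite zero_lfunE (aE _ _ ud) ij subrr.
exists i, j; split=> //; apply/eqP; rewrite -subr_eq0; apply/eqP/formal_eval_separates => [d d0|].
  have [u ud] := coords_exist d0.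
  by rewrite formal_evalD !formal_evalN formal_evalD formal_evalN !formal_eval_eps -(lift_ev aD ud) (aE _ _ ud) subrr.
have := formal_height (lift_formal aD).
by rewrite heightD heightN heightD heightN !height_eps !inE; lia.
Qed.

Lemma even_lift_height a : a \in D -> X a \in spart g false -> height (lift a) = 0.
Proof. by move=> aD Xa; have [i [j [_ ->]]] := even_lift aD Xa; rewrite heightD heightN !height_eps. Qed.

Lemma P_even_symm a : a \in D -> X a \in spart g false -> - a \in D.
Proof.
move=> aD Xa; have [i [j [ij aE]]] := even_lift aD Xa.
have tr0 : \tr (delta_mx j i : 'M[K]_n.+1) = 0.
  by rewrite /mxtrace big1 // => k _; rewrite mxE; case: (eqVneq k j) => // ->; rewrite eq_sym (negPf ij).
apply/D_roots; left; split.
  by move/eqP; rewrite oppr_eq0 => /eqP a0; have := P_zero_notin; rewrite -a0 aD.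
(* For a = eps_i - eps_j the elementary matrix at (j, i) is a vector of weight - a. *)
exists (psi (even_mx (delta_mx j i))); split.
- move=> E; have : (delta_mx j i : 'M[K]_n.+1) = 0.
    apply: even_mx_inj => //; first by rewrite mxtrace0.
    by rewrite E /even_mx trmx0 oppr0 block_mx0 linear0.
  move/(congr1 (fun M : 'M[K]_n.+1 => M j i)); rewrite !mxE !eqxx => /eqP.
  by rewrite oner_eq0.
- by have [pp _ _ _] := P_mx_model; apply: pp; [exact: even_mx_P | exact: even_mx_part].
move=> u; have [d ud] := coords_all u; rewrite (psi_diag_br ud tr0) -linearZ -even_mx_scale.
congr (psi (even_mx _)); apply/matrixP => k l; rewrite !mxE opp_lfunE (lift_ev aD ud) aE.
rewrite formal_evalD formal_evalN !formal_eval_eps opprB; case: (eqVneq k j) => [-> | _]; last by rewrite !mulr0.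
by case: (eqVneq l i) => [-> // | _]; rewrite !mulr0.
Qed.

Lemma P_lift2 a : a \in D -> X a \in spart g false -> a + a \in D -> lift (a + a) = lift a + lift a.
Proof.
move=> aD Xa a2D; apply/eqP; rewrite -subr_eq0; apply/eqP/formal_eval_separates => [d d0|].
  have [u ud] := coords_exist d0.
  by rewrite formal_evalD formal_evalN formal_evalD -(lift_ev aD ud) -(lift_ev a2D ud) add_lfunE subrr.
have := formal_height (lift_formal a2D); rewrite heightD heightN heightD (even_lift_height aD Xa).
by rewrite !inE; lia.
Qed.

Lemma P_aniso a : a \in D -> anisotropic form a.
Proof.
move=> aD; set v := lift a; have N0 : (n.+1%:R : K) != 0 := natK_neq0 char0 n.
(* The element dual to a: the lift of a projected to the trace-zero diagonals. *)
pose d : 'rV[K]_n.+1 := \row_i ((v 0 i)%:~R - (height v)%:~R / n.+1%:R).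
have d0 : \sum_i d 0 i = 0.
  under eq_bigr => i _ do rewrite mxE.
  rewrite sumrB sumr_const card_ord -[_ *+ n.+1]mulr_natr divfK // /height rmorph_sum subrr.
  by [].
have [t td] := coords_exist d0.
have formE u e : P_coords psi u e -> form t u = formal_eval v e.
  move=> ue; rewrite (psi_form td ue) mulmx_diag mxtrace_diag.
  under eq_bigr => i _ do rewrite !mxE mulrBl.
  rewrite sumrB -mulr_sumr; have [-> _] := ue; rewrite mulr0 subr0.
  by [].
exists t; first by move=> u; have [e ue] := coords_all u; rewrite (formE _ _ ue) (lift_ev aD ue).
rewrite (formE _ _ td) => E.
have /eqP := formal_norm n2 (lift_formal aD); apply; apply: (intK_inj char0).
rewrite rmorphB !rmorphM /= -/v.
have -> : (sqnorm v)%:~R = \sum_i (v 0 i)%:~R * (v 0 i)%:~R :> K.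
  by rewrite rmorph_sum; apply: eq_bigr => i _; rewrite rmorphM.
move: E; rewrite /formal_eval; under eq_bigr => i _ do rewrite mxE mulrBr.
rewrite sumrB -mulr_suml => /eqP; rewrite subr_eq0 => /eqP ->.
rewrite -rmorph_sum /= -/(height v) -[(n.+1%:Z)%:~R]/(n.+1%:R : K) mulr0z.
move: (height v)%:~R (n.+1%:R) N0 => ht N N0.
by field.
Qed.

Lemma P_even_cor a : a \in D -> X a \in spart g false -> a (cor a) = 2.
Proof.
move=> aD Xa; have [i [j [ij aE]]] := even_lift aD Xa.
have [/(_ ij aE) ud _ _] := psi_cor i j aD.
rewrite (lift_ev aD ud) formal_eval_coroot aE !mxE !eqxx (negPf ij) eq_sym (negPf ij).
by [].
Qed.

Lemma P_cor_int a b : a \in D -> - a \in D -> b \in D -> Zint (b (cor a) : K).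
Proof.
move=> aD naD bD.
have key u i j : P_coords psi u (P_coroot_diag K i j) -> Zint (b u : K).
  by move=> ud; rewrite (lift_ev bD ud) formal_eval_coroot; apply: Zint_int.
case: (lift_formal aD) => [[i [j [ij]]] | [i aE]]; last first.
  by have := lift_formal naD; rewrite P_liftN // aE => /formal_opp_double.
(* The coroots of the roots eps_i + eps_j and their opposites are prescribed for i < j only, whereas
   those of eps_i - eps_j are prescribed for both orders. *)
wlog lt_ij : i j ij / (i < j)%N \/ lift a = eps i - eps j.
  move=> W [] aE.
  - by apply: (W i j) => //; [right | constructor 1].
  - have [lt | le] := ltnP i j; first by apply: (W i j) => //; [left | constructor 2].
    apply: (W j i); rewrite 1?eq_sym //; last by constructor 2; rewrite addrC.
    by left; rewrite ltn_neqAle le eq_sym andbT.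
  - have [lt | le] := ltnP i j; first by apply: (W i j) => //; [left | constructor 3].
    apply: (W j i); rewrite 1?eq_sym //; last by constructor 3; rewrite addrC.
    by left; rewrite ltn_neqAle le eq_sym andbT.
have [c1 c2 c3] := psi_cor i j aD.
have hE := congr1 (@height n).
case=> aE.
- exact: key (c1 ij aE).
- case: lt_ij => [lt | aE']; first exact: key (c2 lt aE).
  by move: aE; rewrite aE' => /hE; rewrite !heightD heightN !height_eps.
- case: lt_ij => [lt | aE']; last first.
    by move: aE; rewrite aE' => /hE; rewrite heightN !heightD heightN !height_eps.
  by have := key _ _ _ (c3 lt aE); rewrite linearN => /(subringN ZK); rewrite opprK.
Qed.

Lemma P_odd_square a : a \in D -> sbr (X a) (X a) = 0.
Proof.
move=> aD; case: chev => _ _ _ _ XX.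
have [E _] := XX a a aD aD (root_neq_opp char0 P_zero_notin aD); apply: E.
apply/mapP => -[s sD sE]; apply: (formal_double (lift_formal aD)).
by rewrite sE; apply: lift_formal.
Qed.

Theorem P_kostant_data : kostant_data D H X.
Proof.
apply: (chevalley_kostant_data char0 D_uniq h_even centerless chev).
- exact: P_zero_notin.
- exact: P_liftD.
- exact: P_liftN.
- exact: P_lift2.
- exact: P_even_symm.
- by move=> a aD _; apply: P_aniso.
- exact: P_even_cor.
- move=> a aD Xa [i [j [_ E]]]; have := even_lift_height aD Xa.
  by rewrite E heightN heightD !height_eps.
- move=> a b aD Xa [i [j [_ E _]]]; have := even_lift_height aD Xa.
  by rewrite E heightD !height_eps.
- by move=> a b aD _ /(_ (P_aniso aD)).
- exact: P_cor_int.
- by move=> a aD _; rewrite P_odd_square // scaler0; constructor.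
Qed.

End PCase.

Theorem theorem4p3p1 (K : closedFieldType) (charK0 : [pchar K] =i pred0)
  (g : lieSuper K) (g_classical : classical g)
  (g_notA11 : ~ type_A11 g) (g_notP3 : ~ type_P 3 g)
  (g_notQ : forall n : nat, (2 <= n)%N -> ~ type_Q n g)
  (g_notD21 : ~ type_D21_nonintegral g)
  (h : {vspace g}) (h_cartan : cartan_subalgebra h)
  (* D lists the roots without repetition *)
  (D : seq (hdual h)) (D_uniq : uniq D)
  (D_roots : forall a : hdual h, a \in D <-> is_root a)
  (H : 'I_(\dim h) -> subvs_of h) (X : hdual h -> g)
  (HX_chevalley : chevalley_basis D H X)
  (U : algType K) (iota : g -> U) (U_env : universal_enveloping iota) :
  is_Zfree (kostant H X iota) /\
  forall le : rel (pbw_index D),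
    total le -> antisymmetric le -> transitive le ->
    is_Zbasis (kostant H X iota) (@pbw_exponent _ _ _ D)
      (pbw_monomial H X iota le).
Proof.
have [h_even _ _ _] := h_cartan.
have centerless := @classical_center _ _ g_classical.
have notP3 n (psi : 'Hom('M[K]_(n.+1 + n.+1), g)) : P_model psi -> n <> 3.
  by move=> model n3; subst n; apply: g_notP3; exists psi.
have [kd [evenP oddP]] : kostant_data D H X /\
    ((forall a : hdual h, even_root a <-> a \in D /\ X a \in spart g false) /\
     (forall a : hdual h, odd_root a <-> a \in D /\ X a \notin spart g false)).
  case: HX_chevalley => [B Pi cor notP formB _ corB chev | n psi lift form cor n2 model cart plift pform pcor chev].
    have kd := basic_kostant_data charK0 D_uniq D_roots h_even centerless formB corB chev.
    split=> //; split=> a.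
      exact: (even_rootP D_uniq D_roots (kd_basis kd) (chev_Hbasis chev) (kd_HH kd) (kd_HX kd) (kd_zero kd)).
    exact: (odd_rootP D_uniq D_roots (kd_basis kd) (kd_hom kd) (chev_Hbasis chev) (kd_HH kd) (kd_HX kd) (kd_zero kd)).
  have n3 := notP3 _ _ model.
  have kd := P_kostant_data charK0 D_uniq D_roots h_even centerless n2 n3 model cart plift pform pcor chev.
  split=> //; split=> a.
    exact: (even_rootP D_uniq D_roots (kd_basis kd) (chev_Hbasis chev) (kd_HH kd) (kd_HX kd) (kd_zero kd)).
  exact: (odd_rootP D_uniq D_roots (kd_basis kd) (kd_hom kd) (chev_Hbasis chev) (kd_HH kd) (kd_HX kd) (kd_zero kd)).
have basis := kostant_Zbasis charK0 kd evenP oddP U_env.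
split; first exact: Zbasis_free (basis _ (enum_uniq _) (mem_enum _)).
move=> le _ _ _; apply: basis => [|k]; first by rewrite sort_uniq enum_uniq.
by rewrite mem_sort mem_enum.
Qed.
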